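(* Let $\mu$ be a positive NC measure which is a finitely-correlated Cuntz--Toeplitz functional. The following are equivalent: (1) The NC rational multiplier $\mathfrak b\in[\mathbb H^\infty_d]_1$ such that $\mu=\mu_{\mathfrak b}$ is inner. (2) $\Pi_\mu$ is purely Cuntz (i.e. a surjective row isometry). (3) $T_\mu$ is a finite-dimensional row co-isometry. (4) $\Pi_\mu$ is purely of dilation type. (5) $\mu$ is a singular NC measure.
   Context: Fix $d\ge2$. $\mathbb F^d$ is the free monoid of words in $1,\dots,d$; for $\omega=i_1\cdots i_m$ and a $d$-tuple $A$ of operators, $A^\omega:=A_{i_1}\cdots A_{i_m}$, $A^{*\omega}:=(A^\omega)^*$. $\bigvee$ denotes closed linear span. $\mathbb H^2_d$ is the Hilbert space of power series $\sum_\omega\hat h_\omega\mathfrak z^\omega$ in non-commuting variables $\mathfrak z_1,\dots,\mathfrak z_d$ with square-summable coefficients; $L_k$ is left multiplication by $\mathfrak z_k$. $\mathbb B^d_{\mathbb N}=\bigsqcup_n\mathbb B^d_n$, $\mathbb B^d_n$ the set of $d$-tuples $Z$ of $n\times n$ matrices with $\sum_jZ_jZ_j^*<I_n$. $\mathbb H^\infty_d$ is the algebra of NC functions uniformly bounded on $\mathbb B^d_{\mathbb N}$, identified isometrically with the left multipliers of $\mathbb H^2_d$; $[\mathbb H^\infty_d]_1$ is its closed unit ball; a multiplier is inner if the multiplication operator is isometric; it is NC rational if it is given on $\mathbb B^d_{\mathbb N}$ by an NC rational expression (built from $\mathfrak z_1,\dots,\mathfrak z_d$, scalars, $+,\cdot,{}^{-1}$).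 $\mathbb A_d=\mathrm{Alg}\{I,L_1,\dots,L_d\}^{-\|\cdot\|}$, $\mathscr A_d=(\mathbb A_d+\mathbb A_d^* )^{-\|\cdot\|}$; a positive NC measure is a positive linear functional on $\mathscr A_d$. $H_\mu(Z)=(\mathrm{id}_n\otimes\mu)((I+ZL^* )(I-ZL^* )^{-1})$, $ZL^*=\sum_jZ_j\otimes L_j^*$, $Z\in\mathbb B^d_n$. For $b\in[\mathbb H^\infty_d]_1$, $b\not\equiv1$, the NC Clark measure $\mu_b$ is the unique positive NC measure with $(I_n+b(Z))(I_n-b(Z))^{-1}=H_{\mu_b}(Z)+itI_n$ on $\mathbb B^d_n$ for all $n$, $t=\mathrm{Im}\frac{1+b(0)}{1-b(0)}$ ($b$ is determined by $\mu$ up to the choice of $t\in\mathbb R$). The GNS space $\mathbb H^2_d(\mu)$ is the completion of free polynomials modulo zero-length vectors $N_\mu$ for $\langle p,q\rangle_\mu=\mu(p(L)^*q(L))$, with GNS row isometry $\Pi_{\mu;k}(p+N_\mu)=\mathfrak z_kp+N_\mu$. $\mu$ is a finitely-correlated Cuntz--Toeplitz functional if $\mathcal H_\mu:=\bigvee_\omega\Pi_\mu^{*\omega}(1+N_\mu)$ is finite-dimensional; then $T_\mu:=(\Pi_\mu^*|_{\mathcal H_\mu})^*$ is the row contraction on $\mathcal H_\mu$ with components $T_{\mu;k}=P_{\mathcal H_\mu}\Pi_{\mu;k}|_{\mathcal H_\mu}$; it is known that every such $\mu$ is the NC Clark measure of a contractive NC rational multiplier. A row co-isometry is a row contraction $T$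 with $\sum_jT_jT_j^*=I$. Types: the free semigroup algebra of a row isometry $V$ is the WOT-closed unital algebra generated by the $V_j$. $V$ is (pure) type-$L$ if $V\simeq L\otimes I$; a Cuntz (i.e. surjective) $V$ is Cuntz type-$L$ if its free semigroup algebra is completely isometrically isomorphic and weak-$*$ homeomorphic to that of $L$; von Neumann type if its free semigroup algebra is self-adjoint; dilation type if it has no direct summand of the previous two types. By Kennedy's theorem every row isometry on a separable space decomposes uniquely as the direct sum of these four types. $\mu$ is singular (with respect to NC Lebesgue measure $m(L^\omega)=\langle1,L^\omega1\rangle$) if $\Pi_\mu$ is a direct sum of dilation type and von Neumann type Cuntz row isometries. *)

(* Defs.v *)
From HB Require Import structures.
From mathcomp Require Import all_boot all_order all_algebra.
From mathcomp Require Import boolp classical_sets functions reals topology.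
From mathcomp Require Import normedtype sequences complex.
From mathcomp Require Import ring lra.
From mathcomp Require Import -(notations) finmap.
From mathcomp Require Import -(notations) monalg.

Set Implicit Arguments.
Unset Strict Implicit.
Unset Printing Implicit Defensive.

Import Order.TTheory GRing.Theory Num.Theory.
Import numFieldNormedType.Exports.
Import ComplexField.

Local Open Scope classical_set_scope.
Local Open Scope ring_scope.
Local Open Scope complex_scope.
Local Open Scope sesquilinear_scope.

Lemma normc_ge0 (R : realType) (z : R[i]) : 0 <= Normc.normc z.
Proof. by case: z => a b; exact: sqrtr_ge0. Qed.

(* Forms are linear in the second variable, conjugate-linear in the first. *)
Definition form_norm (R : realType) (V : lmodType R[i]) (f : V -> V -> R[i])
  (x : V) : R := Num.sqrt (complex.Re (f x x)).

Definition form_complete (R : realType) (V : lmodType R[i])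
    (f : V -> V -> R[i]) : Prop :=
  forall u : nat -> V,
    (forall e : R, 0 < e -> exists N, forall m n,
       (N <= m)%N -> (N <= n)%N -> form_norm f (u m - u n) < e) ->
  exists l, forall e : R, 0 < e -> exists N, forall n,
       (N <= n)%N -> form_norm f (u n - l) < e.

HB.mixin Record Lmodule_isHilbert (R : realType) V of GRing.Lmodule R[i] V := {
  dotp : V -> V -> R[i];
  dotpPr : forall (a : R[i]) x y z,
    dotp x (a *: y + z) = a * dotp x y + dotp x z;
  dotpC : forall x y, dotp y x = (dotp x y)^*%C;
  dotp_gt0 : forall x, x != 0 -> 0 < dotp x x;
  dotp_complete : form_complete dotp
}.

#[short(type="hilbertType")]
HB.structure Definition Hilbert (R : realType) :=
  {V of GRing.Lmodule R[i] V & Lmodule_isHilbert R V}.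

Section HilbertTheory.
Context {R : realType} {H : hilbertType R}.
Implicit Types x y z : H.

Definition hnorm x : R := form_norm dotp x.

Lemma dotpDr x y z : dotp x (y + z) = dotp x y + dotp x z.
Proof. by rewrite -[y]scale1r dotpPr mul1r scale1r. Qed.

Lemma dotp0r x : dotp x 0 = 0.
Proof. by apply: (addrI (dotp x 0)); rewrite -dotpDr !addr0. Qed.

Lemma dotpZr (a : R[i]) x y : dotp x (a *: y) = a * dotp x y.
Proof. by rewrite -[_ *: _]addr0 dotpPr dotp0r addr0. Qed.

Lemma dotpDl x y z : dotp (y + z) x = dotp y x + dotp z x.
Proof. by rewrite dotpC dotpDr rmorphD /= -!dotpC. Qed.

Lemma dotpZl (a : R[i]) x y : dotp (a *: y) x = a^*%C * dotp y x.
Proof. by rewrite dotpC dotpZr rmorphM /= -!dotpC. Qed.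

Lemma dotp_ge0 x : 0 <= dotp x x.
Proof. by have [->|/dotp_gt0/ltW//] := eqVneq x 0; rewrite dotp0r. Qed.

Lemma hnorm_ge0 x : 0 <= hnorm x. Proof. exact: sqrtr_ge0. Qed.

Lemma hnorm_sqr x : hnorm x ^+ 2 = complex.Re (dotp x x).
Proof.
by rewrite sqr_sqrtr//; have := dotp_ge0 x; rewrite lecE/= => /andP[].
Qed.

Lemma hnorm0 : hnorm 0 = 0.
Proof. by rewrite /hnorm /form_norm dotp0r sqrtr0. Qed.

Lemma hnormZ (a : R[i]) x : hnorm (a *: x) = Normc.normc a * hnorm x.
Proof.
apply/eqP; rewrite -(@eqrXn2 _ 2)// ?mulr_ge0 ?hnorm_ge0 ?normc_ge0//.
rewrite exprMn !hnorm_sqr dotpZl dotpZr.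
have := dotp_ge0 x; case: (dotp x x) => c e; rewrite lecE/= => /andP[/eqP -> _].
case: (a) => b f /=; rewrite sqr_sqrtr ?addr_ge0 ?sqr_ge0//; apply/eqP; ring.
Qed.

Lemma hnormN x : hnorm (- x) = hnorm x.
Proof.
rewrite -scaleN1r hnormZ.
suff -> : Normc.normc (-1 : R[i]) = 1 by rewrite mul1r.
by rewrite /= oppr0 expr0n addr0 sqrrN expr1n sqrtr1.
Qed.

Lemma hnorm_parallel x y :
  hnorm (x + y) ^+ 2 + hnorm (x - y) ^+ 2 = (hnorm x ^+ 2 + hnorm y ^+ 2) *+ 2.
Proof.
rewrite !hnorm_sqr -!raddfD -raddfMn /=; congr complex.Re.
rewrite -[- y]scaleN1r !(dotpDl, dotpDr) !dotpZl !dotpZr rmorphN1 /=.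
rewrite !mulN1r opprK mulr2n; set a := dotp x x; set b := dotp x y.
by rewrite [dotp y x]dotpC -/b; ring.
Qed.

Lemma hnormD_le x y : hnorm (x + y) <= 2 * (hnorm x + hnorm y).
Proof.
rewrite -(@ler_pXn2r _ 2)// ?nnegrE ?mulr_ge0 ?addr_ge0 ?hnorm_ge0//.
have := hnorm_parallel x y; have := sqr_ge0 (hnorm (x - y)).
by have := hnorm_ge0 x; have := hnorm_ge0 y; nra.
Qed.

End HilbertTheory.

Section BoundedOperators.
Context {R : realType}.

Definition bounded_linear {H K : hilbertType R} (f : H -> K) : Prop :=
  linear f /\ exists c : R, forall x, hnorm (f x) <= c * hnorm x.

Definition bounded_linear_pred (H K : hilbertType R) : {pred H -> K} :=
  fun f => `[< bounded_linear f >].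

Record bop (H K : hilbertType R) := Bop {
  bop_fun :> H -> K;
  bop_funP : bop_fun \in @bounded_linear_pred H K }.

HB.instance Definition _ (H K : hilbertType R) := [isSub for @bop_fun H K].
HB.instance Definition _ (H K : hilbertType R) := [Choice of bop H K by <:].

Lemma bounded_linear_submod (H K : hilbertType R) :
  submod_closed (@bounded_linear_pred H K).
Proof.
split=> [|a f g /asboolP[lf [cf bf]] /asboolP[lg [cg bg]]]; apply/asboolP.
  split=> [b x y|]; first by rewrite scaler0 addr0.
  by exists 0 => x; rewrite mul0r (hnorm0 (H := K)).
split=> [b x y|].
  change (a *: f (b *: x + y) + g (b *: x + y) =
    b *: (a *: f x + g x) + (a *: f y + g y)).
  rewrite lf lg !scalerDr !scalerA [b * a]mulrC.
  by rewrite -!addrA; congr (_ + _); rewrite addrCA.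
exists (2 * (Normc.normc a * cf + cg)) => x.
change (hnorm (a *: f x + g x) <= 2 * (Normc.normc a * cf + cg) * hnorm x).
apply: (le_trans (hnormD_le _ _)); rewrite -mulrA ler_pM2l// mulrDl.
have n0 : 0 <= Normc.normc a by exact: normc_ge0.
by rewrite lerD// hnormZ -mulrA ler_wpM2l.
Qed.

HB.instance Definition _ (H K : hilbertType R) :=
  GRing.isSubmodClosed.Build _ _ (@bounded_linear_pred H K)
    (bounded_linear_submod H K).

HB.instance Definition _ (H K : hilbertType R) :=
  [SubChoice_isSubLmodule of bop H K by <:].

Lemma bopP {H K : hilbertType R} (S T : bop H K) : S =1 T -> S = T.
Proof. by move=> ST; apply/val_inj/funext. Qed.

Lemma bop_linear {H K : hilbertType R} (T : bop H K) : linear T.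
Proof. by case: T => f /= /asboolP[]. Qed.

HB.instance Definition _ (H K : hilbertType R) (T : bop H K) :=
  GRing.isLinear.Build _ _ _ _ (bop_fun T) (bop_linear T).

Lemma bop_bounded {H K : hilbertType R} (T : bop H K) :
  exists2 c : R, 0 <= c & forall x, hnorm (T x) <= c * hnorm x.
Proof.
case: T => f /= /asboolP[_ [c bc]].
exists (Num.max 0 c); first by rewrite le_max lexx.
move=> x; apply: (le_trans (bc x)); rewrite ler_wpM2r ?hnorm_ge0//.
by rewrite le_max lexx orbT.
Qed.

Lemma bopDE {H K : hilbertType R} (S T : bop H K) x : (S + T) x = S x + T x.
Proof. by []. Qed.

Lemma bopZE {H K : hilbertType R} a (T : bop H K) x : (a *: T) x = a *: T x.
Proof. by []. Qed.

Lemma bcomp_subproof {H K L : hilbertType R} (S : bop K L) (T : bop H K) :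
  S \o T \in @bounded_linear_pred H L.
Proof.
apply/asboolP; split=> [a x y /=|]; first by rewrite !linearP.
have [c c0 bc] := bop_bounded S; have [e e0 be] := bop_bounded T.
exists (c * e) => x /=; apply: (le_trans (bc _)).
by rewrite -mulrA ler_wpM2l.
Qed.
Definition bcomp {H K L : hilbertType R} (S : bop K L) (T : bop H K) :
    bop H L :=
  Bop (bcomp_subproof S T).

Lemma bid_subproof {H : hilbertType R} : id \in @bounded_linear_pred H H.
Proof. by apply/asboolP; split=> //; exists 1 => x; rewrite mul1r. Qed.
Definition bid {H : hilbertType R} : bop H H := Bop bid_subproof.

Section Ring.
Context {H : hilbertType R}.
Implicit Types S T U : bop H H.

Fact bcompA : associative (fun S T => bcomp S T).
Proof. by move=> S T U; apply: bopP. Qed.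
Fact bcomp1l : left_id bid (fun S T => bcomp S T).
Proof. by move=> S; apply: bopP. Qed.
Fact bcomp1r : right_id bid (fun S T => bcomp S T).
Proof. by move=> S; apply: bopP. Qed.
Fact bcompDl : left_distributive (fun S T => bcomp S T) +%R.
Proof. by move=> S T U; apply: bopP. Qed.
Fact bcompDr : right_distributive (fun S T => bcomp S T) +%R.
Proof. by move=> S T U; apply: bopP => x; exact: (linearD S). Qed.
End Ring.

HB.instance Definition _ (H : hilbertType R) :=
  GRing.Zmodule_isPzRing.Build (bop H H)
    bcompA bcomp1l bcomp1r bcompDl bcompDr.

(* The Hilbert space adjoint (its existence is the Riesz representation
   theorem, its uniqueness the nondegeneracy of the inner product). *)
Definition adj {H K : hilbertType R} (T : bop H K) : bop K H :=
  xget 0 [set S : bop K H | forall x y, dotp (T x) y = dotp x (S y)].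

(* The norm of an n x n matrix of operators, acting on the n-fold direct sum. *)
Definition mxopnorm {H : hilbertType R} n (T : 'M[bop H H]_n) : R :=
  sup [set Num.sqrt (\sum_i hnorm (\sum_j T i j (x j)) ^+ 2) |
        x in [set x : 'I_n -> H | \sum_j hnorm (x j) ^+ 2 <= 1]].

Definition opnorm {H K : hilbertType R} (T : bop H K) : R :=
  sup [set hnorm (T x) | x in [set x | hnorm x <= 1]].

Definition finite_dim (H : hilbertType R) : Prop :=
  exists n (e : 'I_n -> H), forall x, exists c : 'I_n -> R[i],
    x = \sum_k c k *: e k.

End BoundedOperators.

Section ClosedSubspaces.
Context {R : realType}.

Record clsubspace (H : hilbertType R) := ClSubspace {
  cls_set :> H -> Prop;
  cls0 : cls_set 0;
  clsP : forall (a : R[i]) x y, cls_set x -> cls_set y -> cls_set (a *: x + y);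
  cls_closed : forall x,
    (forall e : R, 0 < e -> exists2 y, cls_set y & hnorm (x - y) < e) ->
    cls_set x }.

Definition cls_pred {H : hilbertType R} (M : clsubspace H) : {pred H} :=
  fun x => `[< cls_set M x >].

Lemma cls_submod {H : hilbertType R} (M : clsubspace H) :
  submod_closed (cls_pred M).
Proof.
split; first by apply/asboolP/cls0.
by move=> a x y /asboolP Mx /asboolP My; apply/asboolP/clsP.
Qed.

HB.instance Definition _ (H : hilbertType R) (M : clsubspace H) :=
  GRing.isSubmodClosed.Build _ _ (cls_pred M) (cls_submod M).

(* A closed subspace, regarded as a Hilbert space in its own right. *)
Record subhilb (H : hilbertType R) (M : clsubspace H) := SubHilb {
  subhilb_val :> H;
  subhilb_valP : subhilb_val \in cls_pred M }.

HB.instance Definition _ (H : hilbertType R) (M : clsubspace H) :=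
  [isSub for @subhilb_val H M].
HB.instance Definition _ (H : hilbertType R) (M : clsubspace H) :=
  [Choice of subhilb M by <:].
HB.instance Definition _ (H : hilbertType R) (M : clsubspace H) :=
  [SubChoice_isSubLmodule of subhilb M by <:].

Section SubHilbert.
Context {H : hilbertType R} (M : clsubspace H).
Implicit Types x y z : subhilb M.

Definition subhilb_dotp x y : R[i] := dotp (val x) (val y).

Fact subhilb_dotpPr (a : R[i]) x y z :
  subhilb_dotp x (a *: y + z) = a * subhilb_dotp x y + subhilb_dotp x z.
Proof. exact: dotpPr. Qed.

Fact subhilb_dotpC x y : subhilb_dotp y x = (subhilb_dotp x y)^*%C.
Proof. exact: dotpC. Qed.

Fact subhilb_dotp_gt0 x : x != 0 -> 0 < subhilb_dotp x x.
Proof. by move=> x0; apply: dotp_gt0. Qed.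

Fact subhilb_complete : form_complete subhilb_dotp.
Proof.
move=> u cu; have [l ul] := @dotp_complete R H (fun n => val (u n)) cu.
have Ml : cls_set M l.
  apply: cls_closed => e e0; have [N /(_ N (leqnn N)) uN] := ul e e0.
  exists (val (u N)); first by have /asboolP := subhilb_valP (u N).
  by rewrite -hnormN opprB.
by exists (SubHilb (asboolT Ml)).
Qed.

HB.instance Definition _ := Lmodule_isHilbert.Build R (subhilb M)
  subhilb_dotpPr subhilb_dotpC subhilb_dotp_gt0 subhilb_complete.

Fact incl_subproof :
  (val : subhilb M -> H) \in @bounded_linear_pred R (subhilb M) H.
Proof. by apply/asboolP; split=> //; exists 1 => x; rewrite mul1r. Qed.
Definition incl : bop (subhilb M) H := Bop incl_subproof.

(* P_M T |_M; the adjoint of the inclusion is the orthogonal projection onto M,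
   with codomain M. *)
Definition compress (T : bop H H) : bop (subhilb M) (subhilb M) :=
  bcomp (adj incl) (bcomp T incl).

End SubHilbert.

Section ClosedSpan.
Context {H : hilbertType R} (A : set H).

Definition lspan : set H :=
  [set x | exists n (c : 'I_n -> R[i]) (a : 'I_n -> H),
     (forall k, A (a k)) /\ x = \sum_k c k *: a k].

Definition closed_span_set : set H :=
  [set x | forall e : R, 0 < e -> exists2 y, lspan y & hnorm (x - y) < e].

Fact lspanP (a : R[i]) x y : lspan x -> lspan y -> lspan (a *: x + y).
Proof.
move=> [n [c [u [Au ->]]]] [m [c' [v [Av ->]]]].
exists (n + m)%N.
exists (fun k =>
  match fintype.split k with inl i => a * c i | inr j => c' j end).
exists (fun k => match fintype.split k with inl i => u i | inr j => v j end).
split.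
  by move=> k; case: fintype.split.
rewrite big_split_ord /= scaler_sumr; congr (_ + _); apply: eq_bigr => i _.
  by rewrite scalerA (unsplitK (inl i)).
by rewrite (unsplitK (inr i)).
Qed.

Fact closed_span0 : closed_span_set 0.
Proof.
move=> e e0; exists 0; last by rewrite subrr hnorm0.
have f (T : Type) : 'I_0 -> T by case.
by exists 0%N, (f _), (f _); split; [case|rewrite big_ord0].
Qed.

Fact closed_spanP (a : R[i]) x y :
  closed_span_set x -> closed_span_set y -> closed_span_set (a *: x + y).
Proof.
have n0 : 0 <= Normc.normc a by exact: normc_ge0.
move=> sx sy e e0; pose b := Normc.normc a + 1.
have b0 : 0 < b by rewrite ltr_wpDl.
have [x' lx' xx'] := sx (e / (4 * b)) (divr_gt0 e0 (mulr_gt0 (ltr0n _ 4) b0)).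
have [y' ly' yy'] := sy (e / 4) (divr_gt0 e0 (ltr0n _ 4)).
exists (a *: x' + y'); first exact: lspanP.
rewrite opprD addrACA -scalerBr.
apply: (le_lt_trans (hnormD_le _ _)); rewrite hnormZ.
have : Normc.normc a * hnorm (x - x') <= e / 4.
  have -> : e / 4 = b * (e / (4 * b)).
    by rewrite invfM mulrCA; field; rewrite gt_eqF.
  by rewrite ler_pM ?hnorm_ge0 ?lerDl// ltW.
by lra.
Qed.

Fact closed_span_closed x :
  (forall e : R, 0 < e -> exists2 y, closed_span_set y & hnorm (x - y) < e) ->
  closed_span_set x.
Proof.
move=> cx e e0; have e4 : 0 < e / 4 by rewrite divr_gt0.
have [y cy xy] := cx _ e4; have [z lz yz] := cy _ e4.
exists z => //; rewrite -(subrK y x) -addrA.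
apply: (le_lt_trans (hnormD_le _ _)); lra.
Qed.

Definition closed_span : clsubspace H :=
  ClSubspace closed_span0 closed_spanP closed_span_closed.

End ClosedSpan.

End ClosedSubspaces.

Section ComplexSeries.
Context {R : realType}.

(* Sum of a complex series, by real and imaginary parts. *)
Definition csum (u : nat -> R[i]) : R[i] :=
  limn (series (fun n => complex.Re (u n)))
  +i* limn (series (fun n => complex.Im (u n))).

Definition ccvg (u : nat -> R[i]) : Prop :=
  cvgn (series (fun n => complex.Re (u n))) /\
  cvgn (series (fun n => complex.Im (u n))).

Lemma csum_linear (a : R[i]) u v : ccvg u -> ccvg v ->
  csum (fun n => a * u n + v n) = a * csum u + csum v.
Proof.
case: a => b c [ru iu] [rv iv].
have lim3 (k l : R) (x y z : R ^nat) :
    cvgn (series x) -> cvgn (series y) -> cvgn (series z) ->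
    limn (series (k *: x + l *: y + z)) =
    k * limn (series x) + l * limn (series y) + limn (series z).
  move=> cx cy cz; have Zx := @is_cvg_seriesZ _ x k cx.
  have Zy := @is_cvg_seriesZ _ y l cy.
  have Dxy : cvgn (series (k *: x + l *: y)) by exact: is_cvg_seriesD.
  by rewrite lim_seriesD// lim_seriesD// !lim_seriesZ.
rewrite /csum; congr (_ +i* _).
  rewrite (_ : (fun n => _) = (b *: (fun n => complex.Re (u n))
    + (- c) *: (fun n => complex.Im (u n)))
    + (fun n => complex.Re (v n))); last first.
    apply/funext => n; change (complex.Re ((b +i* c) * u n + v n) =
      b * complex.Re (u n) + - c * complex.Im (u n) + complex.Re (v n)).
    by case: (u n) (v n) => ? ? [? ?] /=; rewrite mulNr.
  by rewrite lim3// mulNr.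
rewrite (_ : (fun n => _) = (b *: (fun n => complex.Im (u n))
    + c *: (fun n => complex.Re (u n)))
    + (fun n => complex.Im (v n))); last first.
  apply/funext => n; change (complex.Im ((b +i* c) * u n + v n) =
    b * complex.Im (u n) + c * complex.Re (u n) + complex.Im (v n)).
  by case: (u n) (v n) => ? ? [? ?].
by rewrite lim3.
Qed.

Lemma csum_conj u : ccvg u -> csum (fun n => (u n)^*%C) = (csum u)^*%C.
Proof.
move=> [ru iu]; rewrite /csum /=; congr (_ +i* _).
  by congr (limn (series _)); apply/funext => n; case: (u n).
rewrite -lim_seriesN// (_ : (fun n => _) = - (fun n => complex.Im (u n)))//.
apply/funext => n; change (complex.Im (u n)^*%C = - complex.Im (u n)).
by case: (u n).
Qed.

End ComplexSeries.

Notation word d := (fmonom 'I_d).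

Section FockSpace.
Context {R : realType} {d : nat}.
Implicit Types (f : word d -> R) (h : word d -> R[i]) (w : word d).

Definition wlevel {V : zmodType} (F : word d -> V) (m : nat) : V :=
  \sum_(t : m.-tuple 'I_d) F (FMonom t).

(* Sums over all words are taken by increasing length. *)
Definition wsum h : R[i] := csum (wlevel h).

Definition square_summable h : Prop :=
  cvgn (series (wlevel (fun w => Normc.normc (h w) ^+ 2))).

Definition l2_pred : {pred word d -> R[i]} := fun h => `[< square_summable h >].

Lemma normc2 (z : R[i]) :
  Normc.normc z ^+ 2 = complex.Re z ^+ 2 + complex.Im z ^+ 2.
Proof. by case: z => a b /=; rewrite sqr_sqrtr ?addr_ge0 ?sqr_ge0. Qed.

Lemma wlevel_ge0 f m : (forall w, 0 <= f w) -> 0 <= wlevel f m.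
Proof. by move=> f0; apply: sumr_ge0. Qed.

Lemma wlevel_le f g m : (forall w, f w <= g w) -> wlevel f m <= wlevel g m.
Proof. by move=> fg; apply: ler_sum. Qed.

Lemma wsummable_le f g : (forall w, `|f w| <= g w) ->
  cvgn (series (wlevel g)) -> cvgn (series (wlevel f)).
Proof.
move=> fg cg; apply: normed_cvg.
have g0 w : 0 <= g w := le_trans (normr_ge0 _) (fg w).
apply: (@series_le_cvg _ (fun n => `|wlevel f n|) (wlevel g)) => // [n|n].
  exact: wlevel_ge0.
by rewrite /wlevel; apply: (le_trans (ler_norm_sum _ _ _)); apply: ler_sum.
Qed.

Lemma wseries_le f N : (forall w, 0 <= f w) -> cvgn (series (wlevel f)) ->
  series (wlevel f) N <= limn (series (wlevel f)).
Proof.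
move=> f0 cf; apply: nondecreasing_cvgn_le => // m n mn.
by apply: nondecreasing_series => // k _ _; exact: wlevel_ge0.
Qed.

Lemma wseries_bounded f (M : R) : (forall w, 0 <= f w) ->
  (forall N, series (wlevel f) N <= M) ->
  cvgn (series (wlevel f)) /\ limn (series (wlevel f)) <= M.
Proof.
move=> f0 fM; have cf : cvgn (series (wlevel f)).
  apply: nondecreasing_is_cvgn.
    move=> m n mn; apply: nondecreasing_series => // k _ _.
    exact: wlevel_ge0.
  by exists M => _ [N _ <-].
by split=> //; apply: limr_le => //; near=> N; exact: fM.
Unshelve. all: by end_near. Qed.

Lemma word_le_series f w : (forall w, 0 <= f w) ->
  f w <= series (wlevel f) (size w).+1.
Proof.
move=> f0; rewrite /series /= big_nat_recr //=.
apply: ler_wpDl; first by apply: sumr_ge0 => k _; exact: wlevel_ge0.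
rewrite /wlevel (bigD1 (in_tuple w)) //= (_ : FMonom _ = w); last by case: (w).
by rewrite lerDl; apply: sumr_ge0.
Qed.

Lemma cvg_finsum (J : Type) (r : seq J) (F : J -> R ^nat) (a : J -> R) :
  (forall j, F j @ \oo --> a j) ->
  (fun m => \sum_(j <- r) F j m) @ \oo --> \sum_(j <- r) a j.
Proof.
move=> Fa; elim: r => [|j r IH].
  rewrite big_nil (_ : (fun _ => _) = fun=> 0); first exact: cvg_cst.
  by apply/funext => m; rewrite big_nil.
rewrite big_cons (_ : (fun _ => _) = F j + (fun m => \sum_(j <- r) F j m));
  first exact: cvgD.
by apply/funext => m; rewrite big_cons.
Qed.

Lemma cvg_sqrB (c a : R) (v : R ^nat) :
  v @ \oo --> a -> (fun m => (c - v m) ^+ 2) @ \oo --> (c - a) ^+ 2.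
Proof.
move=> va; have cva : (fun m => c - v m) @ \oo --> c - a.
  by apply: cvgB => //; exact: cvg_cst.
exact: (cvgM cva cva).
Qed.

Lemma l2_submod : submod_closed l2_pred.
Proof.
split=> [|a g h /asboolP sg /asboolP sh]; apply/asboolP.
  have /= := @wseries_bounded (fun w => Normc.normc (0 : R[i]) ^+ 2) 0.
  case=> [w|N|] //; first exact: sqr_ge0.
  rewrite /series /= big1// => k _.
  by apply: big1 => ? _; rewrite /= expr0n /= addr0 sqrtr0 expr0n.
apply: (@wsummable_le _ (fun w => 2 * (Normc.normc a ^+ 2 *
    Normc.normc (g w) ^+ 2 + Normc.normc (h w) ^+ 2))) => [w|].
  change ((a *: g + h) w) with (a * g w + h w).
  rewrite ger0_norm ?sqr_ge0// -exprMn -Normc.normcM !normc2.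
  case: (a * g w) (h w) => x y [x' y'] /=.
  have := sqr_ge0 (x - x'); have := sqr_ge0 (y - y'); lra.
rewrite (_ : wlevel _ = (2 : R) *: (Normc.normc a ^+ 2 *:
    wlevel (fun w => Normc.normc (g w) ^+ 2) +
    wlevel (fun w => Normc.normc (h w) ^+ 2))).
  apply: is_cvg_seriesZ; apply: is_cvg_seriesD => //; exact: is_cvg_seriesZ.
apply/funext => m; rewrite /wlevel -mulr_sumr big_split /= -mulr_sumr.
by [].
Qed.

HB.instance Definition _ :=
  GRing.isSubmodClosed.Build R[i] (word d -> R[i]) l2_pred l2_submod.

Record fock := Fock {
  fock_coef :> word d -> R[i];
  fock_coefP : fock_coef \in l2_pred }.

HB.instance Definition _ := [isSub for fock_coef].
HB.instance Definition _ := [Choice of fock by <:].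
HB.instance Definition _ := [SubChoice_isSubLmodule of fock by <:].

Implicit Types u v : fock.

Definition fock_dotp u v : R[i] := wsum (fun w => (u w)^*%C * v w).

Lemma fock_ccvg u v : ccvg (wlevel (fun w => (u w)^*%C * v w)).
Proof.
have /asboolP su := fock_coefP u; have /asboolP sv := fock_coefP v.
have sD : cvgn (series (wlevel (fun w =>
    Normc.normc (u w) ^+ 2 + Normc.normc (v w) ^+ 2))).
  rewrite (_ : wlevel _ = wlevel (fun w => Normc.normc (u w) ^+ 2)
    + wlevel (fun w => Normc.normc (v w) ^+ 2)); first exact: is_cvg_seriesD.
  by apply/funext => m; rewrite /wlevel big_split.
have E (p : {additive R[i] -> R}) :
    (fun m => p (wlevel (fun w => (u w)^*%C * v w) m)) =
    wlevel (fun w => p ((u w)^*%C * v w)).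
  by apply/funext => m; rewrite /wlevel raddf_sum.
split.
  rewrite (E (@complex.Re R : {additive R[i] -> R})).
  apply: wsummable_le sD => w.
  rewrite !normc2 ler_norml; case: (u w) (v w) => a b [a' b'] /=.
  have := (sqr_ge0 (a - a'), sqr_ge0 (b - b'),
           sqr_ge0 (a + a'), sqr_ge0 (b + b')).
  by move=> [[[]]]; lra.
rewrite (E (@complex.Im R : {additive R[i] -> R})).
apply: wsummable_le sD => w.
rewrite !normc2 ler_norml; case: (u w) (v w) => a b [a' b'] /=.
have := (sqr_ge0 (a - b'), sqr_ge0 (b - a'),
         sqr_ge0 (a + b'), sqr_ge0 (b + a')).
by move=> [[[]]]; lra.
Qed.

Fact fock_dotpPr (a : R[i]) x y z :
  fock_dotp x (a *: y + z) = a * fock_dotp x y + fock_dotp x z.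
Proof.
rewrite /fock_dotp /wsum -csum_linear; [|exact: fock_ccvg..].
congr csum; apply/funext => m; rewrite /wlevel mulr_sumr -big_split /=.
apply: eq_bigr => t _.
change ((a *: y + z) (FMonom t)) with (a * y (FMonom t) + z (FMonom t)).
by rewrite mulrDr mulrCA.
Qed.

Fact fock_dotpC x y : fock_dotp y x = (fock_dotp x y)^*%C.
Proof.
rewrite /fock_dotp /wsum -csum_conj; last exact: fock_ccvg.
congr csum; apply/funext => m; rewrite /wlevel raddf_sum.
apply: eq_bigr => t _; case: (x _) (y _) => a b [c e].
by apply/eqP; rewrite eq_complex /=; apply/andP; split; apply/eqP; ring.
Qed.

Lemma fock_dotpxx (x : fock) :
  fock_dotp x x = (limn (series (wlevel (fun w => Normc.normc (x w) ^+ 2))))%:C.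
Proof.
have E w : (x w)^*%C * x w = (Normc.normc (x w) ^+ 2)%:C.
  rewrite normc2; case: (x w) => a b /=.
  rewrite /GRing.mul /= /real_complex_def.
  by congr (_ +i* _); rewrite ?expr2; ring.
rewrite /fock_dotp /wsum /csum /real_complex_def /=; congr (_ +i* _).
  congr (limn (series _)); apply/funext => m; rewrite /wlevel raddf_sum.
  by apply: eq_bigr => t _; rewrite E.
rewrite (_ : series _ = fun=> 0); first exact: lim_cst.
apply/funext => n; rewrite /series /= big1// => m _.
by rewrite /wlevel raddf_sum big1// => t _; rewrite E.
Qed.

Lemma fock_coef_le (x : fock) w :
  Normc.normc (x w) ^+ 2 <=
  limn (series (wlevel (fun w => Normc.normc (x w) ^+ 2))).
Proof.
have /asboolP sx := fock_coefP x.
apply: le_trans (wseries_le (size w).+1 _ sx); last first.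
  by move=> ?; rewrite sqr_ge0.
apply: (word_le_series (f := fun w => Normc.normc (x w) ^+ 2)) => ?.
by rewrite sqr_ge0.
Qed.

Fact fock_dotp_gt0 (x : fock) : x != 0 -> 0 < fock_dotp x x.
Proof.
move=> x0; rewrite fock_dotpxx ltcR.
have [w xw] : exists w, x w != 0.
  apply: contrapT => nx; case/eqP: x0; apply/val_inj/funext => w /=.
  by apply/eqP; apply/negP => /negP xw; apply: nx; exists w.
apply: lt_le_trans (fock_coef_le x w); rewrite exprn_gt0// lt_neqAle.
case: (x w) xw => a b ab; rewrite sqrtr_ge0 andbT eq_sym.
by apply: contra ab => /eqP/Normc.eq0_normc ->.
Qed.

Fact fock_complete : form_complete fock_dotp.
Proof.
pose N2 (x : fock) : R :=
  limn (series (wlevel (fun w => Normc.normc (x w) ^+ 2))).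
have FN x : form_norm fock_dotp x = Num.sqrt (N2 x).
  by rewrite /form_norm fock_dotpxx.
have N20 x : 0 <= N2 x.
  by apply: le_trans (fock_coef_le x (FMonom [::])); rewrite sqr_ge0.
move=> u cu.
have {}cu (e : R) : 0 < e -> exists N, forall m n,
    (N <= m)%N -> (N <= n)%N -> N2 (u m - u n) < e ^+ 2.
  move=> e0; have [N uN] := cu e e0; exists N => m n Nm Nn.
  have := uN m n Nm Nn; rewrite FN => uu.
  by rewrite -(sqr_sqrtr (N20 _)) ltrXn2r// ?nnegrE ?sqrtr_ge0.
have cvp (p : R[i] -> R) w :
    (forall z z', `|p z - p z'| <= Normc.normc (z - z')) ->
    cvgn (fun n => p (u n w)).
  move=> pL; apply/cauchy_cvgP/cauchy_exP => e e0.
  have [N uN] := cu e e0; exists (p (u N w)).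
  exists N => // n /= Nn; rewrite -ball_normE /ball_ /=.
  apply: (le_lt_trans (pL _ _)).
  rewrite -(@ltr_pXn2r _ 2)// ?nnegrE ?normc_ge0 ?(ltW e0)//.
  exact: (le_lt_trans (fock_coef_le (u N - u n) w) (uN N n (leqnn N) Nn)).
have normcB (p : R[i] -> R) (z : R[i]) : `|p z| ^+ 2 <= Normc.normc z ^+ 2 ->
    `|p z| <= Normc.normc z.
  by rewrite ler_pXn2r// ?nnegrE ?normr_ge0 ?normc_ge0.
have cRe w : cvgn (fun n => complex.Re (u n w)).
  apply: cvp => z z'; rewrite -raddfB; apply: normcB.
  by rewrite normc2 real_normK ?num_real// lerDl sqr_ge0.
have cIm w : cvgn (fun n => complex.Im (u n w)).
  apply: cvp => z z'; rewrite -raddfB; apply: normcB.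
  by rewrite normc2 real_normK ?num_real// lerDr sqr_ge0.
pose l w : R[i] := limn (fun n => complex.Re (u n w))
                   +i* limn (fun n => complex.Im (u n w)).
have lu (e : R) : 0 < e -> exists N, forall n, (N <= n)%N -> forall k,
    series (wlevel (fun w => Normc.normc (u n w - l w) ^+ 2)) k <= e ^+ 2.
  move=> e0; have [N uN] := cu e e0; exists N => n Nn k.
  have cs :
    (fun m => series (wlevel (fun w => Normc.normc (u n w - u m w) ^+ 2)) k)
      @ \oo --> series (wlevel (fun w => Normc.normc (u n w - l w) ^+ 2)) k.
    rewrite /series /=; apply: cvg_finsum => j; apply: cvg_finsum => t.
    set w := FMonom t.
    have nE z : Normc.normc (u n w - z) ^+ 2 =
        (complex.Re (u n w) - complex.Re z) ^+ 2 +
        (complex.Im (u n w) - complex.Im z) ^+ 2.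
      by rewrite normc2; case: (u n w) z => ? ? [? ?].
    rewrite nE (_ : (fun m => _) = fun m =>
      (complex.Re (u n w) - complex.Re (u m w)) ^+ 2 +
      (complex.Im (u n w) - complex.Im (u m w)) ^+ 2); last first.
      by apply/funext => m; exact: nE.
    apply: cvgD; apply: cvg_sqrB; [exact: cRe|exact: cIm].
  rewrite -(cvg_lim _ cs)//; apply: limr_le; first by apply: cvgP cs.
  near=> m.
  have Nm : (N <= m)%N by near: m; exists N.
  apply: le_trans (ltW (uN n m Nn Nm)).
  have /asboolP sx := fock_coefP (u n - u m).
  by apply: (wseries_le k _ sx) => w; exact: sqr_ge0.
have sl (e : R) : 0 < e -> exists N, forall n, (N <= n)%N ->
    (fun w => u n w - l w) \in l2_pred /\
    limn (series (wlevel (fun w => Normc.normc (u n w - l w) ^+ 2))) <= e ^+ 2.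
  move=> e0; have [N uN] := lu e e0; exists N => n Nn.
  have [|? ?] := @wseries_bounded
    (fun w => Normc.normc (u n w - l w) ^+ 2) _ _ (uN n Nn).
    by move=> w; exact: sqr_ge0.
  by split=> //; apply/asboolP.
have Ml : l \in l2_pred.
  have [N /(_ N (leqnn N))[sN _]] := sl 1 ltr01.
  have -> : l = (u N : word d -> R[i]) - (fun w => u N w - l w).
    by apply/funext => w; change (l w = u N w - (u N w - l w)); rewrite subKr.
  by rewrite rpredB// fock_coefP.
exists (Fock Ml) => e e0.
have [N uN] := sl (e / 2) (divr_gt0 e0 (ltr0n _ 2)); exists N => n Nn.
rewrite FN; have [_ le2] := uN n Nn.
apply: (@le_lt_trans _ _ (e / 2)); last first.
  by rewrite ltr_pdivrMr// ltr_pMr// ltr1n.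
have e2 : 0 <= e / 2 by rewrite divr_ge0// ltW.
by rewrite -(@ler_pXn2r _ 2)// ?nnegrE ?sqrtr_ge0// sqr_sqrtr// N20.
Unshelve. all: by end_near. Qed.

HB.instance Definition _ := Lmodule_isHilbert.Build R fock
  fock_dotpPr fock_dotpC fock_dotp_gt0 fock_complete.

(* Left multiplication by the k-th variable. *)
Definition shift (k : 'I_d) (h : word d -> R[i]) (w : word d) : R[i] :=
  if fmonom_val w is j :: s then (if j == k then h (FMonom s) else 0) else 0.

Lemma shift_linear k : linear (shift k).
Proof.
move=> a g h; apply/funext => -[[|j s]].
  by change (0 = a * 0 + 0 :> R[i]); rewrite mulr0 addr0.
change ((if j == k then a * g (FMonom s) + h (FMonom s) else 0) =
  a * (if j == k then g (FMonom s) else 0) +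
  (if j == k then h (FMonom s) else 0)).
by case: ifP => // _; rewrite mulr0 addr0.
Qed.

Lemma wlevel_shift k h m :
  wlevel (fun w => Normc.normc (shift k h w) ^+ 2) m.+1 =
  wlevel (fun w => Normc.normc (h w) ^+ 2) m.
Proof.
rewrite /wlevel (reindex (fun p : 'I_d * m.-tuple 'I_d =>
  [tuple of p.1 :: p.2])) /=; last first.
  exists (fun t : m.+1.-tuple 'I_d => (thead t, [tuple of behead t])) =>
    [[i t] _|t _].
    by congr pair; apply/val_inj.
  by rewrite [RHS]tuple_eta; apply/val_inj.
rewrite -(pair_bigA _ (fun i (t : m.-tuple 'I_d) =>
  Normc.normc (shift k h (FMonom (i :: t))) ^+ 2)) /= (bigD1 k)//=.
rewrite [X in _ + X]big1 ?addr0.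
  by apply: eq_bigr => t _; rewrite /shift /= eqxx.
move=> i ik; apply: big1 => t _; rewrite /shift /= (negbTE ik).
by rewrite /= expr0n /= addr0 sqrtr0 expr0n.
Qed.

Lemma series_shift k h N :
  series (wlevel (fun w => Normc.normc (shift k h w) ^+ 2)) N.+1 =
  series (wlevel (fun w => Normc.normc (h w) ^+ 2)) N.
Proof.
rewrite /series /= big_nat_recl// [X in X + _]big1 ?add0r; last first.
  by move=> t _; rewrite tuple0 /shift /= expr0n /= addr0 sqrtr0 expr0n.
by apply: eq_bigr => m _; rewrite wlevel_shift.
Qed.

Lemma shift_bound k u :
  cvgn (series (wlevel (fun w => Normc.normc (shift k u w) ^+ 2))) /\
  limn (series (wlevel (fun w => Normc.normc (shift k u w) ^+ 2))) <=
  limn (series (wlevel (fun w => Normc.normc (u w) ^+ 2))).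
Proof.
have /asboolP su := fock_coefP u.
apply: wseries_bounded => [w|[|N]]; first exact: sqr_ge0.
  rewrite /series /= big_geq//.
  by apply: le_trans (fock_coef_le u (FMonom [::])); rewrite sqr_ge0.
by rewrite series_shift; apply: wseries_le su => w; exact: sqr_ge0.
Qed.

Definition fock_shift k u : fock := Fock (asboolT (proj1 (shift_bound k u))).

Fact fock_shift_subproof k : fock_shift k \in @bounded_linear_pred R fock fock.
Proof.
apply/asboolP; split=> [a x y|]; first by apply/val_inj; exact: shift_linear.
exists 1 => x; rewrite mul1r.
change (form_norm fock_dotp (fock_shift k x) <= form_norm fock_dotp x).
rewrite /form_norm !fock_dotpxx /=.
by rewrite ler_wsqrtr//; exact: (proj2 (shift_bound k x)).
Qed.
Definition lshift k : bop fock fock := Bop (fock_shift_subproof k).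

End FockSpace.

Section RowOperators.
Context {R : realType} {d : nat}.

Definition ncpoly := malg (word d) R[i].
Definition ncvar (k : 'I_d) : ncpoly := mkmalgU (fmu k) 1.

Definition wpow {A : pzRingType} (a : 'I_d -> A) (w : word d) : A :=
  \prod_(i <- (w : seq 'I_d)) a i.

Context {H : hilbertType R}.
Implicit Types (V : 'I_d -> bop H H) (M N : clsubspace H).

Definition peval V (p : ncpoly) : bop H H :=
  \sum_(w <- enum_fset (msupp p)) mcoeff w p *: wpow V w.

Definition row_isometry V : Prop := forall x : 'I_d -> H,
  hnorm (\sum_j V j (x j)) ^+ 2 = \sum_j hnorm (x j) ^+ 2.

Definition row_contraction V : Prop := forall x : 'I_d -> H,
  hnorm (\sum_j V j (x j)) ^+ 2 <= \sum_j hnorm (x j) ^+ 2.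

Definition row_coisometry V : Prop :=
  row_contraction V /\ \sum_j V j * adj (V j) = 1.

Definition cuntz V : Prop :=
  row_isometry V /\ forall y, exists x : 'I_d -> H, y = \sum_j V j (x j).

(* The free semigroup algebra: closure of the polynomials in V in the weak
   operator topology. *)
Definition free_semigroup_algebra V : set (bop H H) :=
  [set T | forall n (x y : 'I_n -> H) (e : R), 0 < e ->
     exists p : ncpoly, forall i,
       Normc.normc (dotp (x i) ((T - peval V p) (y i))) < e].

Definition reducing V M : Prop :=
  forall k x, M x -> M (V k x) /\ M (adj (V k) x).

Definition von_neumann_type V : Prop :=
  row_isometry V /\
  forall T, free_semigroup_algebra V T -> free_semigroup_algebra V (adj T).

End RowOperators.

Arguments ncpoly : clear implicits.

Section WeakStar.
Context {R : realType}.

Definition hsquare_summable {H : hilbertType R} (x : nat -> H) : Prop :=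
  cvgn (series (fun n => hnorm (x n) ^+ 2)).

(* The weak-* continuous functionals on B(H) are the
   T |-> \sum_n <x_n, T y_n> with x and y square-summable. *)
Definition ultraweak {H : hilbertType R} (x y : nat -> H) (T : bop H H) :
    R[i] :=
  csum (fun n => dotp (x n) (T (y n))).

Definition weak_star_continuous {H K : hilbertType R} (S : set (bop H H))
    (phi : bop H H -> bop K K) : Prop :=
  forall T0, S T0 -> forall x' y' : nat -> K,
    hsquare_summable x' -> hsquare_summable y' ->
  forall e : R, 0 < e ->
  exists n (x y : 'I_n -> nat -> H) (delta : R),
    [/\ 0 < delta, forall i, hsquare_summable (x i) /\ hsquare_summable (y i) &
     forall T, S T ->
       (forall i, Normc.normc (ultraweak (x i) (y i) (T - T0)) < delta) ->
       Normc.normc (ultraweak x' y' (phi T - phi T0)) < e].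

(* phi : S -> S' is a completely isometric algebra isomorphism which is a
   weak-* homeomorphism, with inverse psi. *)
Definition dual_algebra_iso {H K : hilbertType R}
    (S : set (bop H H)) (S' : set (bop K K))
    (phi : bop H H -> bop K K) (psi : bop K K -> bop H H) : Prop :=
  [/\ [/\ forall T, S T -> S' (phi T), forall T, S' T -> S (psi T),
          forall T, S T -> psi (phi T) = T & forall T, S' T -> phi (psi T) = T],
      [/\ forall (a : R[i]) T U, S T -> S U ->
            phi (a *: T + U) = a *: phi T + phi U,
          forall T U, S T -> S U -> phi (T * U) = phi T * phi U & phi 1 = 1],
      forall n (T : 'M[bop H H]_n), (forall i j, S (T i j)) ->
        mxopnorm (map_mx phi T) = mxopnorm T,
      weak_star_continuous S phi & weak_star_continuous S' psi].

End WeakStar.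

Section Types.
Context {R : realType} {d : nat} {H : hilbertType R}.
Implicit Types (V : 'I_d -> bop H H) (M N : clsubspace H).

Definition cuntz_type_L {K : hilbertType R} (V : 'I_d -> bop K K) : Prop :=
  cuntz V /\ exists phi psi,
    dual_algebra_iso (free_semigroup_algebra (@lshift R d))
                     (free_semigroup_algebra V) phi psi.

(* For reducing M, compress M \o V is the restriction of V to M. *)
Definition dilation_type {K : hilbertType R} (V : 'I_d -> bop K K) : Prop :=
  cuntz V /\ forall M : clsubspace K, reducing V M ->
    (exists x, M x /\ x <> 0) ->
    ~ cuntz_type_L (fun k => compress M (V k)) /\
    ~ von_neumann_type (fun k => compress M (V k)).

Definition singular_row V : Prop :=
  exists M N : clsubspace H,
    [/\ reducing V M, reducing V N,
        forall x y, M x -> N y -> dotp x y = 0,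
        forall z, exists x y, [/\ M x, N y & z = x + y] &
        dilation_type (fun k => compress M (V k)) /\
        (cuntz (fun k => compress N (V k)) /\
         von_neumann_type (fun k => compress N (V k)))].

End Types.

Section NCFunctions.
Context {R : realType} {d : nat}.
Local Notation C := R[i].

Definition mxtuple n := 'I_d -> 'M[C]_n.

(* The strict inequality \sum_j Z_j Z_j^* < I_n, i.e. the difference is
   positive definite. *)
Definition row_ball n (Z : mxtuple n) : Prop :=
  forall v : 'cV[C]_n, v != 0 ->
    0 < (v^t* *m (1%:M - \sum_j Z j *m (Z j)^t*) *m v) 0 0.

Definition ncmap := forall n, mxtuple n -> 'M[C]_n.

Definition nc_function (b : ncmap) : Prop :=
  (forall m n (Z : mxtuple m) (W : mxtuple n), row_ball Z -> row_ball W ->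
     b (m + n)%N (fun j => block_mx (Z j) 0 0 (W j)) =
     block_mx (b m Z) 0 0 (b n W)) /\
  (forall n (Z : mxtuple n) (S : 'M[C]_n), S \in unitmx -> row_ball Z ->
     row_ball (fun j => invmx S *m Z j *m S) ->
     b n (fun j => invmx S *m Z j *m S) = invmx S *m b n Z *m S).

Definition hinfty_ball (b : ncmap) : Prop :=
  nc_function b /\
  forall n (Z : mxtuple n), row_ball Z -> forall v : 'cV[C]_n,
    ((b n Z *m v)^t* *m (b n Z *m v)) 0 0 <= (v^t* *m v) 0 0.

(* The value at Z of the power series with coefficients h. *)
Definition heval (h : @fock R d) n (Z : mxtuple n) : 'M[C]_n :=
  \matrix_(i, j) wsum (fun w => h w * (wpow Z w) i j).

(* Left multiplication by b on the Fock space is isometric. *)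
Definition inner_multiplier (b : ncmap) : Prop :=
  forall h : @fock R d, exists2 g : @fock R d,
    forall n (Z : mxtuple n), row_ball Z -> heval g Z = b n Z *m heval h Z &
    hnorm g = hnorm h.

Inductive ncexpr :=
  | EVar of 'I_d
  | EConst of C
  | EAdd of ncexpr & ncexpr
  | EMul of ncexpr & ncexpr
  | EInv of ncexpr.

Fixpoint ncexpr_eval (r : ncexpr) n (Z : mxtuple n) : 'M[C]_n :=
  match r with
  | EVar j => Z j
  | EConst c => c%:M
  | EAdd r s => ncexpr_eval r Z + ncexpr_eval s Z
  | EMul r s => ncexpr_eval r Z *m ncexpr_eval s Z
  | EInv r => invmx (ncexpr_eval r Z)
  end.

Fixpoint ncexpr_dom (r : ncexpr) n (Z : mxtuple n) : Prop :=
  match r with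
  | EVar _ | EConst _ => True
  | EAdd r s | EMul r s => ncexpr_dom r Z /\ ncexpr_dom s Z
  | EInv r => ncexpr_dom r Z /\ ncexpr_eval r Z \in unitmx
  end.

Definition nc_rational (b : ncmap) : Prop :=
  exists r : ncexpr, forall n (Z : mxtuple n), row_ball Z ->
    ncexpr_dom r Z /\ b n Z = ncexpr_eval r Z.

End NCFunctions.

Section NCMeasures.
Context {R : realType} {d : nat}.
Local Notation C := R[i].
Local Notation H2 := (@fock R d).
Local Notation L := (@lshift R d).

Definition disk_algebra : set (bop H2 H2) :=
  [set T | forall e : R, 0 < e -> exists p, opnorm (T - peval L p) < e].

Definition disk_system : set (bop H2 H2) :=
  [set T | forall e : R, 0 < e -> exists A B,
     [/\ disk_algebra A, disk_algebra B & opnorm (T - (A + adj B)) < e]].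

(* Only the values of mu on disk_system are meaningful. *)
Definition positive_ncmeasure (mu : bop H2 H2 -> C) : Prop :=
  (forall (a : C) S T, disk_system S -> disk_system T ->
     mu (a *: S + T) = a * mu S + mu T) /\
  (forall T, disk_system T -> (forall h, 0 <= dotp h (T h)) -> 0 <= mu T).

(* Z L^* = \sum_j Z_j (x) L_j^*, an operator on C^n (x) H^2 written as an
   n x n matrix of operators on H^2. *)
Definition ZLstar n (Z : mxtuple n) : 'M[bop H2 H2]_n :=
  \matrix_(i, j) \sum_k Z k i j *: adj (L k).

Definition opmx_inv n (X : 'M[bop H2 H2]_n) : 'M[bop H2 H2]_n :=
  xget 0 [set Y | X *m Y = 1%:M /\ Y *m X = 1%:M].

Definition herglotz (mu : bop H2 H2 -> C) n (Z : mxtuple n) : 'M[C]_n :=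
  map_mx mu ((1%:M + ZLstar Z) *m opmx_inv (1%:M - ZLstar Z)).

Definition is_clark_measure (b : ncmap) (mu : bop H2 H2 -> C) : Prop :=
  let b0 : C := b 1%N (fun=> 0) 0 0 in
  let t : R := complex.Im ((1 + b0) / (1 - b0)) in
  (exists n (Z : mxtuple n), row_ball Z /\ b n Z <> 1%:M) /\
  forall n (Z : mxtuple n), row_ball Z ->
    1%:M - b n Z \in unitmx /\
    (1%:M + b n Z) *m invmx (1%:M - b n Z) = herglotz mu Z + (0 +i* t)%:M.

Definition rational_clark_symbol (mu : bop H2 H2 -> C) (b : ncmap) : Prop :=
  [/\ hinfty_ball b, nc_rational b & is_clark_measure b mu].

(* Any two symbols of mu differ only by the choice of t, so "the symbol is
   inner" is read as: a symbol exists, and every one of them is inner. *)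
Definition clark_symbol_inner (mu : bop H2 H2 -> C) : Prop :=
  (exists b, rational_clark_symbol mu b) /\
  (forall b, rational_clark_symbol mu b -> inner_multiplier b).

(* K, with the linear map iota sending p to p + N_mu, is the completion of the
   free polynomials modulo zero-length vectors, and Pi is the GNS row
   isometry. *)
Definition is_gns (mu : bop H2 H2 -> C) (K : hilbertType R)
    (iota : {linear ncpoly R d -> K}) (Pi : 'I_d -> bop K K) : Prop :=
  [/\ forall p q, dotp (iota p) (iota q) = mu (adj (peval L p) * peval L q),
      forall x (e : R), 0 < e -> exists p, hnorm (x - iota p) < e &
      forall k p, Pi k (iota p) = iota (ncvar k * p)].

Section GNS.
Context {K : hilbertType R} (iota : {linear ncpoly R d -> K})
  (Pi : 'I_d -> bop K K).

Definition gns_cyclic : clsubspace K :=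
  closed_span [set x | exists w : word d, x = adj (wpow Pi w) (iota 1)].

Definition finitely_correlated : Prop := finite_dim (subhilb gns_cyclic).

Definition gns_row (k : 'I_d) : bop (subhilb gns_cyclic) (subhilb gns_cyclic) :=
  compress gns_cyclic (Pi k).

End GNS.

End NCMeasures.

(* Main.v *)
(* Let xi = 1 + N_mu. Multiplication by a symbol of mu is the input-output map of
   a system on the GNS space whose state moves by the Pi_j^* and is fed back
   through xi. The only energy lost by this system is
   |k|^2 - sum_j |Pi_j^* k|^2; for an inner symbol and the input 1 there is no
   loss, and the first state is a nonzero multiple of xi, so xi lies in the range
   of Pi, which is surjective by cyclicity. Conversely, if Pi is Cuntz then energy
   can only remain in the states; by cyclicity of xi the closed loop is observable
   on the finite-dimensional space H_mu, hence stable there, and the symbol is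
   inner. A rational symbol is the Cayley transform of H_mu(Z), obtained from the
   accretive linear system x - sum_j (Z_j (x) Pi_j^* ) x = xi on H_mu.

   A Cuntz Pi with a cyclic finite-dimensional coinvariant subspace has no von
   Neumann type summand by a trace count. It has no type L summand either: the
   elements A_j of the algebra of L corresponding to the Pi_j have a strictly
   contractive constant term, so contractive combinations of their words of length
   m tend weak-* to 0, while by Parseval on H_mu some of the corresponding
   combinations for Pi do not. *)
From HB Require Import structures.
From mathcomp Require Import all_boot all_order all_algebra.
From mathcomp Require Import boolp classical_sets functions reals topology.
From mathcomp Require Import normedtype sequences complex.
From mathcomp Require Import ring lra.
From mathcomp Require Import -(notations) finmap.
From mathcomp Require Import -(notations) monalg.
Require Import Defs.

Set Implicit Arguments.
Unset Strict Implicit.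
Unset Printing Implicit Defensive.

Import Order.TTheory GRing.Theory Num.Theory.
Import numFieldNormedType.Exports.
Import ComplexField.

Local Open Scope ring_scope.
Local Open Scope complex_scope.

(** * Hilbert spaces and adjoints *)

(** The feedback through xi is the Cayley transform read one word at a time. Put y = (1 - b) h, so
    that 2 h = (H_mu + i t + 1) y, and X = sum_j Z_j (x) adj(Pi_j). Since H_mu = 2 <xi, (1 - X)^-1
    xi> - |xi|^2, writing the state (1 - X)^-1 xi y as p + y xi gives delta y = 2 (h - <xi, p>) with
    delta = 1 + |xi|^2 + i t. Every Clark symbol is covered, whatever its t. The obstacle is that b
    is known only through its values on the row ball, whereas inner refers to coefficients. Energies
    are therefore computed on coefficients, over all words of a given length, and truncated
    identities are carried to the values by Neumann series with geometric rates.

    The strict constant term comes from the equality case of Cauchy-Schwarz: if the constant terms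
    a_j form a unit vector, then sum_j conj(a_j) A_j fixes the vacuum and is 1; the same relation on
    the Cuntz side makes every isometry of the row a scalar, against the orthogonality of two
    ranges. *)

Section ComplexNumbers.
Context {R : realType}.
Implicit Types (x y z : R[i]) (a b : R).
Local Notation nc := (@Normc.normc R).
Local Notation Re := (@complex.Re R).

Lemma normc_conj z : nc z^*%C = nc z.
Proof. by case: z => a b /=; rewrite sqrrN. Qed.

Lemma normc_real a : nc a%:C = `|a|.
Proof. by rewrite /= expr0n addr0 sqrtr_sqr. Qed.

Lemma normc_eq0 z : (nc z == 0) = (z == 0).
Proof.
by apply/eqP/eqP => [/Normc.eq0_normc//|->]; exact: Normc.normc0.
Qed.

Lemma normc_sqr z : nc z ^+ 2 = Re (z^*%C * z).
Proof. rewrite normc2; case: z => a b /=; ring. Qed.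

Lemma mul_conjc z : z^*%C * z = (nc z ^+ 2)%:C.
Proof.
rewrite normc2; case: z => a b; apply/eqP.
by rewrite eq_complex /=; apply/andP; split; apply/eqP; ring.
Qed.

Lemma Re_le_normc z : `|Re z| <= nc z.
Proof.
rewrite -(@ler_pXn2r _ 2) ?nnegrE ?normc_ge0// normc2.
by rewrite real_normK ?num_real// lerDl sqr_ge0.
Qed.

Lemma Im_le_normc z : `|complex.Im z| <= nc z.
Proof.
rewrite -(@ler_pXn2r _ 2) ?nnegrE ?normc_ge0// normc2.
by rewrite real_normK ?num_real// lerDr sqr_ge0.
Qed.

Lemma Re_rmul a z : Re (a%:C * z) = a * Re z.
Proof. by case: z => b c /=; rewrite mul0r subr0. Qed.

Lemma normc_sum (I : Type) (r : seq I) (F : I -> R[i]) :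
  nc (\sum_(i <- r) F i) <= \sum_(i <- r) nc (F i).
Proof.
elim: r => [|i r IH]; first by rewrite !big_nil Normc.normc0.
rewrite !big_cons; apply: (le_trans (le_normcD _ _)).
by rewrite lerD2l.
Qed.

Lemma real_complexK z : complex.Im z = 0 -> z = (Re z)%:C.
Proof. by case: z => a b /= ->. Qed.

End ComplexNumbers.

Lemma quad_discr (R : realType) (a b c : R) : 0 <= a -> 0 <= c ->
  (forall t : R, 0 <= a + 2 * t * b + t ^+ 2 * c) -> b ^+ 2 <= a * c.
Proof.
move=> a0 c0 H; have [c00|cn0] := eqVneq c 0.
  have [->|bn0] := eqVneq b 0; first by rewrite c00 expr0n mulr0.
  (* With [c = 0] the polynomial is affine in [t]; this [t] gives it the value -1. *)
  have := H (- (a + 1) / (2 * b)).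
  rewrite c00 mulr0 addr0 (_ : a + _ = -1); first by rewrite ler0N1.
  by field.
have cp : 0 < c by rewrite lt_neqAle eq_sym cn0.
have := H (- b / c).
rewrite (_ : a + _ + _ = (a * c - b ^+ 2) / c); last by field.
by rewrite pmulr_lge0 ?invr_gt0// subr_ge0.
Qed.

(** The form may be degenerate and live on any module: it is applied to inner products and, in
    [row_ball_strict_col], to the form of a matrix. *)
Lemma form_Cauchy_Schwarz (R : realType) (V : lmodType R[i]) (f : V -> V -> R[i])
    (x y : V) :
  (forall (a : R[i]) x y z, f x (a *: y + z) = a * f x y + f x z) ->
  (forall x y, f y x = (f x y)^*%C) -> (forall x, 0 <= complex.Re (f x x)) ->
  Normc.normc (f x y) ^+ 2 <= complex.Re (f x x) * complex.Re (f y y).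
Proof.
move=> fL fC f0.
have [d0|d0] := eqVneq (f x y) 0.
  by rewrite d0 Normc.normc0 expr0n mulr_ge0 ?f0.
have n0 : 0 < Normc.normc (f x y) by rewrite lt_neqAle normc_ge0 eq_sym normc_eq0 d0.
suff: (Normc.normc (f x y) ^+ 2) ^+ 2 <=
    complex.Re (f x x) * (Normc.normc (f x y) ^+ 2 * complex.Re (f y y)).
  by rewrite [in leRHS]mulrCA [X in X <= _ -> _]expr2 ler_pM2l// exprn_gt0.
apply: quad_discr; [exact: f0|by rewrite mulr_ge0 ?sqr_ge0 ?f0|move=> t].
(* The conjugate factor makes the cross term [f x (c *: y)] the real number t |f x y|^2, so the
   expansion is a real quadratic polynomial in [t]. *)
pose c := t%:C * (f x y)^*%C; have := f0 (c *: y + x).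
rewrite fL (fC y (c *: y + x)) (fC x (c *: y + x)) !fL (fC x y) /c.
have : complex.Im (f y y) = 0.
  by move: (fC y y); case: (f y y) => a b [] /eqP; rewrite -addr_eq0 -mulr2n mulrn_eq0 => /eqP.
have : complex.Im (f x x) = 0.
  by move: (fC x x); case: (f x x) => a b [] /eqP; rewrite -addr_eq0 -mulr2n mulrn_eq0 => /eqP.
rewrite normc2; case: (f x y) (f y y) (f x x) => a b [p q] [r s] /= s0 q0.
by rewrite ?s0 ?q0; congr (_ <= _); ring.
Qed.

Section InnerProduct.
Context {R : realType} {H : hilbertType R}.
Implicit Types x y z : H.
Local Notation nc := (@Normc.normc R).
Local Notation Re := (@complex.Re R).

Lemma dotpNr x y : dotp x (- y) = - dotp x y.
Proof. by rewrite -scaleN1r dotpZr mulN1r. Qed.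

Lemma dotpBr x y z : dotp x (y - z) = dotp x y - dotp x z.
Proof. by rewrite dotpDr dotpNr. Qed.

Lemma dotpNl x y : dotp (- x) y = - dotp x y.
Proof. by rewrite dotpC dotpNr rmorphN /= -dotpC. Qed.

Lemma dotpBl x y z : dotp (y - z) x = dotp y x - dotp z x.
Proof. by rewrite dotpDl dotpNl. Qed.

Lemma dotp0l x : dotp 0 x = 0.
Proof. by rewrite dotpC dotp0r conjc0. Qed.

Lemma dotp_sumr (I : Type) (r : seq I) (P : pred I) (F : I -> H) x :
  dotp x (\sum_(i <- r | P i) F i) = \sum_(i <- r | P i) dotp x (F i).
Proof. exact: (big_morph _ (dotpDr x) (dotp0r x)). Qed.

Lemma dotp_suml (I : Type) (r : seq I) (P : pred I) (F : I -> H) x :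
  dotp (\sum_(i <- r | P i) F i) x = \sum_(i <- r | P i) dotp (F i) x.
Proof. exact: (big_morph (dotp^~ x) (dotpDl x) (dotp0l x)). Qed.

Lemma dotpxx x : dotp x x = (hnorm x ^+ 2)%:C.
Proof.
rewrite hnorm_sqr -real_complexK//.
by have := dotp_ge0 x; rewrite lecE => /andP[/eqP].
Qed.

Lemma hnorm_eq0 x : hnorm x = 0 -> x = 0.
Proof.
move=> x0; apply/eqP; apply: contraT => /dotp_gt0.
by rewrite dotpxx x0 expr0n ltxx.
Qed.

Lemma hnormD_sqr x y :
  hnorm (x + y) ^+ 2 = hnorm x ^+ 2 + hnorm y ^+ 2 + 2 * Re (dotp x y).
Proof.
rewrite !hnorm_sqr !(dotpDl, dotpDr) [dotp y x]dotpC.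
by case: (dotp x y) (dotp x x) (dotp y y) => a b [c e] [f g] /=; ring.
Qed.

Lemma hnormB_sqr x y :
  hnorm (x - y) ^+ 2 = hnorm x ^+ 2 + hnorm y ^+ 2 - 2 * Re (dotp x y).
Proof. by rewrite hnormD_sqr hnormN dotpNr raddfN /= mulrN. Qed.

Lemma hnormB_sym x y : hnorm (x - y) = hnorm (y - x).
Proof. by rewrite -hnormN opprB. Qed.

Lemma Cauchy_Schwarz_sqr x y :
  nc (dotp x y) ^+ 2 <= hnorm x ^+ 2 * hnorm y ^+ 2.
Proof.
rewrite !hnorm_sqr; apply: form_Cauchy_Schwarz; first exact: dotpPr.
  exact: dotpC.
by move=> z; rewrite -hnorm_sqr sqr_ge0.
Qed.

Lemma Cauchy_Schwarz x y : nc (dotp x y) <= hnorm x * hnorm y.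
Proof.
rewrite -(@ler_pXn2r _ 2) ?nnegrE ?normc_ge0 ?mulr_ge0 ?hnorm_ge0//.
by rewrite exprMn Cauchy_Schwarz_sqr.
Qed.

Lemma hnormD x y : hnorm (x + y) <= hnorm x + hnorm y.
Proof.
rewrite -(@ler_pXn2r _ 2) ?nnegrE ?addr_ge0 ?hnorm_ge0// hnormD_sqr sqrrD.
have := Cauchy_Schwarz x y; have := Re_le_normc (dotp x y).
by rewrite ler_norml => /andP[]; lra.
Qed.

Lemma hnorm_sum (I : Type) (r : seq I) (F : I -> H) :
  hnorm (\sum_(i <- r) F i) <= \sum_(i <- r) hnorm (F i).
Proof.
elim: r => [|i r IH]; first by rewrite !big_nil hnorm0.
by rewrite !big_cons; apply: (le_trans (hnormD _ _)); rewrite lerD2l.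
Qed.

Lemma dotp_ext x y : (forall z, dotp z x = dotp z y) -> x = y.
Proof.
move=> xy; apply/subr0_eq/hnorm_eq0/eqP; rewrite -sqrf_eq0 hnorm_sqr.
by rewrite dotpBr xy subrr.
Qed.

Lemma hnorm_small x : (forall e : R, 0 < e -> hnorm x < e) -> x = 0.
Proof.
move=> xe; apply: hnorm_eq0; apply/eqP; apply: contraT => x0.
have xp : 0 < hnorm x by rewrite lt_neqAle hnorm_ge0 eq_sym x0.
by have := xe _ xp; rewrite ltxx.
Qed.

Lemma Pythagoras x y : dotp x y = 0 ->
  hnorm (x + y) ^+ 2 = hnorm x ^+ 2 + hnorm y ^+ 2.
Proof. by move=> xy; rewrite hnormD_sqr xy mulr0 addr0. Qed.

Lemma hnorm_dense_eq0 (A : H -> Prop) x :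
  (forall e : R, 0 < e -> exists2 y, A y & hnorm (x - y) < e) ->
  (forall y, A y -> dotp y x = 0) -> x = 0.
Proof.
move=> dA xA; apply: hnorm_eq0; apply/eqP; apply: contraT => x0.
have xp : 0 < hnorm x by rewrite lt_neqAle hnorm_ge0 eq_sym x0.
have [y Ay xy] := dA _ xp.
suff: hnorm x ^+ 2 <= hnorm (x - y) * hnorm x.
  by rewrite expr2 ler_pM2r// leNgt xy.
apply: le_trans (Cauchy_Schwarz _ _); apply: le_trans (Re_le_normc _).
by apply: le_trans (ler_norm _); rewrite dotpBl (xA y)// subr0 -hnorm_sqr.
Qed.

End InnerProduct.

Section Projection.
Context {R : realType} {H : hilbertType R} (M : clsubspace H).
Implicit Types x y z : H.
Local Notation Re := (@complex.Re R).

Lemma clsD x y : M x -> M y -> M (x + y).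
Proof. by move=> Mx My; rewrite -[x]scale1r; apply: clsP. Qed.

Lemma clsZ a x : M x -> M (a *: x).
Proof. by move=> Mx; rewrite -[_ *: _]addr0; apply: clsP => //; exact: cls0. Qed.

(* A minimizing sequence for the distance to [M] is Cauchy by the parallelogram law. *)
Lemma projection_exists x :
  exists2 m, M m & forall y, M y -> dotp y (x - m) = 0.
Proof.
pose D := [set hnorm (x - y) ^+ 2 | y in M : set H]%classic.
have Dlb : has_lbound D by exists 0 => _ [y _ <-]; exact: sqr_ge0.
have D0 : (D !=set0)%classic by exists (hnorm (x - 0) ^+ 2), 0 => //; exact: cls0.
pose d := inf D.
have dle y : M y -> d <= hnorm (x - y) ^+ 2.
  by move=> My; apply: ge_inf => //; exists y.
have ex n : {y | M y & hnorm (x - y) ^+ 2 < d + n.+1%:R^-1}.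
  apply: cid2; have n0 : 0 < (n.+1%:R^-1 : R) by rewrite invr_gt0.
  by have [_ [y My <-] ?] := inf_adherent n0 (conj D0 Dlb); exists y.
pose u n := s2val (ex n).
have Mu n : M (u n) := s2valP (ex n).
have du n : hnorm (x - u n) ^+ 2 < d + n.+1%:R^-1 := s2valP' (ex n).
have uu m n : hnorm (u m - u n) ^+ 2 <= 2 * (m.+1%:R^-1 + n.+1%:R^-1).
  have := hnorm_parallel (x - u n) (x - u m).
  rewrite (_ : x - u n - (x - u m) = u m - u n); last first.
    by rewrite opprB [LHS]addrC addrA addrNK.
  have -> : x - u n + (x - u m) = (2 : R[i]) *: (x - (2 : R[i])^-1 *: (u n + u m)).
    rewrite scalerBr scalerA mulfV ?pnatr_eq0// scale1r opprD addrACA.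
    by rewrite -mulr2n scaler_nat.
  rewrite hnormZ exprMn (_ : Normc.normc 2 ^+ 2 = 4); last first.
    by rewrite normc2 /= addr0 expr0n addr0; ring.
  have := dle _ (clsZ (2 : R[i])^-1 (clsD (Mu n) (Mu m))).
  have := du n; have := du m; rewrite -(mulr_natl (_ + _) 2).
  by move: m.+1%:R^-1 n.+1%:R^-1 => a b; move: (hnorm (x - _ *: _)) => c; lra.
have [e e0|l ul] := @dotp_complete R H u.
  have [N Ne] : exists N : nat, 4 * N.+1%:R^-1 < e ^+ 2.
    have e20 : 0 < e ^+ 2 / 4 by rewrite divr_gt0// exprn_gt0.
    have [N] := ltr_add_invr (y := 0) e20; rewrite add0r => h; exists N.
    by rewrite mulrC -ltr_pdivlMr.
  exists N => m n Nm Nn.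
  rewrite -(@ltr_pXn2r _ 2) ?nnegrE ?hnorm_ge0 ?(ltW e0)//.
  apply: le_lt_trans (uu m n) (le_lt_trans _ Ne).
  have : (m.+1%:R^-1 : R) <= N.+1%:R^-1 by rewrite lef_pV2 ?posrE// ler_nat.
  have : (n.+1%:R^-1 : R) <= N.+1%:R^-1 by rewrite lef_pV2 ?posrE// ler_nat.
  by move: m.+1%:R^-1 n.+1%:R^-1 N.+1%:R^-1 => a b c; lra.
have Ml : M l.
  apply: cls_closed => e e0; have [N /(_ N (leqnn N)) uN] := ul e e0.
  by exists (u N) => //; rewrite hnormB_sym.
have dl : hnorm (x - l) ^+ 2 <= d.
  have sl : hnorm (x - l) <= Num.sqrt d.
    apply/ler_addgt0Pr => e e0; have e20 : 0 < e / 2 by rewrite divr_gt0.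
    have [N uN] := ul _ e20.
    have d0 : 0 <= d by apply: lb_le_inf => // _ [y _ <-]; exact: sqr_ge0.
    have [n0 hn0] := ltr_add_invr (y := 0) (exprn_gt0 2 e20).
    pose n := maxn N n0.
    have h1 := uN n (leq_maxl _ _).
    rewrite -(subrK (u n) x) -addrA; apply: le_trans (hnormD _ _) _.
    suff : hnorm (x - u n) <= Num.sqrt d + e / 2.
      by rewrite /hnorm in h1 *; lra.
    rewrite -(@ler_pXn2r _ 2) ?nnegrE ?addr_ge0 ?hnorm_ge0 ?sqrtr_ge0 ?(ltW e20)//.
    rewrite sqrrD (sqr_sqrtr d0) -(mulr_natl (_ * _) 2).
    have := du n; have : (n.+1%:R^-1 : R) <= n0.+1%:R^-1.
      by rewrite lef_pV2 ?posrE// ler_nat ltnS leq_maxr.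
    have := mulr_ge0 (sqrtr_ge0 d) (ltW e20); move: hn0; rewrite add0r.
    move: n.+1%:R^-1 n0.+1%:R^-1 (Num.sqrt d * _) ((e / 2) ^+ 2) => a b c f.
    by lra.
  have d0 : 0 <= d by apply: lb_le_inf => // _ [y _ <-]; exact: sqr_ge0.
  by rewrite -(sqr_sqrtr d0) ler_pXn2r// nnegrE ?hnorm_ge0 ?sqrtr_ge0.
exists l => // y My.
have re0 z : M z -> Re (dotp z (x - l)) = 0.
  move=> Mz.
  (* Minimality of [l] against l - t z gives 0 <= 2 t Re <z, x - l> + t^2 |z|^2 for all real t; the
     zero constant coefficient forces the linear one to vanish. *)
  have q : Re (dotp z (x - l)) ^+ 2 <= 0 * hnorm z ^+ 2.
    apply: quad_discr; rewrite ?sqr_ge0// => t.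
    have := dle _ (clsP (- t%:C) Mz Ml).
    rewrite opprD scaleNr opprK addrCA hnormD_sqr hnormZ dotpZl normc_real.
    rewrite conjc_real Re_rmul exprMn real_normK ?num_real//.
    by move: dl; lra.
  by apply/eqP; rewrite -sqrf_eq0 eq_le sqr_ge0 andbT; move: q; rewrite mul0r.
(* Multiplying [y] by i turns the imaginary part into a real part. *)
have r1 := re0 y My; have := re0 _ (clsZ 'i My).
rewrite dotpZl; case: (dotp y _) r1 => a b /= -> /=.
by rewrite !mul0r mulN1r opprK add0r => ->.
Qed.

End Projection.

Lemma total_closed_span (R : realType) (H : hilbertType R) (A : set H) :
  (forall x, (forall y, A y -> dotp y x = 0) -> x = 0) ->
  forall x, closed_span A x.
Proof.
move=> tA x; have [m Mm xm] := projection_exists (closed_span A) x.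
suff /subr0_eq-> : x - m = 0 by [].
apply: tA => y Ay; apply: xm => e e0; exists y; last by rewrite subrr hnorm0.
by exists 1%N, (fun=> 1), (fun=> y); split=> //; rewrite big_ord1 scale1r.
Qed.

Section Adjoint.
Context {R : realType}.
Local Notation nc := (@Normc.normc R).
Local Notation Re := (@complex.Re R).

Lemma Riesz (H : hilbertType R) (f : H -> R[i]) (c : R) :
  (forall a x y, f (a *: x + y) = a * f x + f y) ->
  (forall x, nc (f x) <= c * hnorm x) ->
  exists z, forall x, f x = dotp z x.
Proof.
move=> fL fb.
have f0 : f 0 = 0.
  by apply: (addIr (1 * f 0)); rewrite addrC -fL scale1r addr0 mul1r add0r.
have fZ a x : f (a *: x) = a * f x by rewrite -[_ *: _]addr0 fL f0 addr0.
have fD x y : f (x + y) = f x + f y by rewrite -[x]scale1r fL mul1r scale1r.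
have fB x y : f (x - y) = f x - f y by rewrite fD -scaleN1r fZ mulN1r.
have ker_closed x : (forall e : R, 0 < e -> exists2 y, f y = 0 & hnorm (x - y) < e) ->
    f x = 0.
  move=> cx; apply/eqP; rewrite -normc_eq0; apply: contraT => fx0.
  have fxp : 0 < nc (f x) by rewrite lt_neqAle normc_ge0 eq_sym fx0.
  have c0 : 0 < `|c| + 1 by rewrite ltr_wpDl.
  have [y fy xy] := cx _ (divr_gt0 fxp c0).
  have := fb (x - y); rewrite fB fy subr0 => h.
  suff: nc (f x) < nc (f x) by rewrite ltxx.
  apply: le_lt_trans h (le_lt_trans _ (_ : (`|c| + 1) * hnorm (x - y) < _)).
    by rewrite ler_wpM2r ?hnorm_ge0//; have := ler_norm c; lra.
  by rewrite mulrC -ltr_pdivlMr.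
have kerP a x y : f x = 0 -> f y = 0 -> f (a *: x + y) = 0.
  by move=> fx fy; rewrite fL fx fy mulr0 addr0.
pose M := ClSubspace f0 kerP ker_closed.
have [[x0 fx0]|nf] := pselect (exists x, f x <> 0); last first.
  exists 0 => x; rewrite dotp0l; apply: contrapT => fx; apply: nf.
  by exists x.
have [m Mm xm] := projection_exists M x0.
pose w := x0 - m; have fw : f w <> 0 by rewrite fB (_ : f m = 0)// subr0.
have w0 : w != 0 by apply/eqP => w0; apply: fw; rewrite w0.
have ww : dotp w w != 0 by rewrite gt_eqF ?dotp_gt0.
exists ((f w / dotp w w)^*%C *: w) => x.
rewrite dotpZl conjcK.
have fw0 : f w != 0 by apply/eqP.
have : dotp (x - (f x / f w) *: w) w = 0.
  by apply: xm; change (f (x - (f x / f w) *: w) = 0); rewrite fB fZ divfK// subrr.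
move/(congr1 conjc); rewrite -dotpC conjc0 dotpBr dotpZr => /subr0_eq ->.
by field; rewrite fw0 ww.
Qed.

Context {H K : hilbertType R}.
Implicit Types T S : bop H K.

(** [adj] is a choice with a default value, so its defining identity [adjP] rests on this existence,
    a consequence of [Riesz]. *)
Lemma adj_exists T : exists S : bop K H, forall x y, dotp (T x) y = dotp x (S y).
Proof.
have [c c0 bT] := bop_bounded T.
have ex y : exists z, forall x, dotp y (T x) = dotp z x.
  apply: (@Riesz _ _ (hnorm y * c)) => [a x x'|x]; first by rewrite linearP dotpPr.
  by apply: le_trans (Cauchy_Schwarz _ _) _; rewrite -mulrA ler_wpM2l ?hnorm_ge0.
have [f fP] := choice ex.
have fE x y : dotp (T x) y = dotp x (f y) by rewrite dotpC fP -dotpC.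
have fb : f \in @bounded_linear_pred R K H.
  apply/asboolP; split=> [a x y|].
    by apply: dotp_ext => z; rewrite dotpPr -!fE dotpPr.
  exists c => x; have [fx0|fx0] := eqVneq (hnorm (f x)) 0.
    by rewrite fx0 mulr_ge0 ?hnorm_ge0.
  have fxp : 0 < hnorm (f x) by rewrite lt_neqAle hnorm_ge0 eq_sym fx0.
  rewrite -(ler_pM2r fxp) -expr2 hnorm_sqr -fE.
  apply: le_trans (ler_norm _) (le_trans (Re_le_normc _) _).
  rewrite mulrAC; apply: le_trans (Cauchy_Schwarz _ _) _.
  by rewrite ler_wpM2r ?hnorm_ge0.
by exists (Bop fb).
Qed.

Lemma adjP T x y : dotp (T x) y = dotp x (adj T y).
Proof. by rewrite /adj; case: xgetP => [S -> //|/(_ _)]; have [S hS] := adj_exists T => /(_ S). Qed.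

Lemma adj_uniq T (S : bop K H) :
  (forall x y, dotp (T x) y = dotp x (S y)) -> adj T = S.
Proof.
move=> TS; apply: bopP => y; apply: dotp_ext => x.
by rewrite -adjP TS.
Qed.

End Adjoint.

Section AdjointTheory.
Context {R : realType}.

Lemma adjPl (H K : hilbertType R) (T : bop H K) x y :
  dotp (adj T x) y = dotp x (T y).
Proof. by rewrite dotpC -adjP -dotpC. Qed.

Lemma adjK (H K : hilbertType R) (T : bop H K) : adj (adj T) = T.
Proof. by apply: adj_uniq => x y; rewrite adjPl. Qed.

Lemma adj_lin (H K : hilbertType R) a (S T : bop H K) :
  adj (a *: S + T) = a^*%C *: adj S + adj T.
Proof.
apply: adj_uniq => x y.
by rewrite !bopDE !bopZE dotpDl dotpZl dotpDr dotpZr -!adjP.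
Qed.

Lemma adj_bcomp (H K L : hilbertType R) (S : bop K L) (T : bop H K) :
  adj (bcomp S T) = bcomp (adj T) (adj S).
Proof. by apply: adj_uniq => x y; rewrite -!adjP. Qed.

Context {H : hilbertType R}.
Implicit Types S T : bop H H.

Lemma bopME S T x : (S * T) x = S (T x). Proof. by []. Qed.
Lemma bop1E x : (1 : bop H H) x = x. Proof. by []. Qed.

Lemma adjM S T : adj (S * T) = adj T * adj S.
Proof. exact: adj_bcomp. Qed.

Lemma adj1 : adj (1 : bop H H) = 1.
Proof. exact: adj_uniq. Qed.

Lemma adj0 : adj (0 : bop H H) = 0.
Proof. by apply: adj_uniq => x y; rewrite dotp0l dotp0r. Qed.

Lemma adjD S T : adj (S + T) = adj S + adj T.
Proof. by rewrite -[S]scale1r adj_lin conjc1 !scale1r. Qed.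

Lemma adjZ a T : adj (a *: T) = a^*%C *: adj T.
Proof. by rewrite -[_ *: _]addr0 adj_lin adj0 addr0. Qed.

Lemma adjN T : adj (- T) = - adj T.
Proof. by rewrite -scaleN1r adjZ rmorphN1 scaleN1r. Qed.

Lemma adjB S T : adj (S - T) = adj S - adj T.
Proof. by rewrite adjD adjN. Qed.

Lemma adj_sum (I : Type) (r : seq I) (F : I -> bop H H) :
  adj (\sum_(i <- r) F i) = \sum_(i <- r) adj (F i).
Proof. exact: (big_morph _ adjD adj0). Qed.

Lemma bop_sumE (I : Type) (r : seq I) (P : pred I) (F : I -> bop H H) x :
  (\sum_(i <- r | P i) F i) x = \sum_(i <- r | P i) F i x.
Proof. by elim/big_rec2: _ => // i y S _ <-. Qed.

End AdjointTheory.

Section FiniteFamilies.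
Context {R : realType} {H : hilbertType R}.
Implicit Types x y : H.
Local Notation nc := (@Normc.normc R).
Local Notation Re := (@complex.Re R).

Definition orthonormal_family n (f : 'I_n -> H) : Prop :=
  forall a b, dotp (f a) (f b) = (a == b)%:R.

(** For an orthonormal [f] this is membership in its span, with the coefficients forced; it serves
    as the notion of finite-dimensional subspace. *)
Definition expands n (f : 'I_n -> H) x : Prop :=
  x = \sum_a dotp (f a) x *: f a.

Definition subspace_pred (M : H -> Prop) : Prop :=
  M 0 /\ forall a x y, M x -> M y -> M (a *: x + y).

Lemma subspace_sum (M : H -> Prop) n (c : 'I_n -> R[i]) (y : 'I_n -> H) :
  subspace_pred M -> (forall i, M (y i)) -> M (\sum_i c i *: y i).
Proof.
move=> [M0 MP] My; elim/big_ind: _ => // [u v Mu Mv|i _].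
  by rewrite -[u]scale1r; exact: MP.
by rewrite -[_ *: _]addr0; exact: MP.
Qed.

Lemma expands_subspace n (f : 'I_n -> H) : subspace_pred (expands f).
Proof.
split=> [|a x y]; rewrite /expands.
  by rewrite big1// => b _; rewrite dotp0r scale0r.
move=> fx fy; rewrite {1}fx {1}fy scaler_sumr -big_split/=.
by apply: eq_bigr => b _; rewrite dotpPr scalerDl scalerA.
Qed.

Lemma expands_linear n (f : 'I_n -> H) (T : {linear H -> H}) x :
  (forall a, expands f (T (f a))) -> expands f x -> expands f (T x).
Proof.
move=> fT fx; rewrite {1}fx linear_sum.
under eq_bigr do rewrite linearZ.
by apply: subspace_sum => //; exact: expands_subspace.
Qed.

Lemma orthonormal_expands n (f : 'I_n -> H) b :
  orthonormal_family f -> expands f (f b).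
Proof.
move=> fo; rewrite /expands (bigD1 b)//= fo eqxx scale1r big1 ?addr0// => a ab.
by rewrite fo (negbTE ab) scale0r.
Qed.

(** Dependent vectors are dropped, so [m] is part of the conclusion. The last clause places [f] in
    the span of [y], in a form that applies directly to any linear span or closed subspace
    containing [y]. *)
Lemma Gram_Schmidt n (y : 'I_n -> H) :
  exists m (f : 'I_m -> H), [/\ orthonormal_family f,
    forall i, expands f (y i) &
    forall M : H -> Prop, subspace_pred M -> (forall i, M (y i)) ->
      forall a, M (f a)].
Proof.
elim: n y => [|n IH] y.
  by exists 0%N, (fun=> 0); split=> [[]|[]|? ? ? []].
have [m [f [fo fy fM]]] := IH (fun i => y (widen_ord (leqnSn n) i)).
pose z := y ord_max - \sum_a dotp (f a) (y ord_max) *: f a.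
have fz a : dotp (f a) z = 0.
  rewrite dotpBr dotp_sumr (bigD1 a)//= dotpZr fo eqxx mulr1.
  by rewrite big1 ?addr0 ?subrr// => b ba; rewrite dotpZr fo eq_sym (negbTE ba) mulr0.
have yS (P : H -> Prop) : (forall i, P (y (widen_ord (leqnSn n) i))) ->
    P (y ord_max) -> forall i, P (y i).
  move=> Pw Pm i; case: (ltnP i n) => [lin|].
    by rewrite (_ : i = widen_ord (leqnSn n) (Ordinal lin)) //; exact: val_inj.
  move=> ni; rewrite (_ : i = ord_max) //; apply/val_inj/eqP.
  by rewrite eqn_leq ni -ltnS ltn_ord.
have [z0|z0] := eqVneq z 0.
  exists m, f; split=> // [|M sM My a]; last exact: fM.
  by apply: yS => //; rewrite /expands -(subr0_eq z0).
pose w := (hnorm z)^-1%:C *: z.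
have hz : hnorm z != 0 by apply: contra z0 => /eqP/hnorm_eq0->.
pose g (k : 'I_(m + 1)) :=
  match fintype.split k with inl a => f a | inr _ => w end.
have gl a : g (fintype.lshift 1 a) = f a by rewrite /g (unsplitK (inl a)).
have gr b : g (rshift m b) = w by rewrite /g (unsplitK (inr b)).
have fw a : dotp (f a) w = 0 by rewrite dotpZr fz mulr0.
have ww : dotp w w = 1.
  by rewrite dotpxx hnormZ normc_real ger0_norm ?invr_ge0 ?hnorm_ge0// mulVf// expr1n.
have zw : z = dotp w z *: w.
  rewrite /w dotpZl conjc_real scalerA dotpxx -!rmorphM /=.
  by rewrite (_ : _ * _ = 1) ?scale1r//; field.
exists (m + 1)%N, g; split.
- move=> a b.
  rewrite -(splitK a) -(splitK b); case: (fintype.split a) => a'; case: (fintype.split b) => b' /=;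
    rewrite !(gl, gr).
  + by rewrite fo (inj_eq (@fintype.lshift_inj _ _)).
  + by rewrite fw eq_lrshift.
  + by rewrite dotpC fw conjc0 eq_rlshift.
  + by rewrite ww (inj_eq (@rshift_inj _ _)) !ord1 eqxx.
- apply: yS => [i|]; rewrite /expands big_split_ord/= big_ord1 gr.
    under eq_bigr do rewrite gl.
    rewrite -fy (_ : dotp w _ = 0) ?scale0r ?addr0//.
    rewrite (fy i) dotp_sumr big1// => a _.
    by rewrite dotpZr (dotpC (f a) w) fw conjc0 mulr0.
  under eq_bigr do rewrite gl.
  have -> : dotp w (y ord_max) = dotp w z.
    rewrite dotpBr dotp_sumr big1 ?subr0// => a _.
    by rewrite dotpZr (dotpC (f a) w) fw conjc0 mulr0.
  by rewrite -zw addrC subrK.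
- move=> M sM My a; have [M0 MP] := sM.
  have fMa : forall a, M (f a) by apply: fM.
  rewrite /g; case: (fintype.split a) => // _.
  rewrite -[w]addr0; apply: sM.2 => //.
  rewrite /z addrC -scaleN1r; apply: sM.2 => //.
  exact: subspace_sum.
Qed.

Section Orthonormal.
Context {n : nat} (f : 'I_n -> H) (fo : orthonormal_family f).

Lemma Parseval_dotp x y : expands f x ->
  dotp x y = \sum_a dotp x (f a) * dotp (f a) y.
Proof.
move=> fx; rewrite {1}fx dotp_suml; apply: eq_bigr => a _.
by rewrite dotpZl -dotpC.
Qed.

Lemma Parseval x : expands f x -> hnorm x ^+ 2 = \sum_a nc (dotp (f a) x) ^+ 2.
Proof.
move=> fx; rewrite hnorm_sqr (Parseval_dotp _ fx) raddf_sum.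
by apply: eq_bigr => a _; rewrite (dotpC (f a) x) /= -normc_sqr.
Qed.

Lemma orthonormal_sum (c : 'I_n -> R[i]) a :
  dotp (f a) (\sum_b c b *: f b) = c a.
Proof.
rewrite dotp_sumr (bigD1 a)//= dotpZr fo eqxx mulr1 big1 ?addr0// => b ba.
by rewrite dotpZr fo eq_sym (negbTE ba) mulr0.
Qed.

Lemma orthonormal_sum_expands (c : 'I_n -> R[i]) : expands f (\sum_b c b *: f b).
Proof. by rewrite /expands; apply: eq_bigr => a _; rewrite orthonormal_sum. Qed.

Lemma Bessel x : \sum_a nc (dotp (f a) x) ^+ 2 <= hnorm x ^+ 2.
Proof.
pose p := \sum_a dotp (f a) x *: f a.
have px : dotp p (x - p) = 0.
  rewrite dotp_suml big1// => a _.
  by rewrite dotpZl dotpBr orthonormal_sum subrr mulr0.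
have := Pythagoras px; rewrite [p + _]addrC subrK => ->.
rewrite (Parseval (orthonormal_sum_expands _)).
rewrite [X in X + _](eq_bigr (fun a => nc (dotp (f a) x) ^+ 2)) => [|a _].
  by rewrite lerDl sqr_ge0.
by rewrite orthonormal_sum.
Qed.

Lemma hnorm_orthonormal a : hnorm (f a) = 1.
Proof.
apply/eqP; rewrite -(@eqrXn2 _ 2) ?hnorm_ge0// hnorm_sqr fo eqxx.
by rewrite expr1n.
Qed.

End Orthonormal.

End FiniteFamilies.

(** Bounding squares termwise avoids square roots and lets the inequality be nested over double
    sums. In the inductive step the cross term 2 z_i Z is at most p_i Q + P q_i, because (z_i Z)^2
    is at most the product of these two terms. *)
Lemma sum_Cauchy_Schwarz (R : realType) (I : Type) (r : seq I) (z p q : I -> R) :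
  (forall i, 0 <= p i) -> (forall i, 0 <= q i) -> (forall i, 0 <= z i) ->
  (forall i, z i ^+ 2 <= p i * q i) ->
  (\sum_(i <- r) z i) ^+ 2 <= (\sum_(i <- r) p i) * (\sum_(i <- r) q i).
Proof.
move=> p0 q0 z0 zpq; elim: r => [|i r IH]; first by rewrite !big_nil expr0n mul0r.
rewrite !big_cons.
have : 0 <= \sum_(j <- r) z j by apply: sumr_ge0.
have : 0 <= \sum_(j <- r) p j by apply: sumr_ge0.
have : 0 <= \sum_(j <- r) q j by apply: sumr_ge0.
move: (\sum_(j <- r) z j) (\sum_(j <- r) p j) (\sum_(j <- r) q j) IH => Z P Q IH Q0 P0 Z0.
have {}zpq := zpq i; have {}z0 := z0 i; have {}p0 := p0 i; have {}q0 := q0 i.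
suff : 2 * (z i * Z) <= p i * Q + P * q i by nra.
have a0 : 0 <= p i * Q by rewrite mulr_ge0.
have b0 : 0 <= P * q i by rewrite mulr_ge0.
rewrite -(@ler_pXn2r _ 2) ?nnegrE ?addr_ge0 ?mulr_ge0//.
have : (z i * Z) ^+ 2 <= (p i * Q) * (P * q i).
  rewrite exprMn (_ : p i * Q * _ = (p i * q i) * (P * Q)); last by ring.
  by rewrite ler_pM ?sqr_ge0.
by have := sqr_ge0 (p i * Q - P * q i); nra.
Qed.

(** * Row isometries and polynomials in them *)

Section RowIsometries.
Context {R : realType} {d : nat} {H : hilbertType R}.
Implicit Types (V : 'I_d -> bop H H) (x y : H).
Local Notation Re := (@complex.Re R).

(** Polarization: the norm of x + y gives the real parts, and replacing [y] by i y the imaginary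
    ones. *)
Lemma row_isometry_dotp V (x y : 'I_d -> H) : row_isometry V ->
  dotp (\sum_j V j (x j)) (\sum_j V j (y j)) = \sum_j dotp (x j) (y j).
Proof.
move=> iV.
have re (u v : 'I_d -> H) : Re (dotp (\sum_j V j (u j)) (\sum_j V j (v j))) =
    Re (\sum_j dotp (u j) (v j)).
  have := iV (fun j => u j + v j).
  under eq_bigr do rewrite linearD.
  under [RHS]eq_bigr do rewrite hnormD_sqr.
  rewrite big_split /= hnormD_sqr !iV !big_split /= -mulr_sumr raddf_sum.
  by move/addrI/(mulfI _) => -> //; rewrite pnatr_eq0.
have := re x y; have := re x (fun j => 'i *: y j).
have -> : \sum_j V j ('i *: y j) = 'i *: \sum_j V j (y j).
  by rewrite scaler_sumr; apply: eq_bigr => j _; rewrite linearZ.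
have -> : \sum_j dotp (x j) ('i *: y j) = 'i * \sum_j dotp (x j) (y j).
  by rewrite mulr_sumr; apply: eq_bigr => j _; rewrite dotpZr.
rewrite dotpZr.
move: (dotp (\sum_j _) _) (\sum_j dotp _ _) => [a b] [c e] /=.
by rewrite !mul0r !mul1r !sub0r => /oppr_inj -> ->.
Qed.

Lemma row_isometry_dotpE V i j x y : row_isometry V ->
  dotp (V i x) (V j y) = (i == j)%:R * dotp x y.
Proof.
move=> iV.
pose e (k : 'I_d) (z : H) (l : 'I_d) := if l == k then z else 0.
have E k z : V k z = \sum_l V l (e k z l).
  rewrite (bigD1 k)//= /e eqxx big1 ?addr0// => l /negbTE ->.
  by rewrite linear0.
rewrite !E row_isometry_dotp// (bigD1 i)//= big1 ?addr0 => [|l li].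
  by rewrite /e eqxx; case: eqP => _; rewrite ?mul1r// dotp0r mul0r.
by rewrite /e (negbTE li) dotp0l.
Qed.

Lemma row_isometry_hnorm V i x : row_isometry V -> hnorm (V i x) = hnorm x.
Proof.
move=> iV; apply/eqP; rewrite -(@eqrXn2 _ 2) ?hnorm_ge0// !hnorm_sqr.
by rewrite row_isometry_dotpE// eqxx mul1r.
Qed.

Lemma row_isometry_contraction V : row_isometry V -> row_contraction V.
Proof. by move=> iV x; rewrite iV. Qed.

(** The sum S on the left is the real part of <sum_j V_j adj(V_j) x, x>, so Cauchy-Schwarz and the
    contractivity of the row give S^2 <= S |x|^2. *)
Lemma row_contraction_adj V x : row_contraction V ->
  \sum_j hnorm (adj (V j) x) ^+ 2 <= hnorm x ^+ 2.
Proof.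
move=> cV; set S := \sum_j _.
have S0 : 0 <= S by apply: sumr_ge0 => j _; exact: sqr_ge0.
have h := cV (fun j => adj (V j) x).
have SE : S = Re (dotp (\sum_j V j (adj (V j) x)) x).
  rewrite dotp_suml raddf_sum; apply: eq_bigr => j _.
  by rewrite /= adjP -hnorm_sqr.
have : S ^+ 2 <= S * hnorm x ^+ 2.
  apply: le_trans (_ : hnorm (\sum_j V j (adj (V j) x)) ^+ 2 * hnorm x ^+ 2 <= _).
    apply: le_trans (Cauchy_Schwarz_sqr _ _).
    rewrite ler_pXn2r ?nnegrE ?normc_ge0// SE.
    by apply: le_trans (Re_le_normc _); exact: ler_norm.
  by rewrite ler_wpM2r ?sqr_ge0.
have [->|Sn0] := eqVneq S 0; first by rewrite sqr_ge0.
by rewrite expr2 ler_pM2l// lt_neqAle eq_sym Sn0.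
Qed.

(** The squared distance from [x] to V V^* x is |x|^2 - sum_j |adj(V_j) x|^2: a vector lies in the
    range of the row as soon as the adjoint column loses no norm on it. *)
Lemma row_isometry_adj_eq V x : row_isometry V ->
  hnorm x ^+ 2 <= \sum_j hnorm (adj (V j) x) ^+ 2 ->
  \sum_j V j (adj (V j) x) = x.
Proof.
move=> iV; set S := \sum_j _ => xS; apply/subr0_eq/hnorm_eq0/eqP.
rewrite -sqrf_eq0 eq_le sqr_ge0 andbT hnormB_sqr iV.
have -> : Re (dotp (\sum_j V j (adj (V j) x)) x) = S.
  rewrite dotp_suml raddf_sum; apply: eq_bigr => j _.
  by rewrite /= adjP -hnorm_sqr.
by rewrite -/S; lra.
Qed.

Lemma cuntz_sum V x : cuntz V -> \sum_j V j (adj (V j) x) = x.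
Proof.
move=> [iV sV]; apply: row_isometry_adj_eq => //.
have [y ->] := sV x; rewrite iV; apply: ler_sum => j _.
suff -> : adj (V j) (\sum_k V k (y k)) = y j by [].
apply: dotp_ext => z; rewrite -adjP dotp_sumr (bigD1 j)//=.
rewrite row_isometry_dotpE// eqxx mul1r big1 ?addr0// => k kj.
by rewrite row_isometry_dotpE// eq_sym (negbTE kj) mul0r.
Qed.

Lemma cuntz_adj V x : cuntz V -> \sum_j hnorm (adj (V j) x) ^+ 2 = hnorm x ^+ 2.
Proof.
by move=> cV; rewrite -[in RHS](cuntz_sum x cV) (proj1 cV).
Qed.

Lemma cuntzP V : row_isometry V ->
  (forall x, \sum_j V j (adj (V j) x) = x) -> cuntz V.
Proof. by move=> iV hV; split=> // y; exists (fun j => adj (V j) y). Qed.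

End RowIsometries.

(** * Sums over words of a given length *)

Section Levels.
Context {d : nat}.

(* Sums over the words of length [m], by recursion on the first letter. *)
Fixpoint levsum {V : zmodType} m (F : seq 'I_d -> V) : V :=
  if m is m'.+1 then \sum_j levsum m' (fun s => F (j :: s)) else F [::].

Lemma eq_levsum {V : zmodType} m (F G : seq 'I_d -> V) :
  F =1 G -> levsum m F = levsum m G.
Proof.
elim: m F G => [|m IH] F G FG /=; first exact: FG.
by apply: eq_bigr => j _; apply: IH => s; exact: FG.
Qed.

Lemma eq_levsum_size {V : zmodType} m (F G : seq 'I_d -> V) :
  (forall s, size s = m -> F s = G s) -> levsum m F = levsum m G.
Proof.
elim: m F G => [|m IH] F G FG /=; first exact: FG.
by apply: eq_bigr => j _; apply: IH => s ms; apply: FG; rewrite /= ms.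
Qed.

Lemma wlevelE {V : zmodType} (F : word d -> V) m :
  wlevel F m = levsum m (fun s => F (FMonom s)).
Proof.
elim: m F => [|m IH] F.
  rewrite /wlevel /= (eq_bigr (fun=> F (FMonom [::]))) => [|t _].
    by rewrite big_const card_tuple expn0 /= addr0.
  by rewrite tuple0.
rewrite /wlevel (reindex (fun p : 'I_d * m.-tuple 'I_d =>
  [tuple of p.1 :: p.2])) /=; last first.
  exists (fun t : m.+1.-tuple 'I_d => (thead t, [tuple of behead t])) =>
    [[i t] _|t _].
    by congr pair; apply/val_inj.
  by rewrite [RHS]tuple_eta; apply/val_inj.
rewrite -(pair_bigA _ (fun i (t : m.-tuple 'I_d) => F (FMonom (i :: t)))) /=.
apply: eq_bigr => j _.
rewrite -(IH (fun w => F (FMonom (j :: w)))).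
by apply: eq_bigr => t _.
Qed.

Lemma levsum_morph {V W : zmodType} (phi : V -> W) m F :
  phi 0 = 0 -> {morph phi : x y / x + y} ->
  phi (levsum m F) = levsum m (phi \o F).
Proof.
move=> p0 pD; elim: m F => [//|m IH] F /=.
rewrite (big_morph phi pD p0); apply: eq_bigr => j _.
by rewrite IH.
Qed.

Lemma levsumD {V : zmodType} m (F G : seq 'I_d -> V) :
  levsum m (fun s => F s + G s) = levsum m F + levsum m G.
Proof.
elim: m F G => [//|m IH] F G /=; rewrite -big_split /=.
by apply: eq_bigr => j _; rewrite IH.
Qed.

Lemma levsum_exchange {V : zmodType} n m (F : 'I_n -> seq 'I_d -> V) :
  levsum m (fun s => \sum_a F a s) = \sum_a levsum m (F a).
Proof.
elim: m F => [//|m IH] F /=; rewrite exchange_big /=.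
by apply: eq_bigr => j _; rewrite IH.
Qed.

Lemma levsum0 {V : zmodType} m (F : seq 'I_d -> V) :
  (forall s, size s = m -> F s = 0) -> levsum m F = 0.
Proof.
elim: m F => [|m IH] F F0 /=; first exact: F0.
by apply: big1 => j _; apply: IH => s ms; apply: F0; rewrite /= ms.
Qed.

Lemma levsum_pick {V : zmodType} m (F : seq 'I_d -> V) w : size w = m ->
  (forall s, size s = m -> s <> w -> F s = 0) -> levsum m F = F w.
Proof.
elim: m F w => [|m IH] F [|k w] //= [mw] F0.
rewrite (bigD1 k)//= (IH (fun s => F (k :: s)) w mw); last first.
  by move=> s ms sw; apply: F0 => [|[]//]; rewrite /= ms.
rewrite big1 ?addr0// => j jk; apply: levsum0 => s ms; apply: F0.
  by rewrite /= ms.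
by case=> jk'; rewrite jk' eqxx in jk.
Qed.

Context {R : realType}.

Lemma levsum_le m (F G : seq 'I_d -> R) :
  (forall s, size s = m -> F s <= G s) -> levsum m F <= levsum m G.
Proof.
elim: m F G => [|m IH] F G FG /=; first exact: FG.
by apply: ler_sum => j _; apply: IH => s ms; apply: FG; rewrite /= ms.
Qed.

Lemma levsum_ge0 m (F : seq 'I_d -> R) : (forall s, 0 <= F s) -> 0 <= levsum m F.
Proof.
elim: m F => [|m IH] F F0 /=; first exact: F0.
by apply: sumr_ge0 => j _; apply: IH.
Qed.

Lemma levsumZ m (c : R) (F : seq 'I_d -> R) :
  levsum m (fun s => c * F s) = c * levsum m F.
Proof.
elim: m F => [//|m IH] F /=; rewrite mulr_sumr.
by apply: eq_bigr => j _; rewrite IH.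
Qed.

End Levels.

Section PolynomialCalculus.
Context {R : realType} {d : nat} {H : hilbertType R}.
Implicit Types (V : 'I_d -> bop H H) (p q : ncpoly R d).

Lemma wpow_nil {A : pzRingType} (a : 'I_d -> A) : wpow a (FMonom [::]) = 1.
Proof. by rewrite /wpow big_nil. Qed.

Lemma wpow_cons {A : pzRingType} (a : 'I_d -> A) j s :
  wpow a (FMonom (j :: s)) = a j * wpow a (FMonom s).
Proof. by rewrite /wpow big_cons. Qed.

Lemma wpow_cat {A : pzRingType} (a : 'I_d -> A) s t :
  wpow a (FMonom (s ++ t)) = wpow a (FMonom s) * wpow a (FMonom t).
Proof. by rewrite /wpow big_cat. Qed.

Lemma wpow_mul {A : pzRingType} (a : 'I_d -> A) (u v : word d) :
  wpow a (mmul u v) = wpow a u * wpow a v.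
Proof. by rewrite /wpow fmM big_cat. Qed.

Lemma peval_fset V p (D : finSet (word d)) : fsubset (msupp p) D ->
  peval V p = \sum_(w <- enum_fset D) mcoeff w p *: wpow V w.
Proof.
move=> pD; rewrite /peval; apply: big_fset_incl => // w _ wp.
by rewrite (mcoeff_outdom wp) scale0r.
Qed.

Lemma peval_linear V a p q : peval V (a *: p + q) = a *: peval V p + peval V q.
Proof.
pose D := fsetU (msupp p) (fsetU (msupp q) (msupp (a *: p + q))).
rewrite !(@peval_fset V _ D).
- rewrite scaler_sumr -big_split /=; apply: eq_bigr => w _.
  by rewrite mcoeffD mcoeffZ scalerDl scalerA.
- by rewrite /D fsetUCA fsubsetUl.
- by rewrite /D fsubsetUl.
- by rewrite /D fsetUA fsubsetUr.
Qed.

HB.instance Definition _ V :=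
  GRing.isLinear.Build R[i] (ncpoly R d) (bop H H) _ (peval V) (peval_linear V).

Lemma pevalU V c w : peval V (mkmalgU w c) = c *: wpow V w.
Proof.
rewrite (@peval_fset V _ (fset1 w)) ?msuppU_le// big_seq_fset1.
by rewrite mcoeffU eqxx mulr1n.
Qed.

Lemma peval1 V : peval V 1 = 1.
Proof. by rewrite pevalU scale1r /wpow fm1 big_nil. Qed.

Lemma peval_var V k : peval V (ncvar k) = V k.
Proof. by rewrite pevalU scale1r /wpow fmU big_seq1. Qed.

Lemma pevalM V p q : peval V (p * q) = peval V p * peval V q.
Proof.
rewrite malgME !linear_sum /=.
rewrite [in RHS]/peval mulr_suml; apply: eq_bigr => u _.
rewrite linear_sum /= mulr_sumr; apply: eq_bigr => v _.
rewrite pevalU wpow_mul; apply: bopP => x.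
by rewrite !(bopZE, bopME) linearZ /= scalerA.
Qed.

Lemma wpow_adj_sub V (M : H -> Prop) w x :
  (forall j x, M x -> M (adj (V j) x)) -> M x -> M (adj (wpow V w) x).
Proof.
move=> MV; rewrite -(fmK w); elim: (fmonom_val w) x => [|j s IH] x Mx.
  by rewrite wpow_nil adj1.
by rewrite wpow_cons adjM bopME; apply/IH/MV.
Qed.

Lemma peval_adj_sub V (M : H -> Prop) p x : subspace_pred M ->
  (forall j x, M x -> M (adj (V j) x)) -> M x -> M (adj (peval V p) x).
Proof.
move=> [M0 MP] MV Mx; rewrite /peval adj_sum bop_sumE.
elim/big_ind: _ => // [u v Mu Mv|w _]; first by rewrite -[u]scale1r; apply: MP.
rewrite adjZ bopZE -[_ *: _]addr0; apply: MP => //.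
exact: wpow_adj_sub.
Qed.

End PolynomialCalculus.

Section FreeSemigroupAlgebra.
Context {R : realType} {d : nat} {H : hilbertType R}.
Implicit Types (V : 'I_d -> bop H H).
Local Notation nc := (@Normc.normc R).
Local Notation FSA := (@free_semigroup_algebra R d H).

Lemma FSA_peval V p : FSA V (peval V p).
Proof.
by move=> n x y e e0; exists p => i; rewrite subrr dotp0r Normc.normc0.
Qed.

Lemma FSA1 V : FSA V 1.
Proof. by rewrite -(peval1 V); exact: FSA_peval. Qed.

Lemma FSA0 V : FSA V 0.
Proof. by rewrite -(linear0 (peval V)); exact: FSA_peval. Qed.

Lemma FSA_var V k : FSA V (V k).
Proof. by rewrite -(peval_var V); exact: FSA_peval. Qed.

Lemma FSA_linear V a S T : FSA V S -> FSA V T -> FSA V (a *: S + T).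
Proof.
move=> hS hT n x y e e0.
have c0 : 0 < nc a + 1 by rewrite ltr_wpDl ?normc_ge0.
have [p hp] := hS n x y _ (divr_gt0 (divr_gt0 e0 (ltr0n _ 2)) c0).
have [q hq] := hT n x y _ (divr_gt0 e0 (ltr0n _ 2)).
exists (a *: p + q) => i; rewrite peval_linear opprD addrACA -scalerBr.
rewrite bopDE bopZE dotpPr; apply: le_lt_trans (le_normcD _ _) _.
rewrite Normc.normcM.
have := hq i; have : nc a * nc (dotp (x i) ((S - peval V p) (y i))) <= e / 2.
  apply: le_trans (_ : (nc a + 1) * (e / 2 / (nc a + 1)) <= _).
    by rewrite ler_pM ?normc_ge0 ?lerDl// ltW.
  by rewrite mulrC divfK// gt_eqF.
lra.
Qed.

Lemma FSA_scale V a S : FSA V S -> FSA V (a *: S).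
Proof. by move=> hS; rewrite -[_ *: _]addr0; apply: FSA_linear => //; exact: FSA0. Qed.

Lemma FSA_sum V (I : Type) (r : seq I) (F : I -> bop H H) :
  (forall i, FSA V (F i)) -> FSA V (\sum_(i <- r) F i).
Proof.
move=> hF; elim: r => [|i r IH]; first by rewrite big_nil; exact: FSA0.
by rewrite big_cons -[F i]scale1r; exact: FSA_linear.
Qed.

(** Multiplication is only separately continuous for the weak operator topology, so the
    approximations are chosen in turn: [p] for [S] tested on T y, then [q] for [T] tested against
    [adj (peval V p)] applied to x. *)
Lemma FSA_mul V S T : FSA V S -> FSA V T -> FSA V (S * T).
Proof.
move=> hS hT n x y e e0; have e2 := divr_gt0 e0 (ltr0n _ 2).
have [p hp] := hS n x (fun i => T (y i)) _ e2.
have [q hq] := hT n (fun i => adj (peval V p) (x i)) y _ e2.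
exists (p * q) => i; rewrite pevalM.
have -> : S * T - peval V p * peval V q =
    (S - peval V p) * T + peval V p * (T - peval V q).
  by rewrite mulrBl mulrBr addrA subrK.
rewrite bopDE dotpDr; apply: le_lt_trans (le_normcD _ _) _.
by have := hp i; have := hq i; rewrite adjPl !bopME; lra.
Qed.

(** Equality of two matrix coefficients is a weakly closed condition, so it passes from polynomials
    to the whole algebra. *)
Lemma FSA_dotp_eq V T (x y x' y' : H) : FSA V T ->
  (forall p, dotp x (peval V p y) = dotp x' (peval V p y')) ->
  dotp x (T y) = dotp x' (T y').
Proof.
move=> hT hp; apply/subr0_eq/eqP; rewrite -normc_eq0; apply: contraT => n0.
set z := _ - _ in n0; have z0 : 0 < nc z by rewrite lt_neqAle normc_ge0 eq_sym n0.
have e2 := divr_gt0 z0 (ltr0n R 2).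
(* A family of two pairs of vectors, so that one polynomial approximates both coefficients. *)
have [p hpp] := hT 2 (fun i => if i == ord0 then x else x')
  (fun i => if i == ord0 then y else y') _ e2.
have h1 : nc (dotp x ((T - peval V p) y)) < nc z / 2 := hpp ord0.
have h2 : nc (dotp x' ((T - peval V p) y')) < nc z / 2 := hpp ord_max.
suff: nc z < nc z by rewrite ltxx.
have zE : z = dotp x ((T - peval V p) y) - dotp x' ((T - peval V p) y').
  by rewrite !bopDE !dotpDr (_ : (- peval V p) y = - peval V p y)//
    (_ : (- peval V p) y' = - peval V p y')// !dotpNr (hp p) /z; ring.
rewrite {1}zE; apply: le_lt_trans (le_normcD _ _) _; rewrite normcN.
by rewrite [ltRHS]splitr; exact: ltrD.
Qed.

End FreeSemigroupAlgebra.

Local Open Scope classical_set_scope.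

(** * The free semigroup algebra of the left shift *)

Section SeriesLemmas.
Context {R : realType}.
Local Notation nc := (@Normc.normc R).

Lemma series_single (u : nat -> R) k : (forall n, n <> k -> u n = 0) ->
  series u @ \oo --> u k.
Proof.
move=> u0; apply: cvg_near_cst; exists k.+1 => // n /= kn.
rewrite /series /= (bigD1_seq k) ?iota_uniq//=; last by rewrite mem_index_iota.
by rewrite big1 ?addr0// => j /eqP/u0.
Qed.

Lemma csum_single (u : nat -> R[i]) k : (forall n, n <> k -> u n = 0) ->
  csum u = u k.
Proof.
move=> u0; rewrite /csum.
rewrite (cvg_lim _ (@series_single (fun n => complex.Re (u n)) k _))//; last first.
  by move=> n /u0 ->.
rewrite (cvg_lim _ (@series_single (fun n => complex.Im (u n)) k _))//; last first.
  by move=> n /u0 ->.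
by case: (u k).
Qed.

(** Dominated convergence: the tail of [b] bounds all the tails at once, and the remaining finite
    sum tends to 0 termwise. *)
Lemma series_dominated (v : nat -> nat -> R) (b : nat -> R) :
  (forall m n, 0 <= v m n <= b n) -> cvgn (series b) ->
  (forall n, (v^~ n) @ \oo --> 0) ->
  (fun m => limn (series (v m))) @ \oo --> 0.
Proof.
move=> vb cb v0.
have b0 n : 0 <= b n by have /andP[h1 h2] := vb 0%N n; exact: le_trans h1 h2.
have cv m : cvgn (series (v m)).
  apply: (@series_le_cvg _ (v m) b) => // n; first by have /andP[] := vb m n.
  by have /andP[] := vb m n.
have v_ge0 m : 0 <= limn (series (v m)).
  apply: limr_ge => //; near=> N; apply: sumr_ge0 => n _.
  by have /andP[] := vb m n.
apply/cvgrPdist_lt => e e0; have e2 : 0 < e / 2 by rewrite divr_gt0.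
have := cb => /cvgrPdist_lt/(_ _ e2)[N _ /(_ N (leqnn N)) /= bN].
have : (fun m => series (v m) N) @ \oo --> (0 : R).
  have := @cvg_finsum R _ (index_iota 0 N) (fun n m => v m n) (fun=> 0) v0.
  by rewrite [X in _ --> X]big1.
move/cvgrPdist_lt/(_ _ e2) => [M _ vM]; exists M => // m Mm.
have := vM m Mm; rewrite /= !sub0r !normrN => h.
rewrite ger0_norm//.
apply: le_lt_trans (_ : series (v m) N + (limn (series b) - series b N) < _).
  apply: limr_le => //; near=> K.
  have NK : (N <= K)%N by near: K; exists N.
  have bK : series b K <= limn (series b).
    apply: nondecreasing_cvgn_le => // i j ij.
    by apply: nondecreasing_series => // k _ _; exact: b0.
  apply: le_trans (_ : series (v m) N + (series b K - series b N) <= _); last first.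
    by rewrite lerD2l lerD2r.
  rewrite sub_series_geq// -[series (v m) K](subrK (series (v m) N)) addrC.
  rewrite sub_series_geq// lerD2l; apply: ler_sum => k _.
  by have /andP[] := vb m k.
have h1 : series (v m) N < e / 2 by apply: le_lt_trans h; exact: ler_norm.
have h2 : limn (series b) - series b N < e / 2.
  by apply: le_lt_trans bN; exact: ler_norm.
by rewrite [ltRHS]splitr; exact: ltrD.
Unshelve. all: by end_near. Qed.

(** The factor 2 comes from treating real and imaginary parts separately. *)
Lemma normc_csum_le (u : nat -> R[i]) (v : nat -> R) :
  (forall n, nc (u n) <= v n) -> cvgn (series v) ->
  nc (csum u) <= 2 * limn (series v).
Proof.
move=> uv cv.
have v0 n : 0 <= v n := le_trans (normc_ge0 _) (uv n).
have part (p : R[i] -> R) : (forall z, `|p z| <= nc z) ->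
    `|limn (series (fun n => p (u n)))| <= limn (series v).
  move=> pn.
  have c : cvgn [normed series (fun n => p (u n))].
    apply: (@series_le_cvg _ (fun n => `|p (u n)|) v) => // n.
    exact: le_trans (pn _) (uv n).
  apply: le_trans (lim_series_norm c) _.
  apply: lim_series_le => // n.
  exact: le_trans (pn _) (uv n).
have := part _ (@Re_le_normc R); have := part _ (@Im_le_normc R).
rewrite /csum; set a := limn (series (fun n => complex.Re (u n))).
set b := limn (series (fun n => complex.Im (u n))).
set c := limn (series v) => hb ha.
rewrite -(@ler_pXn2r _ 2) ?nnegrE ?normc_ge0 ?mulr_ge0//; last first.
  exact: le_trans (normr_ge0 _) ha.
rewrite normc2 /= -(real_normK (num_real a)) -(real_normK (num_real b)).
have := normr_ge0 a; have := normr_ge0 b; nra.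
Qed.

End SeriesLemmas.

(** * The basis of words in the Fock space *)

Section FockBasis.
Context {R : realType} {d : nat}.
Local Notation H2 := (@fock R d).
Local Notation L := (@lshift R d).
Implicit Types (s t : seq 'I_d) (h : H2).

Lemma evec_subproof s : (fun w : word d => (w == FMonom s)%:R) \in @l2_pred R d.
Proof.
apply/asboolP; apply: (proj1 (@wseries_bounded _ _
  (fun w => Normc.normc ((w == FMonom s)%:R : R[i]) ^+ 2) 1 _ _)) => [w|N].
  exact: sqr_ge0.
have lE m : wlevel (fun w => Normc.normc ((w == FMonom s)%:R : R[i]) ^+ 2) m =
    (m == size s)%:R.
  rewrite wlevelE; case: eqP => [->|ms].
    rewrite (levsum_pick (w := s))// ?eqxx ?normc2 /= ?expr1n ?expr0n ?addr0//.
    move=> t _ ts; rewrite (_ : (_ == _) = false) ?Normc.normc0 ?expr0n//.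
    by apply/eqP => -[].
  apply: levsum0 => t mt; rewrite (_ : (_ == _) = false) ?Normc.normc0 ?expr0n//.
  by apply/eqP => -[ts]; rewrite -mt ts in ms.
rewrite /series /=; under eq_bigr do rewrite lE.
have [sN|Ns] := ltnP (size s) N.
  rewrite (bigD1_seq (size s)) ?iota_uniq//=; last by rewrite mem_index_iota.
  by rewrite eqxx big1 ?addr0// => j /negbTE ->.
rewrite big_nat big1// => j /andP[_ jN].
by rewrite ltn_eqF// (leq_trans jN Ns).
Qed.

Definition evec s : H2 := Fock (evec_subproof s).

Lemma dotp_evec s h : dotp (evec s) h = h (FMonom s).
Proof.
change (fock_dotp (evec s) h = h (FMonom s)); rewrite /fock_dotp /wsum.
have lE m : wlevel (fun w => (evec s w)^*%C * h w) m =
    (m == size s)%:R * h (FMonom s).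
  rewrite wlevelE; case: eqP => [->|ms].
    rewrite (levsum_pick (w := s))//= ?eqxx ?conjc1// => t _ ts.
    rewrite (_ : (_ == _) = false) ?conjc0 ?mul0r//.
    by apply/eqP => -[].
  rewrite mul0r; apply: levsum0 => t mt /=.
  rewrite (_ : (_ == _) = false) ?conjc0 ?mul0r//.
  by apply/eqP => -[ts]; rewrite -mt ts in ms.
rewrite (@csum_single _ _ (size s)).
  by move: (lE (size s)); rewrite eqxx mul1r.
by move=> n /eqP/negbTE ns; move: (lE n); rewrite ns mul0r.
Qed.

Lemma evec_dotp s t : dotp (evec s) (evec t) = (s == t)%:R.
Proof. by rewrite dotp_evec /=. Qed.

Lemma hnorm_evec s : hnorm (evec s) = 1.
Proof.
by apply/eqP; rewrite -(@eqrXn2 _ 2) ?hnorm_ge0// hnorm_sqr evec_dotp eqxx expr1n.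
Qed.

Lemma evec_total h : (forall s, dotp (evec s) h = 0) -> h = 0.
Proof.
move=> h0; apply/val_inj/funext => w; rewrite -(fmK w) /=.
by rewrite -dotp_evec h0.
Qed.

Lemma shift_evec k s : L k (evec s) = evec (k :: s).
Proof.
apply/val_inj/funext => -[[|j t]] /=; first by rewrite /shift /=.
rewrite /shift /=; case: eqP => [->|jk]; first by rewrite !fmP /= eqseq_cons eqxx.
by rewrite fmP /= eqseq_cons; move/eqP/negbTE: jk => ->.
Qed.

Lemma wpow_shift_evec s t : wpow L (FMonom s) (evec t) = evec (s ++ t).
Proof.
elim: s => [|j s IH]; first by rewrite wpow_nil.
by rewrite wpow_cons bopME IH shift_evec.
Qed.

Lemma hnorm_fock h : hnorm h ^+ 2 =
  limn (series (wlevel (fun w => Normc.normc (h w) ^+ 2))).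
Proof. by rewrite hnorm_sqr [X in complex.Re X]fock_dotpxx. Qed.

(** The coefficients of sum_j L_j x_j at words of length m + 1 are those of the x_j at length m,
    sorted by first letter; hence the partial sums agree after a shift by one. *)
Lemma lshift_row_isometry : row_isometry L.
Proof.
move=> x.
have E (s : seq 'I_d) : (\sum_j L j (x j)) (FMonom s) =
    if s is j :: t then x j (FMonom t) else 0.
  rewrite -dotp_evec dotp_sumr; case: s => [|k t].
    by apply: big1 => j _; rewrite dotp_evec.
  rewrite (bigD1 k)//= dotp_evec /= /shift /= eqxx big1 ?addr0// => j jk.
  by rewrite dotp_evec /= /shift /= eq_sym (negbTE jk).
rewrite hnorm_fock.
have S N : series (wlevel (fun w => Normc.normc ((\sum_j L j (x j)) w) ^+ 2)) N.+1 =
    \sum_j series (wlevel (fun w => Normc.normc (x j w) ^+ 2)) N.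
  rewrite /series /= big_nat_recl// wlevelE /= E Normc.normc0 expr0n add0r.
  rewrite exchange_big /=; apply: eq_bigr => m _; rewrite wlevelE /=.
  apply: eq_bigr => j _; rewrite wlevelE; apply: eq_levsum => s.
  by rewrite E.
apply: cvg_lim => //; rewrite -(cvg_shiftS _) /=.
rewrite (_ : (fun n => _) = fun N => \sum_j series (wlevel (fun w =>
  Normc.normc (x j w) ^+ 2)) N); last by apply/funext => N; exact: S.
apply: cvg_finsum => j; rewrite hnorm_fock.
by have /asboolP := fock_coefP (x j).
Qed.

End FockBasis.

(** * Decay of energy along words *)

Section ColumnEnergy.
Context {R : realType} {d : nat} {H : hilbertType R}.
Implicit Types (B : 'I_d -> bop H H) (x y : H).
Local Notation nc := (@Normc.normc R).

(* [energy B m x] is the sum of [|B^w x|^2] over the words [w] of length [m]. *)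
Fixpoint energy B m x : R :=
  if m is m'.+1 then \sum_j energy B m' (B j x) else hnorm x ^+ 2.

Definition column_contraction B : Prop :=
  forall x, \sum_j hnorm (B j x) ^+ 2 <= hnorm x ^+ 2.

Lemma energy_ge0 B m x : 0 <= energy B m x.
Proof.
elim: m x => [|m IH] x /=; first exact: sqr_ge0.
exact: sumr_ge0.
Qed.

Lemma energyZ B m a x : energy B m (a *: x) = nc a ^+ 2 * energy B m x.
Proof.
elim: m x => [|m IH] x /=; first by rewrite hnormZ exprMn.
by rewrite mulr_sumr; apply: eq_bigr => j _; rewrite linearZ IH.
Qed.

(** The weight [t] is free because [FSA_shift_energy] needs the factor 1 + t close enough to 1 to
    keep a strict contraction. The base case is |t x - y|^2 >= 0 divided by t. *)
Lemma energyD B m (t : R) x y : 0 < t ->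
  energy B m (x + y) <= (1 + t) * energy B m x + (1 + t^-1) * energy B m y.
Proof.
move=> t0; elim: m x y => [|m IH] x y /=; last first.
  rewrite !mulr_sumr -big_split /=; apply: ler_sum => j _.
  by rewrite linearD IH.
have := sqr_ge0 (hnorm (t%:C *: x - y)).
rewrite hnormB_sqr hnormZ dotpZl conjc_real Re_rmul normc_real exprMn.
rewrite real_normK ?num_real// hnormD_sqr.
set a := hnorm x ^+ 2; set b := hnorm y ^+ 2; set c := complex.Re _ => h.
have : 0 <= t^-1 * (t ^+ 2 * a + b - 2 * (t * c)).
  by rewrite mulr_ge0// invr_ge0 ltW.
have -> : t^-1 * (t ^+ 2 * a + b - 2 * (t * c)) = t * a + t^-1 * b - 2 * c.
  by field; rewrite gt_eqF.
by move: t^-1 => u; lra.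
Qed.

Lemma energy_nonincreasing B m x : column_contraction B ->
  energy B m.+1 x <= energy B m x.
Proof.
move=> cB; elim: m x => [|m IH] x; first exact: cB.
change (\sum_j energy B m.+1 (B j x) <= \sum_j energy B m (B j x)).
by apply: ler_sum => j _; exact: IH.
Qed.

Lemma energy_le B m x : column_contraction B -> energy B m x <= hnorm x ^+ 2.
Proof.
move=> cB; elim: m => [//|m IH].
exact: le_trans (energy_nonincreasing _ _ cB) IH.
Qed.

Lemma energy_cvg B x : column_contraction B -> cvgn (energy B ^~ x).
Proof.
move=> cB; apply: nonincreasing_is_cvgn.
  by apply/nonincreasing_seqP => m; exact: energy_nonincreasing.
by exists 0 => _ [m _ <-]; exact: energy_ge0.
Qed.

Definition energy_vanishes B x : Prop := energy B ^~ x @ \oo --> (0 : R).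

Lemma energy_vanishes0 B : energy_vanishes B 0.
Proof.
rewrite /energy_vanishes (_ : energy B ^~ 0 = fun=> 0); first exact: cvg_cst.
by apply/funext => m; rewrite -(scale0r 0) energyZ Normc.normc0 expr0n mul0r.
Qed.

Lemma energy_vanishesP B a x y : energy_vanishes B x -> energy_vanishes B y ->
  energy_vanishes B (a *: x + y).
Proof.
move=> ex ey.
have h : (fun m => 2 * (nc a ^+ 2 * energy B m x) + 2 * energy B m y) @ \oo
    --> 2 * (nc a ^+ 2 * 0) + 2 * (0 : R).
  apply: cvgD; apply: cvgM; [exact: cvg_cst| |exact: cvg_cst|exact: ey].
  by apply: cvgM; [exact: cvg_cst|exact: ex].
rewrite !mulr0 addr0 in h.
rewrite /energy_vanishes; apply: squeeze_cvgr h; last exact: cvg_cst.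
apply: nearW => m; rewrite energy_ge0 /=.
by have := energyD B m (a *: x) y ltr01; rewrite energyZ invr1; lra.
Qed.

Lemma energy_vanishes_closed B x : column_contraction B ->
  (forall e : R, 0 < e -> exists2 y, energy_vanishes B y & hnorm (x - y) < e) ->
  energy_vanishes B x.
Proof.
move=> cB hx; apply/cvgrPdist_lt => e e0.
have e4 : 0 < e / 4 by rewrite divr_gt0.
have s0 : 0 < Num.sqrt (e / 4) by rewrite sqrtr_gt0.
have [y ey xy] := hx _ s0.
have /cvgrPdist_lt/(_ _ e4)[N _ yN] := ey; exists N => // m Nm.
rewrite sub0r normrN ger0_norm ?energy_ge0//.
have := yN m Nm; rewrite /= sub0r normrN ger0_norm ?energy_ge0// => h1.
have := energyD B m (x - y) y ltr01; rewrite subrK invr1 => h2.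
have h3 := energy_le m (x - y) cB.
have h4 : hnorm (x - y) ^+ 2 < e / 4.
  by rewrite -(sqr_sqrtr (ltW e4)) ltr_pXn2r ?nnegrE ?hnorm_ge0 ?sqrtr_ge0.
lra.
Qed.

Lemma energy_vanishes_total B (A : set H) : column_contraction B ->
  (forall y, A y -> energy_vanishes B y) ->
  (forall x, (forall y, A y -> dotp y x = 0) -> x = 0) ->
  forall x, energy_vanishes B x.
Proof.
move=> cB hA tA x; apply: energy_vanishes_closed => // e e0.
have [y [n [c [a [Aa ->]]]] xy] := total_closed_span tA x e0.
exists (\sum_k c k *: a k) => //.
apply: subspace_sum => [|k]; last exact: hA.
by split; [exact: energy_vanishes0|exact: energy_vanishesP].
Qed.

(** The energy is nonincreasing, so it has a limit l, and l <= rho l forces l = 0. The error [delta]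
    absorbs the energy of vectors already known to lose it. *)
Lemma energy_vanishes_step B x (M : nat) (rho : R) (delta : nat -> R) :
  column_contraction B -> 0 <= rho -> rho < 1 -> delta @ \oo --> (0 : R) ->
  (forall m, energy B (m + M) x <= rho * energy B m x + delta m) ->
  energy_vanishes B x.
Proof.
move=> cB r0 r1 d0 hE; have cE := @energy_cvg B x cB.
set l := limn (energy B ^~ x) in cE.
have l0 : 0 <= l by apply: limr_ge => //; apply: nearW => m; exact: energy_ge0.
have : l <= rho * l + 0.
  have c1 : (fun m => energy B (m + M) x) @ \oo --> l.
    by move: cE; rewrite -(cvg_shiftn M (energy B ^~ x)).
  have c2 : (fun m => rho * energy B m x + delta m) @ \oo --> rho * l + 0.
    by apply: cvgD => //; apply: cvgM => //; exact: cvg_cst.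
  rewrite -{1}(cvg_lim _ c1)// -(cvg_lim _ c2)//.
  apply: ler_lim; [by apply: cvgP c1|by apply: cvgP c2|].
  by apply: nearW => m; exact: hE.
rewrite addr0 => h; have l00 : l = 0 by nra.
by rewrite /energy_vanishes -l00.
Qed.

End ColumnEnergy.

Section WordCombinations.
Context {R : realType} {d : nat} {H : hilbertType R}.
Implicit Types (A V : 'I_d -> bop H H) (c : seq 'I_d -> R[i]) (x y : H).
Local Notation nc := (@Normc.normc R).

Fixpoint word_comb A m c : bop H H :=
  if m is m'.+1 then \sum_j A j * word_comb A m' (fun s => c (j :: s))
  else c [::] *: (1 : bop H H).

Definition csqr c : seq 'I_d -> R := fun s => nc (c s) ^+ 2.

(** Cauchy-Schwarz over the words of length m. Coefficients and operators are separated: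
    combinations whose coefficients have bounded square sum tend weakly to 0 as soon as the energy
    of the adjoints does. *)
Lemma word_comb_dotp A m c x y :
  nc (dotp x (word_comb A m c y)) ^+ 2 <=
  levsum m (csqr c) * hnorm y ^+ 2 * energy (fun j => adj (A j)) m x.
Proof.
elim: m c x => [|m IH] c x /=.
  change (nc (dotp x (c [::] *: y)) ^+ 2 <=
    nc (c [::]) ^+ 2 * hnorm y ^+ 2 * hnorm x ^+ 2).
  rewrite dotpZr Normc.normcM exprMn -mulrA ler_wpM2l ?sqr_ge0//.
  by rewrite mulrC Cauchy_Schwarz_sqr.
rewrite bop_sumE dotp_sumr.
apply: le_trans (_ : (\sum_j nc (dotp x ((A j * word_comb A m
    (fun s => c (j :: s))) y))) ^+ 2 <= _).
  rewrite ler_pXn2r ?nnegrE ?normc_ge0 ?normc_sum//.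
  by apply: sumr_ge0 => j _; exact: normc_ge0.
rewrite mulr_suml; apply: sum_Cauchy_Schwarz => j.
- rewrite mulr_ge0 ?sqr_ge0//; apply: levsum_ge0 => s; exact: sqr_ge0.
- exact: energy_ge0.
- exact: normc_ge0.
- by rewrite bopME -adjPl; exact: IH.
Qed.

Lemma word_comb_FSA V A m c : (forall j, free_semigroup_algebra V (A j)) ->
  free_semigroup_algebra V (word_comb A m c).
Proof.
move=> hA; elim: m c => [|m IH] c /=; first by apply: FSA_scale; exact: FSA1.
by apply: FSA_sum => j; apply: FSA_mul.
Qed.

End WordCombinations.

Section FreeSemigroupAlgebraOfShift.
Context {R : realType} {d : nat}.
Local Notation H2 := (@fock R d).
Local Notation L := (@lshift R d).
Local Notation nc := (@Normc.normc R).

(* Elements of the algebra commute with right multiplications by words, so they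
   are determined by their action on the vacuum. *)
Lemma FSA_shift_coef T (w v : seq 'I_d) : free_semigroup_algebra L T ->
  dotp (evec w) (T (evec v)) =
  if w == take (size w - size v) w ++ v
  then dotp (evec (take (size w - size v) w)) (T (evec [::])) else 0.
Proof.
move=> hT; set t := take _ _.
suff hp p : dotp (evec w) (peval L p (evec v)) =
    dotp (if w == t ++ v then evec t else 0 : H2) (peval L p (evec [::])).
  rewrite (FSA_dotp_eq hT hp).
  by case: ifP => // _; rewrite dotp0l.
rewrite /peval !bop_sumE !dotp_sumr; apply: eq_bigr => u _.
rewrite !bopZE !dotpZr -(fmK u) !wpow_shift_evec cats0 evec_dotp.
congr (_ * _); set s := fmonom_val u; case: (w =P t ++ v) => [wt|wt].
  rewrite evec_dotp {1}wt (_ : (t ++ v == s ++ v) = (t == s))//.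
  apply/idP/idP => /eqP; last by move=> ->.
  move=> /(congr1 (drop (size v) \o rev)) /=; rewrite !rev_cat.
  by rewrite !drop_size_cat ?size_rev// => /(inv_inj revK) ->.
rewrite dotp0l; case: eqP => // ws; case: wt.
by rewrite /t ws size_cat addnK take_size_cat.
Qed.

Lemma FSA_shift_coef_lt T (w v : seq 'I_d) : free_semigroup_algebra L T ->
  (size w <= size v)%N -> w <> v -> dotp (evec w) (T (evec v)) = 0.
Proof.
move=> hT wv nwv; rewrite FSA_shift_coef//.
by rewrite (eqP wv) take0 /=; case: eqP.
Qed.

Lemma FSA_shift_coef_diag T (w : seq 'I_d) : free_semigroup_algebra L T ->
  dotp (evec w) (T (evec w)) = dotp (evec [::]) (T (evec [::])).
Proof. by move=> hT; rewrite FSA_shift_coef// subnn take0 /= eqxx. Qed.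

(** The vacuum is separating: [FSA_shift_coef] recovers every matrix coefficient from those at the
    empty word. *)
Lemma FSA_shift_eq1 T : free_semigroup_algebra L T ->
  T (evec [::]) = evec [::] -> T = 1.
Proof.
move=> hT T1; apply/subr0_eq/bopP => x.
(* Vanishing on the basis passes to the whole space through the adjoint, all of whose coefficients
   are then 0. *)
suff : forall v, (T - 1) (evec v) = 0.
  move=> hv; suff /(congr1 (@adj _ _ _)) : adj (T - 1) = 0.
    by rewrite adjK adj0 => ->.
  apply: bopP => y; apply: evec_total => s.
  by rewrite -adjP hv dotp0l.
move=> v; apply: evec_total => w.
rewrite bopDE dotpDr FSA_shift_coef// T1 (_ : (- 1 : bop _ _) _ = - evec v)//.
rewrite dotpNr !evec_dotp; case: (w =P v) => [->|wv].
  by rewrite subnn take0 /= !eqxx subrr.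
case: eqP => [wt|_]; last by rewrite subrr.
case: eqP => [t0|_]; last by rewrite subrr.
by case: wv; rewrite wt t0.
Qed.

(* If the constant coefficients form a strict contraction, the powers of the row tend to zero:
   each [adj (A j)] is the conjugate constant coefficient plus an operator that lowers degrees. *)
Lemma FSA_shift_energy (A : 'I_d -> bop H2 H2) :
  (forall j, free_semigroup_algebra L (A j)) -> row_contraction A ->
  \sum_j nc (dotp (evec [::]) (A j (evec [::]))) ^+ 2 < 1 ->
  forall x, energy_vanishes (fun j => adj (A j)) x.
Proof.
move=> hA cA; set a := fun j => dotp (evec [::]) (A j (evec [::])).
set al := \sum_j _ => al1.
have cB : column_contraction (fun j => adj (A j)).
  by move=> x; exact: row_contraction_adj.
have al0 : 0 <= al by apply: sumr_ge0 => j _; exact: sqr_ge0.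
apply: (energy_vanishes_total (A := [set evec s | s in setT]) cB); last first.
  by move=> x hx; apply: evec_total => s; apply: hx; exists s.
move=> _ [w _ <-].
have [n] := ubnP (size w); elim: n w => // n IH w; rewrite ltnS => wn.
(* The degree-lowering part: [r j] has coefficients only at words strictly shorter than [w], where
   the induction hypothesis applies. *)
pose r j := adj (A j) (evec w) - (a j)^*%C *: evec w.
have rv j v : (size w <= size v)%N -> dotp (evec v) (r j) = 0.
  move=> wv; rewrite dotpBr dotpZr dotpC adjPl.
  have [->|vw] := eqVneq v w.
    by rewrite FSA_shift_coef_diag// evec_dotp eqxx mulr1 -/(a j) subrr.
  rewrite FSA_shift_coef_lt//; last by apply/eqP; rewrite eq_sym.
  by rewrite conjc0 evec_dotp (negbTE vw) mulr0 subrr.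
have vr j : energy_vanishes (fun j => adj (A j)) (r j).
  (* The span of the shorter words; [r j] is recognized as its own projection on it. *)
  pose M := closed_span [set (evec s : H2) | s in [set s | (size s < size w)%N]].
  have [m Mm rm] := projection_exists M (r j).
  have mv v : (size w <= size v)%N -> dotp (evec v) m = 0.
    move=> wv; rewrite dotpC; suff -> : dotp m (evec v) = 0 by rewrite conjc0.
    apply/eqP; rewrite -normc_eq0; apply: contraT => n0.
    have n1 : 0 < nc (dotp m (evec v)) by rewrite lt_neqAle normc_ge0 eq_sym n0.
    have [y [k [c [b [hb ->]]]] my] := Mm _ n1.
    suff: nc (dotp m (evec v)) < nc (dotp m (evec v)) by rewrite ltxx.
    apply: le_lt_trans my.
    have -> : dotp m (evec v) = dotp (m - \sum_i c i *: b i) (evec v).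
      rewrite dotpBl dotp_suml big1 ?subr0// => i _.
      have [s sw <-] := hb i.
      rewrite dotpZl evec_dotp; case: eqP => [sv|_]; last by rewrite mulr0.
      by move: sw; rewrite /= sv ltnNge wv.
    by apply: le_trans (Cauchy_Schwarz _ _) _; rewrite hnorm_evec mulr1.
  have -> : r j = m.
    apply/subr0_eq/evec_total => v; have [wv|vw] := leqP (size w) (size v).
      by rewrite dotpBr rv// mv// subrr.
    apply: rm => e e0; exists (evec v); last by rewrite subrr hnorm0.
    exists 1%N, (fun=> 1), (fun=> evec v); split; last by rewrite big_ord1 scale1r.
    by move=> _; exists v.
  apply: energy_vanishes_closed => // e e0.
  have [y [k [c [b [hb ->]]]] my] := Mm _ e0.
  exists (\sum_i c i *: b i) => //; apply: subspace_sum => [|i].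
    by split; [exact: energy_vanishes0|exact: energy_vanishesP].
  have [s sw <-] := hb i; apply: IH.
  exact: leq_trans sw wn.
(* With this [t], (1 + t) * al < 1, because (1 - al) (2 - al) > 0. *)
pose t : R := (1 - al) / 2.
have t0 : 0 < t by rewrite divr_gt0// subr_gt0.
apply: (@energy_vanishes_step _ _ _ _ _ 1 ((1 + t) * al)
  (fun m => (1 + t^-1) * \sum_j energy (fun j => adj (A j)) m (r j))) => //.
- by rewrite mulr_ge0// addr_ge0// ltW.
- by rewrite /t; nra.
- rewrite -[X in _ --> X](mulr0 (1 + t^-1)); apply: cvgM; first exact: cvg_cst.
  have h := @cvg_finsum R _ (index_enum 'I_d) (fun j m =>
    energy (fun j => adj (A j)) m (r j)) (fun=> 0) vr.
  by rewrite big1 in h.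
- move=> m; rewrite addn1 /= /al -mulrA !mulr_suml !mulr_sumr -big_split /=.
  apply: ler_sum => j _.
  rewrite -[adj (A j) _](subrK ((a j)^*%C *: evec w)) -/(r j).
  rewrite [X in energy _ _ X]addrC.
  by apply: le_trans (energyD _ _ _ _ t0) _; rewrite energyZ normc_conj.
Qed.

End FreeSemigroupAlgebraOfShift.

(** * Finitely correlated row isometries *)

Section Compression.
Context {R : realType} {H : hilbertType R} (M : clsubspace H).
Implicit Types (m : subhilb M) (x : H).

Lemma subhilb_in m : M (val m).
Proof. exact/asboolP/subhilb_valP. Qed.

Lemma subhilb_ext (m m' : subhilb M) : val m = val m' -> m = m'.
Proof. exact: val_inj. Qed.

Lemma subhilb_dotpE m m' : dotp m m' = dotp (val m) (val m').
Proof. by []. Qed.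

Lemma subhilb_hnorm m : hnorm m = hnorm (val m).
Proof. by []. Qed.

Lemma subhilb_val_sum (I : Type) (r : seq I) (F : I -> subhilb M) :
  val (\sum_(i <- r) F i) = \sum_(i <- r) val (F i).
Proof. by apply: (big_morph (fun m => val m)). Qed.

Lemma proj_dotp m x : dotp m (adj (incl M) x) = dotp (val m) x.
Proof. by rewrite -adjP. Qed.

Lemma proj_in x : M x -> val (adj (incl M) x) = x.
Proof.
move=> Mx; have -> : x = val (SubHilb (asboolT Mx)) by [].
congr val; apply: dotp_ext => m.
by rewrite proj_dotp subhilb_dotpE.
Qed.

Lemma val_compress (T : bop H H) m : M (T (val m)) ->
  val (compress M T m) = T (val m).
Proof. exact: proj_in. Qed.

Lemma adj_compress (T : bop H H) : adj (compress M T) = compress M (adj T).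
Proof.
apply: adj_uniq => x y.
change (dotp (adj (incl M) (T (val x))) y =
  dotp x (adj (incl M) (adj T (val y)))).
by rewrite adjPl proj_dotp -adjP.
Qed.

End Compression.

Section Reducing.
Context {R : realType} {d : nat} {H : hilbertType R}.
Context (V : 'I_d -> bop H H) (M : clsubspace H) (rM : reducing V M).
Local Notation VM := (fun k => compress M (V k)).
Local Notation P := (adj (incl M)).

Lemma reducing_val k m : val (compress M (V k) m) = V k (val m).
Proof. by apply: val_compress; apply: (rM k (subhilb_in m)).1. Qed.

Lemma reducing_adj_val k m : val (adj (compress M (V k)) m) = adj (V k) (val m).
Proof.
by rewrite adj_compress; apply: val_compress; apply: (rM k (subhilb_in m)).2.
Qed.

Lemma reducing_proj_adj k x : P (adj (V k) x) = adj (compress M (V k)) (P x).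
Proof.
apply: dotp_ext => m; rewrite [LHS]proj_dotp -[LHS]adjP -[RHS]adjP [RHS]proj_dotp.
by rewrite reducing_val.
Qed.

Lemma reducing_proj k x : P (V k x) = compress M (V k) (P x).
Proof.
apply: dotp_ext => m; rewrite [LHS]proj_dotp -[LHS]adjPl -[RHS]adjPl [RHS]proj_dotp.
by rewrite reducing_adj_val.
Qed.

Lemma reducing_proj_wpow w x : P (wpow V w x) = wpow VM w (P x).
Proof.
rewrite -(fmK w); elim: (fmonom_val w) x => [|j s IH] x; first by rewrite !wpow_nil.
by rewrite !wpow_cons !bopME -IH reducing_proj.
Qed.

Lemma reducing_row_isometry : row_isometry V -> row_isometry VM.
Proof.
move=> iV x; rewrite subhilb_hnorm subhilb_val_sum.
rewrite (eq_bigr (fun j => V j (val (x j)))) => [|j _]; last exact: reducing_val.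
by rewrite iV.
Qed.

Lemma reducing_cuntz : cuntz V -> cuntz VM.
Proof.
move=> cV; apply: cuntzP => [|m]; first exact: reducing_row_isometry cV.1.
apply: subhilb_ext; rewrite subhilb_val_sum -[RHS](cuntz_sum (val m) cV).
by apply: eq_bigr => j _; rewrite reducing_val reducing_adj_val.
Qed.

End Reducing.

(* A Cuntz row isometry with a finite-dimensional cyclic coinvariant subspace,
   presented by an orthonormal basis [f] of the latter. *)
Definition finitely_correlated_cuntz (R : realType) (d : nat) (H : hilbertType R)
    (V : 'I_d -> bop H H) : Prop :=
  cuntz V /\ exists n (f : 'I_n -> H),
    [/\ orthonormal_family f, forall j a, expands f (adj (V j) (f a)) &
        forall x, (forall w a, dotp (wpow V w (f a)) x = 0) -> x = 0].

Section FinitelyCorrelated.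
Context {R : realType} {d : nat}.

Lemma lspan_subspace (H : hilbertType R) (A : set H) : subspace_pred (lspan A).
Proof.
split=> [|a x y]; last exact: lspanP.
have f (T : Type) : 'I_0 -> T by case.
by exists 0%N, (f _), (f _); split; [case|rewrite big_ord0].
Qed.

Lemma lspan_incl (H : hilbertType R) (A : set H) x : A x -> lspan A x.
Proof. by exists 1%N, (fun=> 1), (fun=> x); split=> //; rewrite big_ord1 scale1r. Qed.

Lemma lspan_min (H : hilbertType R) (A : set H) (M : H -> Prop) :
  subspace_pred M -> (forall x, A x -> M x) -> forall x, lspan A x -> M x.
Proof.
move=> sM AM x [n [c [a [Aa ->]]]].
by apply: subspace_sum => // i; exact: AM.
Qed.

(** The family [e] may be dependent: this admits the projections of a basis and arbitrary spanning
    families, from which Gram-Schmidt extracts the basis. *)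
Lemma finitely_correlated_cuntz_intro (H : hilbertType R) (V : 'I_d -> bop H H)
    n (e : 'I_n -> H) :
  cuntz V -> (forall j a, lspan (range e) (adj (V j) (e a))) ->
  (forall x, (forall w a, dotp (wpow V w (e a)) x = 0) -> x = 0) ->
  finitely_correlated_cuntz V.
Proof.
move=> cV eV te; split=> //; have [m [f [fo fe fM]]] := Gram_Schmidt e.
have spanf a : lspan (range e) (f a).
  by apply: fM => [|i]; [exact: lspan_subspace|apply: lspan_incl; exists i].
have expE x : lspan (range e) x -> expands f x.
  by apply: lspan_min => [|_ [i _ <-] //]; exact: expands_subspace.
exists m, f; split=> // [j a|x xf].
  apply: expE; move: (f a) (spanf a); apply: lspan_min => [|_ [i _ <-]//].
  split=> [|c x y hx hy]; first by rewrite linear0; exact: (lspan_subspace _).1.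
  by rewrite linearP; apply: lspanP.
apply: te => w i; rewrite (fe i) linear_sum dotp_suml big1// => a _.
by rewrite linearZ /= dotpZl xf mulr0.
Qed.

(** The projection onto [M] commutes with the row and with its adjoints, so it carries [f] to a
    family of [M] that is still coinvariant and cyclic, though perhaps dependent. *)
Lemma finitely_correlated_reducing (H : hilbertType R) (V : 'I_d -> bop H H)
    (M : clsubspace H) :
  reducing V M -> finitely_correlated_cuntz V ->
  finitely_correlated_cuntz (fun k => compress M (V k)).
Proof.
move=> rM [cV [n [f [fo fV tf]]]].
apply: (finitely_correlated_cuntz_intro (e := fun a => adj (incl M) (f a))).
- exact: reducing_cuntz.
- move=> j a; rewrite -reducing_proj_adj// (fV j a) linear_sum.
  under eq_bigr do rewrite linearZ.
  apply: subspace_sum => [|b]; first exact: lspan_subspace.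
  by apply: lspan_incl; exists b.
- move=> m hm; apply: subhilb_ext; apply: tf => w a.
  have := hm w a; rewrite -(reducing_proj_wpow rM) => <-.
  by rewrite [RHS]dotpC proj_dotp -dotpC.
Qed.

Lemma finitely_correlated_neq0 (H : hilbertType R) (V : 'I_d -> bop H H) n
    (f : 'I_n -> H) (x : H) :
  (forall x, (forall w a, dotp (wpow V w (f a)) x = 0) -> x = 0) -> x <> 0 ->
  (0 < n)%N.
Proof. by case: n f => // f tf x0; case: x0; apply: tf => w [[]]. Qed.

(* Self-adjointness makes the span of [f] reducing; comparing traces of
   [V_k^* V_k = 1] and [sum_k V_k V_k^* = 1] on it gives [d * n <= n]. *)
Lemma finitely_correlated_not_von_Neumann (H : hilbertType R)
    (V : 'I_d -> bop H H) (x : H) : (2 <= d)%N ->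
  finitely_correlated_cuntz V -> x <> 0 -> ~ von_neumann_type V.
Proof.
move=> d2 [cV [n [f [fo fV tf]]]] x0 [iV sa].
have n0 := finitely_correlated_neq0 tf x0.
have Vf k a : expands f (V k (f a)).
  set q := \sum_b dotp (f b) (V k (f a)) *: f b.
  set z := V k (f a) - q.
  have fz b : dotp (f b) z = 0 by rewrite dotpBr (orthonormal_sum fo) subrr.
  have zq : dotp z q = 0.
    rewrite dotp_sumr big1// => b _.
    by rewrite dotpZr (dotpC (f b) z) fz conjc0 mulr0.
  (* By self-adjointness [adj (V k)] is a weak limit of polynomials p(V), and <f a, p(V) z> =
     <adj(p(V)) (f a), z> = 0 because the span of [f] is coinvariant. *)
  have : dotp (f a) (adj (V k) z) = 0.
    rewrite (@FSA_dotp_eq _ _ _ V _ _ z 0 0 (sa _ (FSA_var V k))).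
      by rewrite dotp0l.
    move=> p; rewrite dotp0l -adjPl.
    have ep : expands f (adj (peval V p) (f a)).
      apply: peval_adj_sub; [exact: expands_subspace| |].
        by move=> j y; exact: (expands_linear (fV j)).
      exact: orthonormal_expands.
    by rewrite ep dotp_suml big1// => b _; rewrite dotpZl fz mulr0.
  rewrite -adjP => Vz; apply/subr0_eq/hnorm_eq0/eqP.
  rewrite -sqrf_eq0 hnorm_sqr -/z {2}/z dotpBr zq subr0 dotpC Vz conjc0.
  by rewrite eqxx.
(* The squared Hilbert-Schmidt norm of [V k] on the span of [f]: exactly [n] since [V k] is
   isometric, and at most the right-hand side by Bessel. *)
have le k : n%:R <= \sum_b hnorm (adj (V k) (f b)) ^+ 2.
  have -> : n%:R = \sum_(a < n) hnorm (V k (f a)) ^+ 2.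
    rewrite (eq_bigr (fun=> 1)) => [|a _]; first by rewrite sumr_const card_ord.
    by rewrite row_isometry_hnorm// (hnorm_orthonormal fo) expr1n.
  rewrite (eq_bigr _ (fun a _ => Parseval (Vf k a))) exchange_big /=.
  apply: ler_sum => b _; apply: le_trans (Bessel fo _); apply: ler_sum => a _.
  by rewrite dotpC normc_conj adjP.
have : d%:R * n%:R <= (n%:R : R).
  apply: le_trans (_ : \sum_(k < d) \sum_b hnorm (adj (V k) (f b)) ^+ 2 <= _).
    apply: le_trans (_ : \sum_(k < d) (n%:R : R) <= _).
      by rewrite sumr_const card_ord mulr_natl.
    by apply: ler_sum => k _.
  rewrite exchange_big /= (eq_bigr (fun=> 1)) => [|a _].
    by rewrite sumr_const card_ord.
  by rewrite cuntz_adj// (hnorm_orthonormal fo) expr1n.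
rewrite -natrM ler_nat; move: n0 d2; case: (n) => // n' _; case: (d) => [//|[//|d']].
by rewrite mulSn mulSn => _; rewrite leqNgt -[X in (X < _)%N]addn0 ltn_add2l ltn_addr.
Qed.

End FinitelyCorrelated.

Section RowMatrixNorm.
Context {R : realType} {d : nat} {H : hilbertType R} (i0 : 'I_d).
Implicit Types (W : 'I_d -> bop H H).

(** [mxopnorm] takes square matrices, so the row fills line [i0] of a matrix that is 0 elsewhere;
    complete isometry then applies to rows. *)
Definition row_opmx W : 'M[bop H H]_d :=
  \matrix_(i, j) if i == i0 then W j else 0.

Lemma row_opmx_sum W (x : 'I_d -> H) :
  \sum_i hnorm (\sum_j row_opmx W i j (x j)) ^+ 2 = hnorm (\sum_j W j (x j)) ^+ 2.
Proof.
rewrite (bigD1 i0)//= [X in _ + X]big1.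
  rewrite addr0; congr (hnorm _ ^+ 2).
  by apply: eq_bigr => j _; rewrite mxE eqxx.
move=> i /negbTE ii0; rewrite big1 ?hnorm0 ?expr0n// => j _.
by rewrite mxE ii0.
Qed.

Lemma mxopnorm_row_le1 W : row_contraction W -> mxopnorm (row_opmx W) <= 1.
Proof.
move=> cW; apply: ge_sup.
  exists (Num.sqrt (\sum_i hnorm (\sum_j row_opmx W i j ((fun=> 0 : H) j)) ^+ 2)).
  exists (fun=> 0) => //=; rewrite big1// => j _.
  by rewrite hnorm0 expr0n.
move=> _ [x /= x1 <-]; rewrite -[leRHS]sqrtr1 ler_wsqrtr// row_opmx_sum.
exact: le_trans (cW x) x1.
Qed.

Lemma mxopnorm_row_contraction W : mxopnorm (row_opmx W) <= 1 -> row_contraction W.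
Proof.
move=> W1.
have bound (x : 'I_d -> H) : \sum_j hnorm (x j) ^+ 2 <= 1 ->
    hnorm (\sum_j W j (x j)) <= 1.
  move=> x1; apply: le_trans W1; apply: ub_le_sup; last first.
    by exists x => //; rewrite row_opmx_sum sqrtr_sqr ger0_norm ?hnorm_ge0.
  (* The supremum dominates its members only if the set is bounded, which follows from the bounds of
     the individual [W j]. *)
  have /choice[c hc] : forall j, exists c : R, 0 <= c /\ forall x, hnorm (W j x) <= c * hnorm x.
    by move=> j; have [c c0 hc] := bop_bounded (W j); exists c.
  exists (\sum_j c j) => _ [y /= y1 <-].
  rewrite row_opmx_sum sqrtr_sqr ger0_norm ?hnorm_ge0//.
  apply: le_trans (hnorm_sum _ _) _; apply: ler_sum => j _.
  apply: le_trans ((hc j).2 _) _; rewrite ler_piMr ?(hc j).1//.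
  rewrite -(@ler_pXn2r _ 2) ?nnegrE ?hnorm_ge0// expr1n.
  apply: le_trans y1; rewrite (bigD1 j)//= lerDl.
  by apply: sumr_ge0 => k _; exact: sqr_ge0.
move=> x; set s := \sum_j hnorm (x j) ^+ 2.
have s0 : 0 <= s by apply: sumr_ge0 => j _; exact: sqr_ge0.
have [s00|sn0] := eqVneq s 0.
  have x0 j : x j = 0.
    apply: hnorm_eq0; apply/eqP; rewrite -sqrf_eq0.
    move/eqP: s00; rewrite psumr_eq0 => [/allP/(_ j)|k _]; last exact: sqr_ge0.
    by apply; rewrite mem_index_enum.
  rewrite big1 => [|j _]; last by rewrite x0 linear0.
  by rewrite hnorm0 expr0n.
have sp : 0 < s by rewrite lt_neqAle eq_sym sn0.
pose r := (Num.sqrt s)^-1.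
have r0 : 0 < r by rewrite invr_gt0 sqrtr_gt0.
have r2 : r ^+ 2 = s^-1 by rewrite exprVn sqr_sqrtr.
have hZ (z : H) : hnorm (r%:C *: z) ^+ 2 = s^-1 * hnorm z ^+ 2.
  by rewrite hnormZ normc_real exprMn real_normK ?num_real// r2.
have := bound (fun j => r%:C *: x j).
rewrite (eq_bigr (fun j => s^-1 * hnorm (x j) ^+ 2)) => [|j _]; last exact: hZ.
rewrite -mulr_sumr mulVf// => /(_ (lexx _)).
rewrite (_ : \sum_j W j _ = r%:C *: \sum_j W j (x j)); last first.
  by rewrite scaler_sumr; apply: eq_bigr => j _; rewrite linearZ.
rewrite -(@ler_pXn2r _ 2) ?nnegrE ?hnorm_ge0// expr1n hZ.
by rewrite mulrC ler_pdivrMr// mul1r.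
Qed.

End RowMatrixNorm.

(** * Exclusion of Cuntz type L *)

Section TypeL.
Context {R : realType} {d : nat}.
Local Notation H2 := (@fock R d).
Local Notation L := (@lshift R d).
Local Notation nc := (@Normc.normc R).

Lemma word_comb_dotpE (H : hilbertType R) (V : 'I_d -> bop H H) m c (x y : H) :
  dotp x (word_comb V m c y) =
  levsum m (fun s => c s * dotp x (wpow V (FMonom s) y)).
Proof.
elim: m c x => [|m IH] c x.
  change (dotp x (c [::] *: y) = c [::] * dotp x (wpow V (FMonom [::]) y)).
  by rewrite dotpZr wpow_nil.
rewrite /= bop_sumE dotp_sumr; apply: eq_bigr => j _.
rewrite bopME -adjPl IH; apply: eq_levsum => s.
by rewrite wpow_cons bopME adjPl.
Qed.

(** Together with [ultraweak_single], this makes a single matrix coefficient one of the functionals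
    that test weak-* continuity. *)
Lemma hsquare_summable_single (H : hilbertType R) (x : H) :
  hsquare_summable (fun n => if n is 0 then x else 0).
Proof.
apply: cvgP; apply: (@series_single R _ 0%N) => -[|n] // _.
by rewrite /= hnorm0 expr0n.
Qed.

Lemma ultraweak_single (H : hilbertType R) (x y : H) T :
  ultraweak (fun n => if n is 0 then x else 0) (fun n => if n is 0 then y else 0) T =
  dotp x (T y).
Proof.
rewrite /ultraweak (@csum_single _ _ 0%N) => [|[|n]] //= _.
by rewrite dotp0l.
Qed.

(** The n-th term is at most the square root of |y_n|^2 times the energy of x_n; this tends to 0
    with m and is dominated by the summable |x_n|^2 + |y_n|^2. *)
Lemma ultraweak_vanishes (H : hilbertType R) (B : 'I_d -> bop H H)
    (T : nat -> bop H H) (x y : nat -> H) :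
  column_contraction B -> (forall h, energy_vanishes B h) ->
  (forall m u v, nc (dotp u (T m v)) ^+ 2 <= hnorm v ^+ 2 * energy B m u) ->
  hsquare_summable x -> hsquare_summable y ->
  (fun m => nc (ultraweak x y (T m))) @ \oo --> (0 : R).
Proof.
move=> cB vB hT sx sy.
pose v m n := Num.sqrt (hnorm (y n) ^+ 2 * energy B m (x n)).
pose b n := hnorm (x n) ^+ 2 + hnorm (y n) ^+ 2.
have vb m n : 0 <= v m n <= b n.
  rewrite sqrtr_ge0 /=.
  have b0 : 0 <= b n by rewrite addr_ge0 ?sqr_ge0.
  rewrite -(@ler_pXn2r _ 2) ?nnegrE ?sqrtr_ge0// sqr_sqrtr; last first.
    by rewrite mulr_ge0 ?sqr_ge0 ?energy_ge0.
  apply: le_trans (_ : hnorm (y n) ^+ 2 * hnorm (x n) ^+ 2 <= _).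
    by rewrite ler_wpM2l ?sqr_ge0 ?energy_le.
  by rewrite /b; have := sqr_ge0 (hnorm (x n)); have := sqr_ge0 (hnorm (y n)); nra.
have cb : cvgn (series b).
  rewrite (_ : b = (fun n => hnorm (x n) ^+ 2) + (fun n => hnorm (y n) ^+ 2))//.
  exact: is_cvg_seriesD.
have v0 n : (v^~ n) @ \oo --> (0 : R).
  have : (fun m => hnorm (y n) ^+ 2 * energy B m (x n)) @ \oo --> hnorm (y n) ^+ 2 * 0.
    by apply: cvgM; [exact: cvg_cst|exact: vB].
  rewrite mulr0 => h; apply/cvgrPdist_lt => e e0.
  have /cvgrPdist_lt/(_ _ (exprn_gt0 2 e0))[N _ hN] := h.
  exists N => // m Nm; have := hN m Nm; rewrite /= !sub0r !normrN.
  have u0 : 0 <= hnorm (y n) ^+ 2 * energy B m (x n).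
    by rewrite mulr_ge0 ?sqr_ge0 ?energy_ge0.
  rewrite !ger0_norm ?sqrtr_ge0// => u1.
  by rewrite -(@ltr_pXn2r _ 2) ?nnegrE ?sqrtr_ge0 ?(ltW e0)// sqr_sqrtr.
have cv m : cvgn (series (v m)).
  apply: (@series_le_cvg _ (v m) b) => // n; have /andP[h1 h2] := vb m n => //.
  exact: le_trans h1 h2.
have h := series_dominated vb cb v0.
have {}h : (fun m => 2 * limn (series (v m))) @ \oo --> 2 * (0 : R).
  by apply: cvgM => //; exact: cvg_cst.
rewrite mulr0 in h; apply: squeeze_cvgr h; last exact: cvg_cst.
apply: nearW => m; rewrite normc_ge0 /=; apply: normc_csum_le => // n.
rewrite -(@ler_pXn2r _ 2) ?nnegrE ?sqrtr_ge0 ?normc_ge0// sqr_sqrtr//.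
by rewrite mulr_ge0 ?sqr_ge0 ?energy_ge0.
Qed.

(** The vectors adj(V^w) x stay in the span of [f], and for a Cuntz row their squared norms over the
    words of length m add up to |x|^2; Parseval expands each of them. *)
Lemma levsum_Parseval (H : hilbertType R) (V : 'I_d -> bop H H) n
    (f : 'I_n -> H) m (x : H) :
  cuntz V -> (forall j a, expands f (adj (V j) (f a))) -> expands f x ->
  \sum_a levsum m (fun s => nc (dotp x (wpow V (FMonom s) (f a))) ^+ 2) = hnorm x ^+ 2.
Proof.
move=> cV fV; elim: m x => [|m IH] x fx /=.
  rewrite (Parseval fx); apply: eq_bigr => a _.
  by rewrite wpow_nil dotpC normc_conj.
rewrite exchange_big /= -(cuntz_adj x cV); apply: eq_bigr => j _.
rewrite -IH; last exact: (expands_linear (fV j)).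
apply: eq_bigr => a _; apply: eq_levsum => s.
by rewrite wpow_cons bopME adjPl.
Qed.

(** With e the vacuum and X the displayed combination, <e, X e> = al and |X e|^2 <= al. Hence al <=
    1 by Cauchy-Schwarz, and al = 1 makes |X e - e|^2 at most 0. *)
Lemma strict_constant_term (A : 'I_d -> bop H2 H2) :
  row_contraction A ->
  let a j := dotp (evec [::]) (A j (evec [::])) in
  let al := \sum_j nc (a j) ^+ 2 in
  al < 1 \/ (\sum_j (a j)^*%C *: A j) (evec [::]) = evec [::].
Proof.
move=> cA a al; set X := \sum_j _; set e := evec [::].
have al0 : 0 <= al by apply: sumr_ge0 => j _; exact: sqr_ge0.
have XE : X e = \sum_j A j ((a j)^*%C *: e).
  by rewrite bop_sumE; apply: eq_bigr => j _; rewrite linearZ.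
have Xn : hnorm (X e) ^+ 2 <= al.
  rewrite XE; apply: le_trans (cA _) _; apply: ler_sum => j _.
  by rewrite hnormZ hnorm_evec mulr1 normc_conj.
have Xd : dotp e (X e) = al%:C.
  rewrite bop_sumE dotp_sumr rmorph_sum; apply: eq_bigr => j _.
  by rewrite bopZE dotpZr mul_conjc.
have al1 : al <= 1.
  have := Cauchy_Schwarz_sqr e (X e).
  rewrite Xd normc_real real_normK ?num_real// hnorm_evec expr1n mul1r.
  by move=> h; have := le_trans h Xn; nra.
have [al_lt1|] := ltP al 1; first by left.
move=> al1'; right; apply/subr0_eq/hnorm_eq0/eqP.
rewrite -sqrf_eq0 eq_le sqr_ge0 andbT hnormB_sqr hnorm_evec dotpC Xd.
by rewrite conjc_real /= -/al; nra.
Qed.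

Lemma finitely_correlated_not_type_L (H : hilbertType R)
    (V : 'I_d -> bop H H) (x : H) : (2 <= d)%N ->
  finitely_correlated_cuntz V -> x <> 0 -> ~ cuntz_type_L V.
Proof.
move=> d2 [cV [n [f [fo fV tf]]]] x0 [_ [phi [psi iso]]].
have n0 := finitely_correlated_neq0 tf x0; have iV := cV.1.
case: iso => -[phiS psiS psiK phiK] [phiL phiM phi1] phi_isom phi_cont _.
have phi0 : phi 0 = 0.
  have := phiL (-1) 0 0 (FSA0 _) (FSA0 _).
  by rewrite scaleN1r oppr0 addr0 scaleN1r addNr.
pose A j := psi (V j).
have AS j : free_semigroup_algebra L (A j) by apply/psiS/FSA_var.
have phiA j : phi (A j) = V j by apply/phiK/FSA_var.
have phiZ a T : free_semigroup_algebra L T -> phi (a *: T) = a *: phi T.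
  by move=> hT; have := phiL a T 0 hT (FSA0 _); rewrite phi0 !addr0.
have phi_sum (F : 'I_d -> bop H2 H2) : (forall j, free_semigroup_algebra L (F j)) ->
    phi (\sum_j F j) = \sum_j phi (F j).
  move=> hF; elim: (index_enum _) => [|j r IH]; first by rewrite !big_nil.
  rewrite !big_cons -IH.
  by have := phiL 1 (F j) _ (hF j) (FSA_sum r hF); rewrite !scale1r.
(* Complete isometry enters for one matrix, the one carrying the row of the [A j]. *)
have cA : row_contraction A.
  pose i0 := Ordinal (ltnW d2).
  apply: (mxopnorm_row_contraction (i0 := i0)).
  rewrite -phi_isom; last first.
    by move=> i j; rewrite mxE; case: ifP => // _; exact: FSA0.
  rewrite (_ : map_mx _ _ = row_opmx i0 V).
    exact/mxopnorm_row_le1/row_isometry_contraction.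
  by apply/matrixP => i j; rewrite !mxE; case: ifP.
have phi_comb m c : phi (word_comb A m c) = word_comb V m c.
  elim: m c => [|m IH] c /=; first by rewrite phiZ ?phi1//; exact: FSA1.
  have hS j : free_semigroup_algebra L (word_comb A m (fun s => c (j :: s))).
    exact: word_comb_FSA.
  rewrite phi_sum => [|j]; last exact: FSA_mul.
  by apply: eq_bigr => j _; rewrite phiM// phiA IH.
(* In the case treated first, sum_j conj(a_j) A_j = 1, hence sum_j conj(a_j) V_j = 1 by [phi], and
   each [V i] turns out to be a scalar. *)
have [al1|X1] := strict_constant_term cA; last first.
  pose a j := dotp (evec [::]) (A j (evec [::])).
  have XS : free_semigroup_algebra L (\sum_j (a j)^*%C *: A j).
    by apply: FSA_sum => j; exact: FSA_scale _ (AS j).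
  have : \sum_j (a j)^*%C *: V j = 1.
    rewrite -[RHS](etrans (congr1 phi (FSA_shift_eq1 XS X1)) phi1).
    rewrite phi_sum => [|j]; last exact: FSA_scale _ (AS j).
    by apply: eq_bigr => j _; rewrite (phiZ _ _ (AS j)) phiA.
  move=> V1.
  (* Writing z as sum_j conj(a_j) V_j z and pairing with V_i y keeps only the term j = i. *)
  have VE i y : V i y = a i *: y.
    apply: dotp_ext => z.
    rewrite -[z in LHS](_ : (\sum_j (a j)^*%C *: V j) z = z); last by rewrite V1.
    rewrite bop_sumE dotp_suml (bigD1 i)// big1.
      rewrite bopZE dotpZl conjcK row_isometry_dotpE// eqxx mul1r dotpZr; exact: addr0.
    move=> j /= /negbTE ji; apply: etrans (dotpZl _ _ _) _.
    by rewrite row_isometry_dotpE// ji mul0r mulr0.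
  pose i := Ordinal (ltnW d2); pose j := Ordinal d2.
  have : dotp (V i x) (V j x) = 0 by rewrite row_isometry_dotpE// mul0r.
  rewrite !VE dotpZl dotpZr => /eqP; rewrite !mulf_eq0 conjc_eq0.
  have xx : dotp x x == 0 = false.
    by apply/negbTE; rewrite gt_eqF// dotp_gt0//; apply/eqP.
  have an k : a k == 0 = false.
    apply/negbTE; apply: contraFneq xx => ak; have := row_isometry_hnorm k x iV.
    by rewrite VE ak scale0r hnorm0 => /esym/hnorm_eq0 ->; rewrite dotp0r.
  by rewrite !an xx.
have vA := FSA_shift_energy AS cA al1.
have cB : column_contraction (fun j => adj (A j)).
  by move=> y; exact: row_contraction_adj.
pose eta := f (Ordinal n0).
have eta1 : hnorm eta = 1 by rewrite (hnorm_orthonormal fo).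
(* Conjugate coefficients make the combination pair [eta] and [f a] to its own square sum [tau m a].
   By Parseval these sums add up to 1 over [a], so each is at most 1, as [word_comb_dotp] requires
   for a uniform bound. *)
pose c a s := (dotp eta (wpow V (FMonom s) (f a)))^*%C.
pose tau m a := levsum m (csqr (c a)).
have sum_tau m : \sum_a tau m a = 1.
  rewrite -[RHS](expr1n R 2) -eta1 -(levsum_Parseval m cV fV); last first.
    exact: orthonormal_expands.
  by apply: eq_bigr => a _; apply: eq_levsum => s; rewrite /csqr normc_conj.
have tau0 m a : 0 <= tau m a by apply: levsum_ge0 => s; exact: sqr_ge0.
have tau1 m a : tau m a <= 1.
  rewrite -(sum_tau m) (bigD1 a)//= lerDl.
  exact: sumr_ge0.
have tauE m a : dotp eta (word_comb V m (c a) (f a)) = (tau m a)%:C.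
  rewrite word_comb_dotpE /tau (@levsum_morph d R R[i] (real_complex R))//; last first.
    by move=> u v; exact: rmorphD.
  by apply: eq_levsum => s; rewrite /= mul_conjc /csqr normc_conj.
have tau_cvg a : (tau ^~ a) @ \oo --> (0 : R).
  apply/cvgrPdist_lt => e e0.
  have [k [u [v [delta [delta0 uv hphi]]]]] := phi_cont 0 (FSA0 _) _ _
    (@hsquare_summable_single H eta) (@hsquare_summable_single H (f a)) e e0.
  have comb_bound m y z : nc (dotp y (word_comb A m (c a) z)) ^+ 2 <=
      hnorm z ^+ 2 * energy (fun j => adj (A j)) m y.
    apply: le_trans (word_comb_dotp _ _ _ _ _) _.
    rewrite ler_wpM2r ?energy_ge0// ler_piMl ?sqr_ge0//; exact: tau1.
  have near_small : \forall m \near \oo, forall i,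
      nc (ultraweak (u i) (v i) (word_comb A m (c a) - 0)) < delta.
    apply: filter_forall => i.
    have := ultraweak_vanishes cB vA comb_bound (uv i).1 (uv i).2.
    move/cvgrPdist_lt/(_ _ delta0); apply: filterS => m.
    by rewrite subr0 sub0r normrN ger0_norm ?normc_ge0.
  apply: filterS near_small => m hm.
  have := hphi (word_comb A m (c a)) (word_comb_FSA _ _ AS) hm.
  rewrite phi0 subr0 ultraweak_single phi_comb tauE normc_real => h.
  by rewrite sub0r normrN.
(* The contradiction: a finite sum of null sequences is constantly 1. *)
have := @cvg_finsum R _ (index_enum 'I_n) (fun a m => tau m a) (fun=> 0) tau_cvg.
rewrite (_ : (fun m => _) = fun=> 1); last by apply/funext => m; exact: sum_tau.
rewrite big1// => /(cvg_lim (@Rhausdorff R)); rewrite lim_cst//.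
by move/eqP; rewrite oner_eq0.
Qed.

Lemma finitely_correlated_dilation_type (H : hilbertType R)
    (V : 'I_d -> bop H H) : (2 <= d)%N ->
  finitely_correlated_cuntz V -> dilation_type V.
Proof.
move=> d2 fV; split=> [|M rM [x [Mx x0]]]; first exact: fV.1.
have fM := finitely_correlated_reducing rM fV.
have x0' : SubHilb (asboolT Mx) <> 0 by move/(congr1 val).
split; first exact: (finitely_correlated_not_type_L d2 fM x0').
exact: (finitely_correlated_not_von_Neumann d2 fM x0').
Qed.

End TypeL.

Section ClosedSpanInvariance.
Context {R : realType} {H : hilbertType R}.

Lemma closed_span_sub (A : set H) x : A x -> closed_span A x.
Proof. by move=> Ax e e0; exists x; [exact: lspan_incl|rewrite subrr hnorm0]. Qed.

Lemma closed_span_invariant (A : set H) (T : bop H H) :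
  (forall x, A x -> A (T x)) -> forall x, closed_span A x -> closed_span A (T x).
Proof.
move=> AT x sx e e0; have [c c0 bT] := bop_bounded T.
have c1 : 0 < c + 1 by rewrite ltr_wpDl.
have [y sy xy] := sx _ (divr_gt0 e0 c1).
exists (T y).
  apply: (lspan_min (M := fun y => lspan A (T y)) _ _ sy).
    split=> [|a u v hu hv]; first by rewrite linear0; exact: (lspan_subspace _).1.
    by rewrite linearP; exact: lspanP.
  by move=> u Au; apply/lspan_incl/AT.
rewrite -linearB; apply: le_lt_trans (bT _) _.
apply: le_lt_trans (_ : (c + 1) * hnorm (x - y) < _).
  by rewrite ler_wpM2r ?hnorm_ge0// lerDl.
by rewrite mulrC -ltr_pdivlMr.
Qed.

Lemma proj_contraction (M : clsubspace H) x : hnorm (adj (incl M) x) <= hnorm x.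
Proof.
set m := adj _ _; have [m0|m0] := eqVneq (hnorm m) 0; first by rewrite m0 hnorm_ge0.
have mp : 0 < hnorm m by rewrite lt_neqAle hnorm_ge0 eq_sym m0.
rewrite -(ler_pM2l mp) -expr2 hnorm_sqr {2}/m proj_dotp.
apply: le_trans (ler_norm _) (le_trans (Re_le_normc _) _).
exact: Cauchy_Schwarz.
Qed.

Lemma bop_dense_eq0 (A : H -> Prop) (T : bop H H) :
  (forall x, (forall y, A y -> dotp y x = 0) -> x = 0) ->
  (forall x y, A x -> A y -> dotp x (T y) = 0) -> T = 0.
Proof.
move=> tA hT; suff h : adj T = 0 by rewrite -(adjK T) h adj0.
apply: bopP => x; apply: (tA (adj T x)) => y Ay; rewrite -adjP.
by rewrite (tA (T y)) ?dotp0l// => z Az; exact: hT.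
Qed.

End ClosedSpanInvariance.

(** * The GNS representation *)

Section GNSRepresentation.
Context {R : realType} {d : nat}.
Local Notation H2 := (@fock R d).
Local Notation L := (@lshift R d).
Context (mu : bop H2 H2 -> R[i]) (K : hilbertType R)
  (iota : {linear ncpoly R d -> K}) (Pi : 'I_d -> bop K K).
Hypothesis hgns : is_gns mu iota Pi.
Local Notation xi := (iota 1).
Local Notation Hmu := (gns_cyclic iota Pi).

Lemma ncpoly_cons j s :
  mkmalgU (FMonom (j :: s) : word d) (1 : R[i]) = ncvar j * mkmalgU (FMonom s) 1.
Proof.
rewrite malgM_def fgmulUU mulr1; congr (mkmalgU _ _).
by rewrite -[RHS]fmK fmM fmU.
Qed.

(** Turns the abstract dense map into evaluation at [Pi] on the vector [iota 1], whose cyclicity is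
    then the density of the range. *)
Lemma gns_iota p : iota p = peval Pi p xi.
Proof.
have [_ _ hPi] := hgns.
have hw s : iota (mkmalgU (FMonom s) 1) = wpow Pi (FMonom s) xi.
  elim: s => [|j s IH].
    by rewrite wpow_nil; congr (iota _); rewrite -fmoneE.
  by rewrite ncpoly_cons -hPi IH wpow_cons.
rewrite {1}(monalgE p) linear_sum /peval bop_sumE; apply: eq_bigr => w _.
rewrite bopZE -(fmK w) -hw -linearZ; congr (iota _).
by apply/malgP => k; rewrite mcoeffZ !mcoeffU mulr_natr; case: eqP.
Qed.

Lemma gns_iota_total x : (forall p, dotp (iota p) x = 0) -> x = 0.
Proof.
have [_ dens _] := hgns; move=> hx.
apply: (@hnorm_dense_eq0 _ _ (fun y => exists p, y = iota p)) => [e e0|y [p ->]//].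
by have [p xp] := dens x e e0; exists (iota p) => //; exists p.
Qed.

Lemma gns_total x : (forall w, dotp (wpow Pi w xi) x = 0) -> x = 0.
Proof.
move=> hx; apply: gns_iota_total => p.
rewrite gns_iota /peval bop_sumE dotp_suml big1// => w _.
by rewrite bopZE dotpZl hx mulr0.
Qed.

Lemma lshift_adj_mul i j : adj (L i) * L j = (i == j)%:R *: (1 : bop H2 H2).
Proof.
apply: bopP => x; apply: dotp_ext => y.
rewrite bopME -adjP (row_isometry_dotpE _ _ _ _ (lshift_row_isometry)).
by rewrite bopZE dotpZr.
Qed.

(** The relations adj(L_i) L_j = delta_ij hold inside the argument of [mu], hence for [Pi] on the
    dense range of [iota]. *)
Lemma gns_row_isometry : row_isometry Pi.
Proof.
have [hd _ hPi] := hgns.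
have E i j x y : dotp (Pi i x) (Pi j y) = (i == j)%:R * dotp x y.
  suff /subr0_eq h : adj (Pi i) * Pi j - (i == j)%:R *: (1 : bop K K) = 0.
    by rewrite adjP -bopME h bopZE dotpZr.
  apply: (@bop_dense_eq0 _ _ (fun y => exists p, y = iota p)) => [z hz|].
    by apply: gns_iota_total => p; apply: hz; exists p.
  move=> _ _ [p ->] [q ->]; rewrite bopDE dotpDr bopME -adjP !hPi hd.
  rewrite !pevalM !peval_var adjM -mulrA [X in _ * X]mulrA lshift_adj_mul.
  rewrite (_ : _ * (_ * _) = (i == j)%:R *: (adj (peval L p) * peval L q)); last first.
    by apply: bopP => h; rewrite !bopME bopZE linearZ.
  have -> : mu ((i == j)%:R *: (adj (peval L p) * peval L q)) =
      (i == j)%:R * mu (adj (peval L p) * peval L q).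
    case: eqP => _; first by rewrite scale1r mul1r.
    (* That [mu] vanishes at 0 is read off from the inner product of zero polynomials. *)
    by have h := hd 0 0; rewrite !linear0 dotp0r mulr0 in h; rewrite scale0r mul0r -h.
  rewrite -hd (_ : (- _ : bop _ _) _ = - ((i == j)%:R *: iota q))//.
  by rewrite dotpNr dotpZr subrr.
move=> x; rewrite hnorm_sqr dotp_suml raddf_sum; apply: eq_bigr => i _.
rewrite dotp_sumr (bigD1 i)//= big1 ?addr0 => [|j ji].
  by rewrite E eqxx mul1r hnorm_sqr.
by rewrite E eq_sym (negbTE ji) mul0r.
Qed.

(** Pi Pi^* fixes every vector Pi_k y. Among the total family of words applied to [xi], the empty
    word alone is not visibly of this form, so equality at [xi] decides. *)
Lemma gns_vacuum_cuntz :
  hnorm xi ^+ 2 <= \sum_j hnorm (adj (Pi j) xi) ^+ 2 -> cuntz Pi.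
Proof.
have iPi := gns_row_isometry; move/(row_isometry_adj_eq iPi) => hxi.
apply: cuntzP => // x; apply/subr0_eq/gns_total => w.
have hw : \sum_j Pi j (adj (Pi j) (wpow Pi w xi)) = wpow Pi w xi.
  rewrite -(fmK w); case: (fmonom_val w) => [|k s]; first by rewrite wpow_nil.
  rewrite wpow_cons bopME (bigD1 k)//= big1 ?addr0 => [|j jk].
    congr (Pi k _); apply: dotp_ext => z.
    by rewrite -adjP row_isometry_dotpE// eqxx mul1r.
  rewrite (_ : adj _ _ = 0) ?linear0//; apply: dotp_ext => z.
  by rewrite -adjP row_isometry_dotpE// (negbTE jk) mul0r dotp0r.
rewrite dotpBr -[X in _ - dotp X _]hw dotp_sumr dotp_suml -sumrB big1// => j _.
by rewrite [X in _ - X]adjP -[X in X - _]adjPl subrr.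
Qed.

Lemma gns_cyclic_vacuum : Hmu xi.
Proof.
by apply: closed_span_sub; exists (FMonom [::]); rewrite wpow_nil adj1.
Qed.

Lemma gns_cyclic_adj j x : Hmu x -> Hmu (adj (Pi j) x).
Proof.
apply: closed_span_invariant => _ [w ->].
exists (FMonom (w ++ [:: j])); rewrite wpow_cat adjM.
by rewrite wpow_cons wpow_nil mulr1 fmK.
Qed.

Lemma gns_row_adj_val j m : val (adj (gns_row iota Pi j) m) = adj (Pi j) (val m).
Proof.
rewrite /gns_row adj_compress val_compress//.
by apply: gns_cyclic_adj; exact: subhilb_in.
Qed.

Lemma cuntz_gns_row : cuntz Pi -> row_coisometry (gns_row iota Pi).
Proof.
move=> cPi; split=> [x|].
  rewrite (_ : \sum_j _ = adj (incl Hmu) (\sum_j Pi j (val (x j)))); last first.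
    by rewrite linear_sum.
  rewrite -(cPi.1 (fun j => val (x j))).
  by rewrite ler_pXn2r ?nnegrE ?hnorm_ge0// proj_contraction.
apply: bopP => m; rewrite bop_sumE.
rewrite (_ : \sum_j _ = adj (incl Hmu) (\sum_j Pi j (adj (Pi j) (val m)))); last first.
  rewrite linear_sum; apply: eq_bigr => j _; rewrite bopME -gns_row_adj_val.
  by [].
rewrite cuntz_sum//; apply: subhilb_ext; rewrite proj_in//.
exact: subhilb_in.
Qed.

(** H_mu is coinvariant, so the adjoint of T_j is the restriction of adj(Pi_j), and the coisometry
    relation at [xi] is the equality asked by [gns_vacuum_cuntz]. *)
Lemma gns_row_cuntz : row_coisometry (gns_row iota Pi) -> cuntz Pi.
Proof.
move=> [_ coi]; apply: gns_vacuum_cuntz.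
pose m : subhilb Hmu := SubHilb (asboolT gns_cyclic_vacuum).
have -> : hnorm xi ^+ 2 = hnorm m ^+ 2 by [].
have mE : m = \sum_j gns_row iota Pi j (adj (gns_row iota Pi j) m).
  by rewrite -[LHS]bop1E -coi bop_sumE.
rewrite hnorm_sqr {2}mE dotp_sumr raddf_sum; apply: ler_sum => j _.
by rewrite -adjPl -[X in X <= _]hnorm_sqr subhilb_hnorm gns_row_adj_val.
Qed.

Lemma gns_finitely_correlated :
  finitely_correlated iota Pi -> cuntz Pi -> finitely_correlated_cuntz Pi.
Proof.
move=> [n [e he]] cPi.
have he' x : Hmu x -> exists c : 'I_n -> R[i], x = \sum_k c k *: val (e k).
  move=> hx; have [c /(congr1 val)] := he (SubHilb (asboolT hx)).
  by rewrite subhilb_val_sum => hc; exists c.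
apply: (finitely_correlated_cuntz_intro (e := fun a => val (e a))) => //.
  move=> j a; have [c ->] := he' _ (gns_cyclic_adj j (subhilb_in (e a))).
  apply: subspace_sum => [|b]; first exact: lspan_subspace.
  by apply: lspan_incl; exists b.
move=> x hx; apply: gns_total => w; have [c ->] := he' _ gns_cyclic_vacuum.
rewrite linear_sum dotp_suml big1// => a _.
by rewrite linearZ dotpZl hx mulr0.
Qed.

End GNSRepresentation.

(** * Singular rows *)

Section SingularRows.
Context {R : realType} {d : nat} {H : hilbertType R}.
Implicit Types V : 'I_d -> bop H H.

Definition full_subspace : clsubspace H :=
  @ClSubspace R H (fun=> True) I (fun _ _ _ _ _ => I) (fun _ _ => I).

Fact zero_closed (x : H) :
  (forall e : R, 0 < e -> exists2 y, y = 0 & hnorm (x - y) < e) -> x = 0.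
Proof.
by move=> hx; apply: hnorm_small => e /hx[_ ->]; rewrite subr0.
Qed.

Fact zeroP (a : R[i]) (x y : H) : x = 0 -> y = 0 -> a *: x + y = 0.
Proof. by move=> -> ->; rewrite scaler0 addr0. Qed.

Definition zero_subspace : clsubspace H :=
  @ClSubspace R H (fun x => x = 0) erefl zeroP zero_closed.

(** The dilation type summand is the whole space and the von Neumann summand is 0, where the Cuntz
    condition and self-adjointness hold trivially. *)
Lemma finitely_correlated_singular V : (2 <= d)%N ->
  finitely_correlated_cuntz V -> singular_row V.
Proof.
move=> d2 fV; exists full_subspace, zero_subspace.
have rF : reducing V full_subspace by [].
have r0 : reducing V zero_subspace.
  by move=> k x /= ->; rewrite !linear0.
have sub0 (x : subhilb zero_subspace) : x = 0.
  by apply: subhilb_ext; exact: (subhilb_in x).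
split; [exact: rF|exact: r0| | |].
- by move=> x y _ /= ->; rewrite dotp0r.
- by move=> z; exists z, 0; rewrite addr0.
split; first exact/finitely_correlated_dilation_type/finitely_correlated_reducing.
have iso0 : row_isometry (fun k => compress zero_subspace (V k)).
  exact/(reducing_row_isometry r0)/fV.1.1.
split; first by split=> // y; exists (fun=> 0); rewrite [LHS]sub0 [RHS]sub0.
split; first exact: iso0.
move=> T _; rewrite (_ : adj T = 0); first exact: FSA0.
by apply: bopP => x; rewrite [LHS]sub0 [RHS]sub0.
Qed.

Lemma singular_row_cuntz V : row_isometry V -> singular_row V -> cuntz V.
Proof.
move=> iV [M [N [rM rN _ MN [[cM _] [cN _]]]]]; split=> // z.
have [x [y [Mx Ny ->]]] := MN z.
have [u hu] := cM.2 (SubHilb (asboolT Mx)).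
have [v hv] := cN.2 (SubHilb (asboolT Ny)).
exists (fun j => val (u j) + val (v j)).
under eq_bigr do rewrite linearD.
rewrite big_split /=; congr (_ + _).
  move/(congr1 val): hu; rewrite subhilb_val_sum /= => ->.
  by apply: eq_bigr => j _; rewrite reducing_val.
move/(congr1 val): hv; rewrite subhilb_val_sum /= => ->.
by apply: eq_bigr => j _; rewrite reducing_val.
Qed.

End SingularRows.

(** * Boundedness of positive NC measures *)

Section OperatorNorm.
Context {R : realType} {H : hilbertType R}.
Implicit Types S T : bop H H.
Local Notation nc := (@Normc.normc R).

Definition bounded_by T (c : R) : Prop := forall x, hnorm (T x) <= c * hnorm x.

Lemma bounded_by_opnorm T : bounded_by T (opnorm T).
Proof.
move=> x; have [x0|x0] := eqVneq (hnorm x) 0.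
  by rewrite (hnorm_eq0 x0) linear0 hnorm0 mulr0.
have xp : 0 < hnorm x by rewrite lt_neqAle hnorm_ge0 eq_sym x0.
pose y := (hnorm x)^-1%:C *: x.
have y1 : hnorm y = 1.
  by rewrite hnormZ normc_real ger0_norm ?invr_ge0 ?hnorm_ge0// mulVf.
have : hnorm (T y) <= opnorm T.
  apply: ub_le_sup; last by exists y => //=; rewrite y1.
  have [c c0 bc] := bop_bounded T; exists c => _ [z /= z1 <-].
  by apply: le_trans (bc z) _; rewrite ler_piMr.
rewrite linearZ hnormZ normc_real ger0_norm ?invr_ge0 ?hnorm_ge0//.
by rewrite mulrC ler_pdivrMr.
Qed.

Lemma opnorm_le T c : 0 <= c -> bounded_by T c -> opnorm T <= c.
Proof.
move=> c0 bT; apply: ge_sup; first by exists (hnorm (T 0)), 0 => //=; rewrite hnorm0.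
by move=> _ [x /= x1 <-]; apply: le_trans (bT x) _; rewrite ler_piMr.
Qed.

Lemma opnorm_lt T c e : 0 <= c -> c < e -> bounded_by T c -> opnorm T < e.
Proof. by move=> c0 ce bT; apply: le_lt_trans (opnorm_le c0 bT) ce. Qed.

Lemma bounded_by_le T c c' : c <= c' -> bounded_by T c -> bounded_by T c'.
Proof. by move=> cc bT x; apply: le_trans (bT x) _; rewrite ler_wpM2r ?hnorm_ge0. Qed.

Lemma bounded_byD S T c e :
  bounded_by S c -> bounded_by T e -> bounded_by (S + T) (c + e).
Proof.
move=> bS bT x; rewrite bopDE mulrDl.
by apply: le_trans (hnormD _ _) _; exact: lerD.
Qed.

Lemma bounded_byZ a T c : bounded_by T c -> bounded_by (a *: T) (nc a * c).
Proof. by move=> bT x; rewrite bopZE hnormZ -mulrA ler_wpM2l ?normc_ge0. Qed.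

Lemma bounded_by_adj T c : 0 <= c -> bounded_by T c -> bounded_by (adj T) c.
Proof.
move=> c0 bT x; have [z|z] := eqVneq (hnorm (adj T x)) 0.
  by rewrite z mulr_ge0 ?hnorm_ge0.
have zp : 0 < hnorm (adj T x) by rewrite lt_neqAle hnorm_ge0 eq_sym z.
rewrite -(ler_pM2l zp) -expr2 hnorm_sqr -adjP.
apply: le_trans (ler_norm _) (le_trans (Re_le_normc _) _).
apply: le_trans (Cauchy_Schwarz _ _) _.
by rewrite mulrCA mulrA ler_wpM2r ?hnorm_ge0.
Qed.

(** Completeness of the bounded operators, with the rate kept: the limit of a Neumann series comes
    with the error of its partial sums. *)
Lemma bop_limit (S : nat -> bop H H) (c : nat -> R) :
  c @ \oo --> (0 : R) ->
  (forall N M, (N <= M)%N -> bounded_by (S M - S N) (c N)) ->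
  exists T, forall N, bounded_by (T - S N) (c N).
Proof.
move=> c0 hS.
have lim x : exists l, forall e, 0 < e -> exists N, forall n, (N <= n)%N -> hnorm (S n x - l) < e.
  apply: dotp_complete => e e0.
  have x1 : 0 < hnorm x + 1 by rewrite ltr_wpDl ?hnorm_ge0.
  have /cvgrPdist_lt/(_ _ (divr_gt0 (divr_gt0 e0 (ltr0n _ 2)) x1))[N _ hN] := c0.
  have {}hN : c N * hnorm x < e / 2.
    have := hN N (leqnn N); rewrite /= sub0r normrN ltr_pdivlMr// => h.
    apply: le_lt_trans h; apply: le_trans (_ : `|c N| * hnorm x <= _).
      by rewrite ler_wpM2r ?hnorm_ge0// ler_norm.
    by rewrite ler_wpM2l// lerDl.
  exists N => m n Nm Nn.
  change (hnorm (S m x - S n x) < e).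
  rewrite -(subrK (S N x) (S m x)) -addrA; apply: le_lt_trans (hnormD _ _) _.
  rewrite [X in _ + X]hnormB_sym.
  by have := hS _ _ Nm x; have := hS _ _ Nn x; rewrite !bopDE => h1 h2;
    rewrite [ltRHS]splitr; apply: ltrD; [exact: le_lt_trans h2 hN|exact: le_lt_trans h1 hN].
have [f hf] := choice lim.
have approx N x : hnorm (f x - S N x) <= c N * hnorm x.
  apply/ler_addgt0Pr => e e0; have [M hM] := hf x e e0.
  pose n := maxn N M.
  have h1 := hM n (leq_maxr _ _); have h2 := hS _ _ (leq_maxl N M : (N <= n)%N) x.
  rewrite -(subrK (S n x) (f x)) -addrA; apply: le_trans (hnormD _ _) _.
  by rewrite [leRHS]addrC; apply: lerD; [rewrite hnormB_sym ltW|exact: h2].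
have f_bounded : f \in @bounded_linear_pred R H H.
  apply/asboolP; split=> [a x y|].
    apply/subr0_eq/hnorm_small => e e0.
    (* [s - 1] collects the norms that multiply [c N] in the defect of linearity of the limit; the
       added 1 makes [s] positive. *)
    pose s := hnorm (a *: x + y) + (nc a * hnorm x + hnorm y) + 1.
    have s0 : 0 < s.
      by rewrite ltr_wpDl// !addr_ge0 ?mulr_ge0 ?normc_ge0 ?hnorm_ge0.
    have /cvgrPdist_lt/(_ _ (divr_gt0 e0 s0))[N _ hN] := c0.
    have := hN N (leqnn N); rewrite /= sub0r normrN ltr_pdivlMr// => h.
    apply: le_lt_trans h.
    have -> : f (a *: x + y) - (a *: f x + f y) = (f (a *: x + y) - S N (a *: x + y))
        - (a *: (f x - S N x) + (f y - S N y)).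
      have gen (u p q p' q' : H) :
          u - (p + q) = (u - (p' + q')) - ((p - p') + (q - q')).
        by rewrite (addrACA p) -opprD opprB [RHS]addrA subrK.
      by rewrite (linearP (S N)) scalerBr; exact: gen.
    apply: le_trans (hnormD _ _) _; rewrite hnormN.
    have h1 := approx N (a *: x + y); have h2 := hnormD (a *: (f x - S N x)) (f y - S N y).
    have h3 : nc a * hnorm (f x - S N x) <= nc a * (c N * hnorm x).
      by rewrite ler_wpM2l ?normc_ge0.
    have h4 := approx N y; rewrite hnormZ in h2.
    apply: le_trans (_ : c N * (s - 1) <= _); first by rewrite /s; nra.
    have [cN|cN] := lerP 0 (c N); first by rewrite ger0_norm// ler_wpM2l// gerBl.
    apply: le_trans (_ : 0 <= _); last by rewrite mulr_ge0// ltW.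
    rewrite nmulr_rle0// /s addrK !addr_ge0 ?mulr_ge0 ?normc_ge0 ?hnorm_ge0//.
  have [b b0 hb] := bop_bounded (S 0%N); exists (c 0%N + b) => x.
  rewrite -[f x](subrK (S 0%N x)) mulrDl; apply: le_trans (hnormD _ _) _.
  exact: lerD.
by exists (Bop f_bounded) => N x; exact: approx.
Qed.

End OperatorNorm.

Section DiskSystem.
Context {R : realType} {d : nat}.
Local Notation H2 := (@fock R d).
Local Notation L := (@lshift R d).
Local Notation nc := (@Normc.normc R).
Local Notation Re := (@complex.Re R).
Implicit Types S T A B : bop H2 H2.

Lemma disk_algebra_peval p : disk_algebra (peval L p).
Proof.
move=> e e0; exists p; apply: (opnorm_lt (lexx 0) e0) => x.
by rewrite subrr hnorm0 mul0r.
Qed.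

Lemma disk_algebraP T :
  (forall e : R, 0 < e -> exists p, bounded_by (T - peval L p) e) -> disk_algebra T.
Proof.
move=> hT e e0; have e2 : 0 < e / 2 by rewrite divr_gt0.
have [p hp] := hT _ e2; exists p; apply: (opnorm_lt (ltW e2) _ hp).
by rewrite ltr_pdivrMr// ltr_pMr// ltr1n.
Qed.

Lemma disk_algebra_lin a S T : disk_algebra S -> disk_algebra T ->
  disk_algebra (a *: S + T).
Proof.
move=> hS hT; apply: disk_algebraP => e e0.
have a0 : 0 < nc a + 1 by rewrite ltr_wpDl ?normc_ge0.
have e2 : 0 < e / 2 by rewrite divr_gt0.
have [p hp] := hS _ (divr_gt0 e2 a0); have [q hq] := hT _ e2.
exists (a *: p + q); rewrite peval_linear opprD addrACA -scalerBr.
apply: (bounded_by_le _ (bounded_byD (bounded_byZ a (@bounded_by_opnorm _ _ _))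
  (@bounded_by_opnorm _ _ _))).
rewrite [leRHS]splitr; apply: lerD; last exact: ltW.
apply: le_trans (_ : (nc a + 1) * (e / 2 / (nc a + 1)) <= _).
  apply: ler_pM; [exact: normc_ge0| |by rewrite lerDl|exact: ltW].
  apply: le_trans (_ : hnorm ((S - peval L p) 0) <= _); first exact: hnorm_ge0.
  apply: ub_le_sup; last by exists 0 => //=; rewrite hnorm0.
  have [c c0 bc] := bop_bounded (S - peval L p); exists c => _ [z /= z1 <-].
  by apply: le_trans (bc z) _; rewrite ler_piMr.
by rewrite mulrC divfK// gt_eqF.
Qed.

Lemma disk_systemP T :
  (forall e : R, 0 < e -> exists A B,
    [/\ disk_algebra A, disk_algebra B & bounded_by (T - (A + adj B)) e]) ->
  disk_system T.
Proof.
move=> hT e e0; have e2 : 0 < e / 2 by rewrite divr_gt0.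
have [A [B [hA hB hAB]]] := hT _ e2; exists A, B; split=> //.
apply: (opnorm_lt (ltW e2) _ hAB).
by rewrite ltr_pdivrMr// ltr_pMr// ltr1n.
Qed.

Lemma disk_systemE T (e : R) : disk_system T -> 0 < e -> exists A B,
    [/\ disk_algebra A, disk_algebra B & bounded_by (T - (A + adj B)) e].
Proof.
move=> hT e0; have [A [B [hA hB hAB]]] := hT _ e0; exists A, B; split=> //.
exact: bounded_by_le (ltW hAB) (@bounded_by_opnorm _ _ _).
Qed.

Lemma disk_system_sum A B : disk_algebra A -> disk_algebra B -> disk_system (A + adj B).
Proof.
move=> hA hB; apply: disk_systemP => e e0; exists A, B; split=> // x.
by rewrite subrr hnorm0 mulr_ge0 ?hnorm_ge0 ?ltW.
Qed.

Lemma disk_algebra0 : disk_algebra (0 : bop H2 H2).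
Proof. by rewrite -(linear0 (peval L)); exact: disk_algebra_peval. Qed.

Lemma disk_system_peval_adj p : disk_system (adj (peval L p)).
Proof.
rewrite -[adj _]add0r; apply: disk_system_sum; first exact: disk_algebra0.
exact: disk_algebra_peval.
Qed.

Lemma disk_system1 : disk_system (1 : bop H2 H2).
Proof. by rewrite -adj1 -(peval1 L); exact: disk_system_peval_adj. Qed.

Lemma disk_system_lin a S T : disk_system S -> disk_system T ->
  disk_system (a *: S + T).
Proof.
move=> hS hT; apply: disk_systemP => e e0.
have a0 : 0 < nc a + 1 by rewrite ltr_wpDl ?normc_ge0.
have e2 : 0 < e / 2 by rewrite divr_gt0.
have [A [B [hA hB hAB]]] := disk_systemE hS (divr_gt0 e2 a0).
have [A' [B' [hA' hB' hAB']]] := disk_systemE hT e2.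
exists (a *: A + A'), (a^*%C *: B + B'); split; [exact: disk_algebra_lin..|].
have -> : a *: S + T - (a *: A + A' + adj (a^*%C *: B + B')) =
    a *: (S - (A + adj B)) + (T - (A' + adj B')).
  rewrite adj_lin conjcK [in LHS]addrACA -scalerDr.
  by rewrite opprD addrACA -scalerBr.
apply: (bounded_by_le _ (bounded_byD (bounded_byZ a hAB) hAB')).
rewrite [leRHS]splitr; apply: lerD => //.
apply: le_trans (_ : (nc a + 1) * (e / 2 / (nc a + 1)) <= _).
  by rewrite ler_wpM2r ?lerDl// divr_ge0// ltW.
by rewrite mulrC divfK// gt_eqF.
Qed.

Lemma disk_system0 : disk_system (0 : bop H2 H2).
Proof.
rewrite -(addNr 1) -scaleN1r.
exact: (disk_system_lin (-1) disk_system1 disk_system1).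
Qed.

Lemma disk_system_scale a T : disk_system T -> disk_system (a *: T).
Proof.
by move=> hT; have := disk_system_lin a hT disk_system0; rewrite addr0.
Qed.

Lemma disk_system_adj T : disk_system T -> disk_system (adj T).
Proof.
move=> hT; apply: disk_systemP => e e0.
have [A [B [hA hB hAB]]] := disk_systemE hT e0; exists B, A; split; [exact: hB|exact: hA|].
have -> : adj T - (B + adj A) = adj (T - (A + adj B)).
  by rewrite adjB adjD adjK [adj A + B]addrC.
exact: bounded_by_adj (ltW e0) hAB.
Qed.

Lemma disk_system_closed T :
  (forall e : R, 0 < e -> exists2 S, disk_system S & bounded_by (T - S) e) ->
  disk_system T.
Proof.
move=> hT; apply: disk_systemP => e e0; have e2 : 0 < e / 2 by rewrite divr_gt0.
have [S hS TS] := hT _ e2; have [A [B [hA hB hAB]]] := disk_systemE hS e2.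
exists A, B; split=> //; rewrite -(subrK S T) -addrA.
by apply: (bounded_by_le _ (bounded_byD TS hAB)); rewrite -splitr.
Qed.

Section Functional.
Context (mu : bop H2 H2 -> R[i]) (hmu : positive_ncmeasure mu).

Lemma ncmeasure_lin a S T : disk_system S -> disk_system T ->
  mu (a *: S + T) = a * mu S + mu T.
Proof. exact: hmu.1. Qed.

Lemma ncmeasure0 : mu 0 = 0.
Proof.
have := ncmeasure_lin (-1) disk_system0 disk_system0.
by rewrite scaler0 addr0 mulN1r addNr.
Qed.

Lemma ncmeasureZ a T : disk_system T -> mu (a *: T) = a * mu T.
Proof.
move=> hT; have := ncmeasure_lin a hT disk_system0.
by rewrite ncmeasure0 !addr0.
Qed.

Lemma ncmeasureD S T : disk_system S -> disk_system T -> mu (S + T) = mu S + mu T.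
Proof. by move=> hS hT; rewrite -[S]scale1r (ncmeasure_lin _ hS hT) scale1r mul1r. Qed.

Lemma ncmeasure1_ge0 : 0 <= mu 1.
Proof. by apply: hmu.2; [exact: disk_system1|move=> h; exact: dotp_ge0]. Qed.

(** Both e 1 + T and e 1 - T are positive, so [mu T] is real and lies between -e mu(1) and e
    mu(1). *)
Lemma ncmeasure_selfadjoint T (e : R) : disk_system T -> 0 <= e ->
  adj T = T -> bounded_by T e -> nc (mu T) <= e * Re (mu 1).
Proof.
move=> hT e0 aT bT.
have m1 := ncmeasure1_ge0.
have Im1 : complex.Im (mu 1) = 0 by exact: ger0_Im.
have pos (s : R) : s = 1 \/ s = -1 -> 0 <= e%:C * mu 1 + s%:C * mu T.
  move=> hs; have hsT := disk_system_scale s%:C hT.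
  rewrite -(ncmeasureZ s%:C hT) -(ncmeasure_lin _ disk_system1 hsT).
  apply: hmu.2; first exact: (disk_system_lin _ disk_system1 hsT).
  move=> h; rewrite bopDE !bopZE dotpDr !dotpZr bop1E dotpxx.
  have : complex.Im (dotp h (T h)) = 0.
    have : dotp h (T h) = (dotp h (T h))^*%C by rewrite -dotpC -[in RHS]aT adjPl.
    by case: (dotp _ _) => a b [] /= /eqP; rewrite -addr_eq0 -mulr2n mulrn_eq0 => /eqP.
  move/real_complexK => ->; rewrite -!rmorphM -rmorphD ler0c.
  have : `|Re (dotp h (T h))| <= e * hnorm h ^+ 2.
    apply: le_trans (Re_le_normc _) (le_trans (Cauchy_Schwarz _ _) _).
    by rewrite expr2 mulrCA ler_wpM2l ?hnorm_ge0.
  by rewrite ler_norml => /andP[h1 h2]; case: hs => ->; lra.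
have := pos 1 (or_introl erefl); have := pos (-1) (or_intror erefl).
rewrite (real_complexK Im1).
case: (mu T) => a b; rewrite !lecE /= !mulr0 !mul0r.
move=> /andP[/eqP h1 h2] /andP[/eqP h3 h4].
have -> : b = 0 by move: h3; rewrite !(subr0, addr0, add0r, mul1r).
rewrite /= expr0n addr0 sqrtr_sqr ler_norml.
by apply/andP; split; lra.
Qed.

(** Positivity yields continuity: T = (S1 - i S2) / 2 with S1 and S2 self-adjoint and bounded by 2
    e, and each of them contributes e mu(1). *)
Lemma ncmeasure_bound T (e : R) : disk_system T -> 0 <= e -> bounded_by T e ->
  nc (mu T) <= 2 * e * Re (mu 1).
Proof.
move=> hT e0 bT.
pose S1 := T + adj T; pose S2 := 'i%C *: T + (- 'i%C) *: adj T.
have hA := disk_system_adj hT; have bA := bounded_by_adj e0 bT.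
have h1 : nc (mu S1) <= (e + e) * Re (mu 1).
  apply: ncmeasure_selfadjoint; [|exact: addr_ge0| |].
  - by have := disk_system_lin 1 hT hA; rewrite scale1r.
  - by rewrite /S1 adjD adjK addrC.
  - exact: bounded_byD.
have i1 : nc 'i%C = 1 by rewrite /= expr0n expr1n add0r sqrtr1.
have ci : ('i%C)^*%C = - 'i%C :> R[i].
  by apply/eqP; rewrite eq_complex /= oppr0 !eqxx.
have cni : (- 'i%C)^*%C = 'i%C :> R[i] 
  by apply/eqP; rewrite eq_complex /= opprK oppr0 !eqxx.
have hA' := disk_system_scale (- 'i%C) hA.
have h2 : nc (mu S2) <= (e + e) * Re (mu 1).
  apply: ncmeasure_selfadjoint; [|exact: addr_ge0| |].
  - exact: (disk_system_lin _ hT hA').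
  - rewrite /S2 adj_lin adjZ adjK ci cni; exact: addrC.
  - have := bounded_byD (bounded_byZ 'i%C bT) (bounded_byZ (- 'i%C) bA).
    by rewrite normcN i1 !mul1r.
have -> : mu T = 2^-1 * mu S1 + 2^-1 * (- 'i%C) * mu S2.
  rewrite (ncmeasureD hT hA) (ncmeasure_lin _ hT hA') (ncmeasureZ _ hA).
  have ii : 'i%C * 'i%C = -1 :> R[i] by rewrite -expr2 sqr_i.
  move: (mu T) (mu (adj T)) ('i%C) ii => a b I ii.
  transitivity (2^-1 * (a + b) - 2^-1 * (I * I) * a + 2^-1 * (I * I) * b).
    by rewrite ii; field.
  by ring.
apply: le_trans (le_normcD _ _) _; rewrite !Normc.normcM.
have -> : nc 2^-1 = 2^-1.
  by rewrite Normc.normcV (_ : (2 : R[i]) = 2%:C) ?normc_real ?ger0_norm// rmorphD.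
rewrite normcN i1; lra.
Qed.

End Functional.

End DiskSystem.

Local Open Scope sesquilinear_scope.

(** * The Herglotz transform *)

Section RowBall.
Context {R : realType} {d : nat}.
Local Notation C := R[i].
Local Notation nc := (@Normc.normc R).
Local Notation Re := (@complex.Re R).

Lemma trmxC_mul m n p (A : 'M[C]_(m, n)) (B : 'M[C]_(n, p)) :
  (A *m B)^t* = B^t* *m A^t*.
Proof. by rewrite trmx_mul map_mxM. Qed.

Lemma dotmx_col n (v : 'cV[C]_n) : (v^t* *m v) 0 0 = (\sum_i nc (v i 0) ^+ 2)%:C.
Proof.
rewrite mxE rmorph_sum; apply: eq_bigr => i _.
by rewrite !mxE; exact: mul_conjc.
Qed.

Lemma col_neq0 n (v : 'cV[C]_n) : v != 0 -> exists i, v i 0 != 0.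
Proof.
move=> v0; apply/existsP; rewrite -negb_forall.
apply: contra v0 => /forallP v0; apply/eqP/colP => i; rewrite mxE.
exact: eqP (v0 i).
Qed.

Lemma sum_normc_gt0 n (v : 'cV[C]_n) : v != 0 -> 0 < \sum_i nc (v i 0) ^+ 2.
Proof.
move=> /col_neq0[i vi].
rewrite (bigD1 i)//= ltr_pwDl ?sumr_ge0// => [|j _]; last exact: sqr_ge0.
by rewrite exprn_gt0// lt_neqAle normc_ge0 eq_sym normc_eq0 vi.
Qed.

(* [rowadj Z v k l] is the entry [l] of [Z_k^* v], for a column [v] of vectors. *)
Definition rowadj {V : lmodType C} n (Z : mxtuple n) (v : 'I_n -> V)
    (k : 'I_d) (l : 'I_n) : V := \sum_i (Z k i l)^*%C *: v i.

Lemma row_ball_form n (Z : mxtuple n) (v : 'cV[C]_n) :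
  (v^t* *m (1%:M - \sum_k Z k *m (Z k)^t*) *m v) 0 0 =
  (\sum_i nc (v i 0) ^+ 2 -
   \sum_k \sum_l nc (rowadj Z (fun i => v i 0 : C^o) k l) ^+ 2)%:C.
Proof.
rewrite mulmxBr mulmxBl mulmx1 mulmx_sumr mulmx_suml !mxE summxE rmorphB /=.
rewrite -[X in X%:C - _]/(_) -dotmx_col mxE; congr (_ - _).
rewrite rmorph_sum; apply: eq_bigr => k _.
have -> : v^t* *m (Z k *m (Z k)^t*) *m v = ((Z k)^t* *m v)^t* *m ((Z k)^t* *m v).
  by rewrite trmxC_mul trmxCK !mulmxA.
rewrite dotmx_col; congr (_ %:C); apply: eq_bigr => l _.
by rewrite mxE; congr (nc _ ^+ 2); apply: eq_bigr => i _; rewrite !mxE.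
Qed.

Lemma row_ball_lt n (Z : mxtuple n) (v : 'cV[C]_n) : row_ball Z -> v != 0 ->
  \sum_k \sum_l nc (rowadj Z (fun i => v i 0 : C^o) k l) ^+ 2 <
  \sum_i nc (v i 0) ^+ 2.
Proof.
by move=> bZ /bZ; rewrite row_ball_form (ltcR 0) subr_gt0.
Qed.

Lemma row_ball_intro n (Z : mxtuple n) :
  (forall v : 'cV[C]_n, v != 0 ->
    \sum_k \sum_l nc (rowadj Z (fun i => v i 0 : C^o) k l) ^+ 2 <
    \sum_i nc (v i 0) ^+ 2) -> row_ball Z.
Proof. by move=> hZ v /hZ; rewrite row_ball_form (ltcR 0) subr_gt0. Qed.

(* A positive definite matrix [P] is bounded below: the coordinate [v_i] equals
   [<P^-1 e_i, v>_P]. *)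
Lemma row_ball_strict_col n (Z : mxtuple n) : row_ball Z ->
  exists2 c : R, 0 < c <= 1 & forall v : 'cV[C]_n,
    \sum_k \sum_l nc (rowadj Z (fun i => v i 0 : C^o) k l) ^+ 2 <=
    (1 - c) * \sum_i nc (v i 0) ^+ 2.
Proof.
move=> bZ; pose P := 1%:M - \sum_k Z k *m (Z k)^t*.
have PC : P^t* = P.
  rewrite /P linearB /= map_mxB trmx1 map_mx1; congr (_ - _).
  rewrite linear_sum /= raddf_sum; apply: eq_bigr => k _.
  by rewrite /= trmxC_mul trmxCK.
pose f (u v : 'cV[C]_n) := (u^t* *m P *m v) 0 0.
have f0 v : 0 <= Re (f v v).
  rewrite /f row_ball_form /= subr_ge0; have [->|v0] := eqVneq v 0.
    rewrite [leLHS]big1 ?sumr_ge0// => [i _|k _]; first exact: sqr_ge0.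
    rewrite big1// => l _; rewrite /rowadj big1 ?Normc.normc0 ?expr0n// => i _.
    by rewrite mxE scaler0.
  by apply: ltW; exact: row_ball_lt.
have fL (a : C) u v w : f u (a *: v + w) = a * f u v + f u w.
  by rewrite /f mulmxDr -scalemxAr mxE [X in X + _]mxE.
have fC u v : f v u = (f u v)^*%C.
  have -> : f v u = ((u^t* *m P *m v)^t*) 0 0.
    by rewrite !trmxC_mul trmxCK PC mulmxA.
  by rewrite /f mxE mxE.
have uP : P \in unitmx.
  rewrite unitmxE unitfE; apply/negP => /det0P[r r0 rP].
  have /bZ : r^t* != 0.
    by apply: contra r0 => /eqP r0; rewrite -(trmxCK r) r0 trmx0 map_mx0.
  by rewrite trmxCK rP mul0mx mxE ltxx.
pose u (i : 'I_n) : 'cV[C]_n := (delta_mx 0 i *m invmx P)^t*.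
have fu i v : f (u i) v = v i 0.
  by rewrite /f trmxCK mulmxKV// -rowE mxE.
(* Cauchy-Schwarz for [f] bounds |v|^2 by S f(v, v); the constant 1 / (1 + S) stays in the required
   interval even when [S] is 0. *)
pose S := \sum_i Re (f (u i) (u i)).
have S0 : 0 <= S by apply: sumr_ge0 => i _; exact: f0.
have S1 : 0 < 1 + S by rewrite ltr_pwDl.
exists (1 + S)^-1.
  by rewrite invr_gt0 S1 /= invf_le1// lerDl.
move=> v; pose N := \sum_i nc (v i 0) ^+ 2.
have NS : N <= (1 + S) * Re (f v v).
  apply: le_trans (_ : S * Re (f v v) <= _); last first.
    by rewrite ler_wpM2r// lerDr.
  rewrite /N /S mulr_suml; apply: ler_sum => i _.
  by rewrite -fu; exact: form_Cauchy_Schwarz.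
move: NS; rewrite /f row_ball_form /= -/N => NS.
rewrite -/N mulrBl mul1r lerBrDr -lerBrDl.
by rewrite mulrC ler_pdivrMr// mulrC.
Qed.

(** In an orthonormal basis of the span of the [y i] the estimate splits into the scalar one,
    coordinate by coordinate. The constant precedes the Hilbert space because the Fock space and the
    GNS space must share it. *)
Lemma row_ball_strict_adj n (Z : mxtuple n) : row_ball Z ->
  exists2 r : R, 0 <= r < 1 & forall (H : hilbertType R) (y : 'I_n -> H),
    \sum_k \sum_l hnorm (rowadj Z y k l) ^+ 2 <= r ^+ 2 * \sum_i hnorm (y i) ^+ 2.
Proof.
move=> bZ; have [c /andP[c0 c1] hc] := row_ball_strict_col bZ.
exists (Num.sqrt (1 - c)).
  by rewrite sqrtr_ge0 /= -[ltRHS]sqrtr1 ltr_sqrt// gtrBl.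
move=> H y; rewrite sqr_sqrtr ?subr_ge0//.
have [m [f [fo fy _]]] := Gram_Schmidt y.
have fz k l : expands f (rowadj Z y k l).
  by apply: subspace_sum => [|i]; [exact: expands_subspace|exact: fy].
pose v a : 'cV[C]_n := \col_i dotp (f a) (y i).
have rv a k l : dotp (f a) (rowadj Z y k l) =
    rowadj Z (fun i => v a i 0 : C^o) k l.
  by rewrite dotp_sumr; apply: eq_bigr => i _; rewrite dotpZr mxE.
have -> : \sum_i hnorm (y i) ^+ 2 = \sum_a \sum_i nc (v a i 0) ^+ 2.
  rewrite exchange_big /=; apply: eq_bigr => i _; rewrite (Parseval (fy i)).
  by apply: eq_bigr => a _; rewrite mxE.
have -> : \sum_k \sum_l hnorm (rowadj Z y k l) ^+ 2 =
    \sum_a \sum_k \sum_l nc (rowadj Z (fun i => v a i 0 : C^o) k l) ^+ 2.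
  rewrite [RHS]exchange_big /=; apply: eq_bigr => k _.
  rewrite [RHS]exchange_big /=; apply: eq_bigr => l _.
  by rewrite (Parseval (fz k l)); apply: eq_bigr => a _; rewrite rv.
by rewrite mulr_sumr; apply: ler_sum => a _; exact: hc.
Qed.

(** Duality: with N the sum on the left, S the sum on the right and T the corresponding sum for the
    adjoint of Z, N^2 <= T S and T <= r^2 N. *)
Lemma row_ball_strict n (Z : mxtuple n) : row_ball Z ->
  exists2 r : R, 0 <= r < 1 & forall (H : hilbertType R) (x : 'I_d -> 'I_n -> H),
    \sum_i hnorm (\sum_k \sum_l Z k i l *: x k l) ^+ 2 <=
    r ^+ 2 * \sum_k \sum_l hnorm (x k l) ^+ 2.
Proof.
move=> bZ; have [r r01 hr] := row_ball_strict_adj bZ; exists r => // H x.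
pose y i := \sum_k \sum_l Z k i l *: x k l.
pose N := \sum_i hnorm (y i) ^+ 2; pose S := \sum_k \sum_l hnorm (x k l) ^+ 2.
rewrite -[leLHS]/N -[X in _ * X]/S.
have N0 : 0 <= N by apply: sumr_ge0 => i _; exact: sqr_ge0.
have S0 : 0 <= S by apply: sumr_ge0 => k _; apply: sumr_ge0 => l _; exact: sqr_ge0.
have NE : N = \sum_k \sum_l Re (dotp (rowadj Z y k l) (x k l)).
  transitivity (\sum_i \sum_k \sum_l Re (Z k i l * dotp (y i) (x k l))).
    apply: eq_bigr => i _; rewrite hnorm_sqr {2}/y dotp_sumr raddf_sum.
    apply: eq_bigr => k _; rewrite /= dotp_sumr raddf_sum; apply: eq_bigr => l _.
    by rewrite /= dotpZr.
  rewrite exchange_big; apply: eq_bigr => k _; rewrite exchange_big.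
  apply: eq_bigr => l _; rewrite /= /rowadj dotp_suml raddf_sum.
  by apply: eq_bigr => i _; rewrite /= dotpZl conjcK.
pose T := \sum_k \sum_l hnorm (rowadj Z y k l) ^+ 2.
have NT : N ^+ 2 <= T * S.
  apply: le_trans (_ : (\sum_k \sum_l hnorm (rowadj Z y k l) * hnorm (x k l)) ^+ 2 <= _).
    rewrite ler_pXn2r ?nnegrE// ?NE; last first.
      by apply: sumr_ge0 => k _; apply: sumr_ge0 => l _; rewrite mulr_ge0 ?hnorm_ge0.
    apply: ler_sum => k _; apply: ler_sum => l _.
    apply: le_trans (ler_norm _) (le_trans (Re_le_normc _) _).
    exact: Cauchy_Schwarz.
  rewrite /T /S; apply: sum_Cauchy_Schwarz => k; try by apply: sumr_ge0 => l _; exact: sqr_ge0.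
    by apply: sumr_ge0 => l _; rewrite mulr_ge0 ?hnorm_ge0.
  apply: sum_Cauchy_Schwarz => l; rewrite ?sqr_ge0 ?mulr_ge0 ?hnorm_ge0//.
  by rewrite exprMn.
have TN : T <= r ^+ 2 * N by exact: hr.
have [->|Nn0] := eqVneq N 0; first by rewrite mulr_ge0 ?sqr_ge0.
have Np : 0 < N by rewrite lt_neqAle eq_sym Nn0.
rewrite -(ler_pM2l Np) -expr2 (le_trans NT)//.
by rewrite mulrA [N * _]mulrC ler_wpM2r.
Qed.

End RowBall.

Section NeumannSeries.
Context {R : realType} {d : nat} {H : hilbertType R}.
Context (B : 'I_d -> bop H H) (cB : column_contraction B) (n : nat)
  (Z : @mxtuple R d n) (r : R) (r01 : 0 <= r < 1).
Hypothesis hr : forall x : 'I_d -> 'I_n -> H,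
  \sum_i hnorm (\sum_k \sum_l Z k i l *: x k l) ^+ 2 <=
  r ^+ 2 * \sum_k \sum_l hnorm (x k l) ^+ 2.

Definition pencil : 'M[bop H H]_n := \matrix_(i, j) \sum_k Z k i j *: B k.

Definition mxapp (A : 'M[bop H H]_n) (x : 'I_n -> H) (i : 'I_n) : H :=
  \sum_j A i j (x j).

Lemma mxapp_mul A A' x : mxapp (A *m A') x = mxapp A (mxapp A' x).
Proof.
apply/funext => i; rewrite /mxapp.
under eq_bigr do rewrite mxE bop_sumE.
rewrite exchange_big; apply: eq_bigr => k _ /=.
by rewrite linear_sum.
Qed.

Lemma mxapp1 x : mxapp 1%:M x = x.
Proof.
apply/funext => i; rewrite /mxapp (bigD1 i)// big1 => [|j /= ji].
  by rewrite mxE eqxx; exact: addr0.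
by rewrite mxE eq_sym (negbTE ji).
Qed.

(** The pencil is the strict row contraction [Z] applied after the contractive column [B]. *)
Lemma pencil_contraction x :
  \sum_i hnorm (mxapp pencil x i) ^+ 2 <= r ^+ 2 * \sum_i hnorm (x i) ^+ 2.
Proof.
have E i : mxapp pencil x i = \sum_k \sum_l Z k i l *: B k (x l).
  rewrite exchange_big; apply: eq_bigr => l _.
  by rewrite mxE bop_sumE.
under eq_bigr do rewrite E.
apply: le_trans (hr _) _; rewrite ler_wpM2l ?sqr_ge0// exchange_big /=.
by apply: ler_sum => l _; exact: cB.
Qed.

Fixpoint mxpow (m : nat) : 'M[bop H H]_n :=
  if m is m'.+1 then pencil *m mxpow m' else 1%:M.

Lemma mxpowSr m : mxpow m *m pencil = mxpow m.+1.
Proof.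
elim: m => [|m IH] /=; first by rewrite mul1mx mulmx1.
by rewrite -mulmxA IH.
Qed.

Lemma mxpow_contraction m x :
  \sum_i hnorm (mxapp (mxpow m) x i) ^+ 2 <= (r ^+ m) ^+ 2 * \sum_i hnorm (x i) ^+ 2.
Proof.
elim: m => [|m IH] /=; first by rewrite mxapp1 expr1n mul1r.
rewrite mxapp_mul; apply: le_trans (pencil_contraction _) _.
by rewrite (exprS r m) exprMn -[leRHS]mulrA ler_wpM2l ?sqr_ge0.
Qed.

Lemma mxpow_bounded m i j : bounded_by (mxpow m i j) (r ^+ m).
Proof.
move=> x; have /andP[r0 _] := r01.
rewrite -(@ler_pXn2r _ 2) ?nnegrE ?mulr_ge0 ?exprn_ge0 ?hnorm_ge0// exprMn.
pose y (l : 'I_n) := if l == j then x else 0.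
have -> : mxpow m i j x = mxapp (mxpow m) y i.
  rewrite /mxapp (bigD1 j)// big1 => [|l /= /negbTE lj].
    by rewrite /y eqxx; exact/esym/addr0.
  by rewrite /y lj linear0.
have -> : hnorm x ^+ 2 = \sum_l hnorm (y l) ^+ 2.
  rewrite (bigD1 j)//= /y eqxx big1 ?addr0// => l /negbTE ->.
  by rewrite hnorm0 expr0n.
apply: le_trans (mxpow_contraction m y); rewrite (bigD1 i)//= lerDl.
by apply: sumr_ge0 => l _; exact: sqr_ge0.
Qed.

Definition mxpow_sum (N : nat) : 'M[bop H H]_n := \sum_(m < N) mxpow m.

Lemma mxpow_sumS N : mxpow_sum N.+1 = mxpow_sum N + mxpow N.
Proof. by rewrite /mxpow_sum big_ord_recr. Qed.

(** The bound is the exact sum of the powers of r from N to N + p - 1, so the induction on [p]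
    closes. *)
Lemma mxpow_sum_tail N p i j :
  bounded_by ((mxpow_sum (N + p)) i j - (mxpow_sum N) i j)
    ((r ^+ N - r ^+ (N + p)) / (1 - r)).
Proof.
have /andP[r0 r1] := r01; have r1' : 1 - r != 0 by rewrite subr_eq0 gt_eqF.
elim: p => [|p IH]; first by move=> x; rewrite addn0 !subrr mul0r hnorm0 mul0r.
rewrite addnS mxpow_sumS [(_ + mxpow _) _ _]mxE addrAC.
rewrite (_ : (_ - _) / _ = (r ^+ N - r ^+ (N + p)) / (1 - r) + r ^+ (N + p)).
  by apply: bounded_byD IH (mxpow_bounded _ _ _).
by rewrite exprS; field.
Qed.

Lemma bounded_byM (S T : bop H H) (a b : R) : 0 <= a ->
  bounded_by S a -> bounded_by T b -> bounded_by (S * T) (a * b).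
Proof.
move=> a0 hS hT x; rewrite bopME; apply: le_trans (hS _) _.
by rewrite -mulrA ler_wpM2l.
Qed.

Lemma bounded_by_sum (F : 'I_n -> bop H H) (a : R) :
  (forall l, bounded_by (F l) a) -> bounded_by (\sum_l F l) (n%:R * a).
Proof.
move=> hF x; rewrite bop_sumE; apply: le_trans (hnorm_sum _ _) _.
apply: le_trans (_ : \sum_(l < n) a * hnorm x <= _).
  by apply: ler_sum => l _; exact: hF.
by rewrite sumr_const card_ord -mulrA mulr_natl.
Qed.

Lemma bounded_by_eq0 (T : bop H H) (c : nat -> R) :
  c @ \oo --> (0 : R) -> (forall N, bounded_by T (c N)) -> T = 0.
Proof.
move=> c0 hT; apply: bopP => x; apply: hnorm_small => e e0.
have x1 : 0 < hnorm x + 1 by rewrite ltr_wpDl ?hnorm_ge0.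
have /cvgrPdist_lt/(_ _ (divr_gt0 e0 x1))[N _ /(_ N (leqnn N))/=] := c0.
rewrite sub0r normrN ltr_pdivlMr// => h; apply: le_lt_trans (hT N x) _.
apply: le_lt_trans h; apply: le_trans (_ : `|c N| * hnorm x <= _).
  by rewrite ler_wpM2r ?hnorm_ge0// ler_norm.
by rewrite ler_wpM2l// lerDl.
Qed.

Lemma Neumann_rate_cvg : (fun N => r ^+ N / (1 - r)) @ \oo --> (0 : R).
Proof.
have /andP[r0 r1] := r01.
rewrite -[X in _ --> X](mul0r (1 - r)^-1); apply: cvgM; last exact: cvg_cst.
by apply: cvg_expr; rewrite ger0_norm.
Qed.

(** The rate in the last clause lets [mu] and inner products pass to the limit entry by entry. *)
Lemma Neumann_inverse : exists Y : 'M[bop H H]_n,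
  [/\ (1%:M - pencil) *m Y = 1%:M, Y *m (1%:M - pencil) = 1%:M &
      forall N i j, bounded_by (Y i j - mxpow_sum N i j) (r ^+ N / (1 - r))].
Proof.
have /andP[r0 r1] := r01; have r1' : 0 < 1 - r by rewrite subr_gt0.
have ex i j : exists T, forall N, bounded_by (T - mxpow_sum N i j) (r ^+ N / (1 - r)).
  apply: bop_limit Neumann_rate_cvg _ => N M NM; rewrite -(subnKC NM).
  apply: bounded_by_le (mxpow_sum_tail _ _ _ _).
  by apply: ler_wpM2r; [rewrite invr_ge0 ltW|rewrite gerBl exprn_ge0].
have /choice[Y0 hY0] : forall p : 'I_n * 'I_n, exists T, forall N,
    bounded_by (T - mxpow_sum N p.1 p.2) (r ^+ N / (1 - r)).
  by move=> p; exact: ex.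
pose Y := \matrix_(i, j) Y0 (i, j).
have hY N i j : bounded_by ((Y - mxpow_sum N) i j) (r ^+ N / (1 - r)).
  by move: (hY0 (i, j) N); rewrite !mxE.
have h1X i j : bounded_by ((1%:M - pencil) i j) 2.
  have -> : (1%:M - pencil) i j = mxpow 0 i j - mxpow 1 i j.
    by rewrite /= mulmx1 [in LHS]mxE [X in _ + X]mxE.
  have := bounded_byD (mxpow_bounded 0 i j) (bounded_byZ (-1) (mxpow_bounded 1 i j)).
  rewrite scaleN1r normcN Normc.normc1 expr0 expr1 mul1r.
  by apply: bounded_by_le; lra.
have sumR N : (1%:M - pencil) *m mxpow_sum N = 1%:M - mxpow N.
  elim: N => [|N IH]; first by rewrite /mxpow_sum big_ord0 mulmx0 subrr.
  by rewrite mxpow_sumS mulmxDr IH mulmxBl mul1mx addrA subrK.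
have sumL N : mxpow_sum N *m (1%:M - pencil) = 1%:M - mxpow N.
  elim: N => [|N IH]; first by rewrite /mxpow_sum big_ord0 mul0mx subrr.
  by rewrite mxpow_sumS mulmxDl IH mulmxBr mulmx1 mxpowSr addrA subrK.
(* [n] products of an entry of 1 - X, of norm at most 2, with the error of a partial sum, plus the
   remainder X^N. *)
pose c N := n%:R * (2 * (r ^+ N / (1 - r))) + r ^+ N.
have c0 : c @ \oo --> (0 : R).
  have -> : (0 : R) = n%:R * (2 * 0) + 0 by rewrite !mulr0 addr0.
  apply: cvgD; last by apply: cvg_expr; rewrite ger0_norm.
  apply: cvgM; first exact: cvg_cst.
  by apply: cvgM; [exact: cvg_cst|exact: Neumann_rate_cvg].
have pn N i j : bounded_by ((- mxpow N) i j) (r ^+ N).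
  move=> x; rewrite mxE (_ : (- mxpow N i j) x = - mxpow N i j x)// hnormN.
  exact: mxpow_bounded.
exists Y; split => [||N i j].
- apply/subr0_eq/matrixP => i j; rewrite [RHS]mxE; apply: bounded_by_eq0 c0 _ => N.
  rewrite (_ : _ - _ = (1%:M - pencil) *m (Y - mxpow_sum N) + - mxpow N); last first.
    by rewrite mulmxBr sumR opprB addrA [RHS]addrAC addrK.
  rewrite [X in bounded_by X]mxE; apply: bounded_byD => //.
  rewrite mxE; apply: bounded_by_sum => l; exact: bounded_byM.
- apply/subr0_eq/matrixP => i j; rewrite [RHS]mxE; apply: bounded_by_eq0 c0 _ => N.
  rewrite (_ : _ - _ = (Y - mxpow_sum N) *m (1%:M - pencil) + - mxpow N); last first.
    by rewrite mulmxBl sumL opprB addrA [RHS]addrAC addrK.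
  rewrite [X in bounded_by X]mxE; apply: bounded_byD => //.
  rewrite mxE; apply: bounded_by_sum => l; rewrite [2 * _]mulrC.
  by apply: bounded_byM => //; apply: divr_ge0; [exact: exprn_ge0|exact: ltW].
- rewrite (_ : _ - _ = (Y - mxpow_sum N) i j); first exact: hY.
  by rewrite [RHS]mxE [X in _ = _ + X]mxE.
Qed.

End NeumannSeries.

Section HerglotzTransform.
Context {R : realType} {d : nat}.
Local Notation C := R[i].
Local Notation H2 := (@fock R d).
Local Notation L := (@lshift R d).
Local Notation nc := (@Normc.normc R).
Context (mu : bop H2 H2 -> C) (hmu : positive_ncmeasure mu)
  (K : hilbertType R) (iota : {linear ncpoly R d -> K}) (Pi : 'I_d -> bop K K).
Hypothesis hgns : is_gns mu iota Pi.
Local Notation xi := (iota 1).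

(** Leaving the polynomial existential lets sums and products of adjoints be followed on both spaces
    at once; [poly_adj_pair_mu] then evaluates [mu] on the GNS side. *)
Definition poly_adj_pair (A : bop H2 H2) (B : bop K K) : Prop :=
  exists p, A = adj (peval L p) /\ B = adj (peval Pi p).

Lemma poly_adj_pair_lin a A B A' B' : poly_adj_pair A B -> poly_adj_pair A' B' ->
  poly_adj_pair (a *: A + A') (a *: B + B').
Proof.
move=> [p [-> ->]] [q [-> ->]]; exists (a^*%C *: p + q).
by rewrite !linearP /= !adj_lin conjcK.
Qed.

Lemma poly_adj_pair0 : poly_adj_pair 0 0.
Proof. by exists 0; rewrite !linear0 !adj0. Qed.

Lemma poly_adj_pair1 : poly_adj_pair 1 1.
Proof. by exists 1; rewrite !peval1 !adj1. Qed.

Lemma poly_adj_pairM A B A' B' : poly_adj_pair A B -> poly_adj_pair A' B' ->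
  poly_adj_pair (A * A') (B * B').
Proof.
by move=> [p [-> ->]] [q [-> ->]]; exists (q * p); rewrite !pevalM !adjM.
Qed.

Lemma poly_adj_pair_sum (I : Type) (s : seq I) (F : I -> bop H2 H2) (G : I -> bop K K) :
  (forall i, poly_adj_pair (F i) (G i)) ->
  poly_adj_pair (\sum_(i <- s) F i) (\sum_(i <- s) G i).
Proof.
move=> FG; elim: s => [|i s IH]; first by rewrite !big_nil; exact: poly_adj_pair0.
rewrite !big_cons; have := poly_adj_pair_lin 1 (FG i) IH.
by rewrite !scale1r.
Qed.

Lemma poly_adj_pair_disk A B : poly_adj_pair A B -> disk_system A.
Proof. by move=> [p [-> _]]; exact: disk_system_peval_adj. Qed.

Lemma poly_adj_pair_mu A B : poly_adj_pair A B -> mu A = dotp xi (B xi).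
Proof.
move=> [p [-> ->]]; have [hd _ _] := hgns.
have := hd p 1; rewrite peval1 mulr1 => <-.
by rewrite (gns_iota hgns p) adjP.
Qed.

Lemma mu1E : mu 1 = (hnorm xi ^+ 2)%:C.
Proof. by rewrite (poly_adj_pair_mu poly_adj_pair1) bop1E dotpxx. Qed.

Lemma poly_adj_pair_mxpow n (Z : mxtuple n) m i j :
  poly_adj_pair (mxpow (fun k => adj (L k)) Z m i j)
                (mxpow (fun k => adj (Pi k)) Z m i j).
Proof.
elim: m i j => [|m IH] i j /=.
  rewrite !mxE; case: eqP => _; [exact: poly_adj_pair1|exact: poly_adj_pair0].
rewrite !mxE; apply: poly_adj_pair_sum => l; apply: poly_adj_pairM => //.
rewrite !mxE; apply: poly_adj_pair_sum => k.
have pk : poly_adj_pair (adj (L k)) (adj (Pi k)).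
  by exists (ncvar k); rewrite !peval_var.
by have := poly_adj_pair_lin (Z k i l) pk poly_adj_pair0; rewrite !addr0.
Qed.

Lemma poly_adj_pair_mxpow_sum n (Z : mxtuple n) N i j :
  poly_adj_pair (mxpow_sum (fun k => adj (L k)) Z N i j)
                (mxpow_sum (fun k => adj (Pi k)) Z N i j).
Proof.
rewrite /mxpow_sum !summxE; apply: poly_adj_pair_sum => m.
exact: poly_adj_pair_mxpow.
Qed.

Definition resolvent_of n (Z : mxtuple n) (Y : 'M[bop K K]_n) : Prop :=
  (1%:M - pencil (fun k => adj (Pi k)) Z) *m Y = 1%:M /\
  Y *m (1%:M - pencil (fun k => adj (Pi k)) Z) = 1%:M.

(** Since (1 + X) (1 - X)^-1 = 2 (1 - X)^-1 - 1, it suffices to evaluate [mu] on a resolvent; the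
    partial sums of the two Neumann series correspond, and [mu] is continuous. *)
Lemma herglotzE n (Z : mxtuple n) : row_ball Z ->
  exists2 Y, resolvent_of Z Y &
    herglotz mu Z =
    \matrix_(i, j) (2 * dotp xi (Y i j xi) - (i == j)%:R * (hnorm xi ^+ 2)%:C).
Proof.
move=> bZ; have [r r01 hr] := row_ball_strict bZ.
have cL : column_contraction (fun k => adj (L k)).
  by move=> x; apply/row_contraction_adj/row_isometry_contraction/lshift_row_isometry.
have cPi : column_contraction (fun k => adj (Pi k)).
  by move=> x; apply/row_contraction_adj/row_isometry_contraction/(gns_row_isometry hgns).
have [Y [Y1 Y2 YN]] := Neumann_inverse cPi r01 (hr K).
have [W [W1 W2 WN]] := Neumann_inverse cL r01 (hr H2).
exists Y => //.
have XW : ZLstar Z = pencil (fun k => adj (L k)) Z by [].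
(* [herglotz] chooses its inverse; uniqueness of two-sided inverses identifies the choice with
   [W]. *)
have invW : opmx_inv (1%:M - ZLstar Z) = W.
  rewrite /opmx_inv; case: xgetP => [T _ [hT1 hT2]|noW]; last by case: (noW W); split; rewrite XW.
  by rewrite -[T]mul1mx -W2 -mulmxA -XW hT1 mulmx1.
have dW i j : disk_system (W i j).
  apply: disk_system_closed => e e0.
  have /cvgrPdist_lt/(_ _ e0)[N _ /(_ N (leqnn N))/=] := Neumann_rate_cvg r01.
  rewrite sub0r normrN => hN.
  exists (mxpow_sum (fun k => adj (L k)) Z N i j).
    exact: poly_adj_pair_disk (poly_adj_pair_mxpow_sum Z N i j).
  apply: bounded_by_le (WN N i j); apply: le_trans (ltW hN); exact: ler_norm.
have muW i j : mu (W i j) = dotp xi (Y i j xi).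
  apply/subr0_eq/eqP; rewrite -normc_eq0; apply: contraT => n0.
  set z := _ - _ in n0; have z0 : 0 < nc z by rewrite lt_neqAle normc_ge0 eq_sym n0.
  pose m := hnorm xi ^+ 2; have m0 : 0 <= m by exact: sqr_ge0.
  (* The errors are 2 c m for the functional and c m for the inner product; [N] makes c (3 m + 1)
     smaller than |z|. *)
  have m1 : 0 < 3 * m + 1 by rewrite ltr_wpDl// mulr_ge0.
  have /cvgrPdist_lt/(_ _ (divr_gt0 z0 m1))[N _ /(_ N (leqnn N))/=] :=
    Neumann_rate_cvg r01.
  rewrite sub0r normrN; set c := r ^+ N / (1 - r) => hN.
  have c0 : 0 <= c.
    have /andP[r0 r1] := r01; apply: divr_ge0; first exact: exprn_ge0.
    by rewrite subr_ge0 ltW.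
  have pair := poly_adj_pair_mxpow_sum Z N i j.
  set SL := mxpow_sum _ _ _ _ _ in pair; set SP := mxpow_sum _ _ _ _ _ in pair.
  have dS := poly_adj_pair_disk pair.
  have h1 : nc (mu (W i j - SL)) <= 2 * c * m.
    have dWS : disk_system (W i j - SL).
      by have := disk_system_lin (-1) dS (dW i j); rewrite scaleN1r addrC.
    by have := ncmeasure_bound hmu dWS c0 (WN N i j); rewrite mu1E.
  have h2 : nc (dotp xi ((Y i j - SP) xi)) <= c * m.
    apply: le_trans (Cauchy_Schwarz _ _) _; rewrite /m expr2 mulrCA.
    by apply: ler_wpM2l; [exact: hnorm_ge0|exact: YN].
  have zE : z = mu (W i j - SL) - dotp xi ((Y i j - SP) xi).
    have -> : mu (W i j - SL) = mu (W i j) - mu SL.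
      by have := ncmeasure_lin hmu (-1) dS (dW i j);
        rewrite scaleN1r addrC => ->; rewrite mulN1r addrC.
    rewrite (poly_adj_pair_mu pair) bopDE dotpDr.
    rewrite (_ : (- SP) xi = - SP xi)// dotpNr /z; ring.
  suff: nc z < nc z by rewrite ltxx.
  rewrite {1}zE; apply: le_lt_trans (le_normcD _ _) _; rewrite normcN.
  move: hN; rewrite ger0_norm// ltr_pdivlMr// => hN; nra.
rewrite /herglotz invW; apply/matrixP => i j; rewrite [LHS]mxE [RHS]mxE.
have -> : ((1%:M + ZLstar Z) *m W) i j = (2 : C) *: W i j + (- 1) *: ((i == j)%:R : bop H2 H2).
  have -> : (1%:M + ZLstar Z) *m W = W + W - 1%:M.
    have <- : (1%:M + 1%:M - (1%:M - ZLstar Z)) *m W = (1%:M + ZLstar Z) *m W.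
      by congr (_ *m _); rewrite opprB addrA addrAC addrK.
    by rewrite mulmxBl XW W1 mulmxDl mul1mx.
  rewrite mxE [X in X + _]mxE [X in _ + X]mxE [X in _ - X]mxE.
  by rewrite scaleN1r scaler_nat mulr2n.
have d1 : disk_system ((i == j)%:R : bop H2 H2).
  by case: eqP => _; [exact: disk_system1|exact: disk_system0].
rewrite (ncmeasure_lin hmu _ (dW i j) (disk_system_scale _ d1)).
rewrite (ncmeasureZ hmu _ d1) muW mulN1r; congr (_ - _).
by case: eqP => _; rewrite ?mul1r ?mul0r; [exact: mu1E|exact: ncmeasure0].
Qed.

End HerglotzTransform.

(** * Transfer functions *)

Section ComplexConvergence.
Context {R : realType}.
Local Notation C := R[i].
Local Notation nc := (@Normc.normc R).

Definition ccto (u : nat -> C) (l : C) : Prop :=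
  (fun n => nc (u n - l)) @ \oo --> (0 : R).

Lemma ccto_squeeze u l (v : nat -> R) :
  (forall n, nc (u n - l) <= v n) -> v @ \oo --> (0 : R) -> ccto u l.
Proof.
move=> uv v0; rewrite /ccto; apply: squeeze_cvgr v0; last exact: cvg_cst.
by apply: nearW => n; rewrite normc_ge0 uv.
Qed.

Lemma cctoD u v l m : ccto u l -> ccto v m -> ccto (fun n => u n + v n) (l + m).
Proof.
move=> ul vm.
have h : (fun n => nc (u n - l) + nc (v n - m)) @ \oo --> 0 + (0 : R) by exact: cvgD.
rewrite addr0 in h; apply: (ccto_squeeze _ h) => n.
by rewrite opprD addrACA; exact: le_normcD.
Qed.

Lemma cctoZ a u l : ccto u l -> ccto (fun n => a * u n) (a * l).
Proof.
move=> ul.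
have h : (fun n => nc a * nc (u n - l)) @ \oo --> nc a * (0 : R).
  by apply: cvgM => //; exact: cvg_cst.
rewrite mulr0 in h; apply: (ccto_squeeze _ h) => n.
by rewrite -mulrBr Normc.normcM.
Qed.

Lemma ccto_sum (I : Type) (r : seq I) (F : I -> nat -> C) (l : I -> C) :
  (forall i, ccto (F i) (l i)) ->
  ccto (fun n => \sum_(i <- r) F i n) (\sum_(i <- r) l i).
Proof.
move=> hF; elim: r => [|i r IH].
  rewrite /ccto (_ : (fun _ => _) = fun=> 0); first exact: cvg_cst.
  by apply/funext => n; rewrite !big_nil subrr Normc.normc0.
rewrite big_cons (_ : (fun n => _) = fun n => F i n + \sum_(j <- r) F j n).
  exact: cctoD.
by apply/funext => n; rewrite big_cons.
Qed.

Lemma ccto_csum (u : nat -> C) l : ccto (series u) l -> csum u = l.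
Proof.
move=> ul; rewrite /csum.
have part (p : {additive C -> R}) : (forall z, `|p z| <= nc z) ->
    series (fun n => p (u n)) @ \oo --> p l.
  move=> pn; apply/cvgrPdist_lt => e e0.
  have /cvgrPdist_lt/(_ _ e0)[N _ hN] := ul; exists N => // n Nn.
  have := hN n Nn; rewrite /= sub0r normrN ger0_norm ?normc_ge0//.
  apply: le_lt_trans; rewrite distrC.
  rewrite (_ : series _ n = p (series u n)); last by rewrite /series raddf_sum.
  by rewrite -raddfB; exact: pn.
rewrite (cvg_lim _ (part (@complex.Re R : {additive C -> R}) (@Re_le_normc R)))//.
rewrite (cvg_lim _ (part (@complex.Im R : {additive C -> R}) (@Im_le_normc R)))//.
by case: l {ul part}.
Qed.

Lemma ccto_dominated (u : nat -> C) (v : nat -> R) :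
  (forall n, nc (u n) <= v n) -> cvgn (series v) -> ccto (series u) (csum u).
Proof.
move=> uv cv.
have v0 n : 0 <= v n := le_trans (normc_ge0 _) (uv n).
have part (p : C -> R) : (forall z, `|p z| <= nc z) ->
    cvgn (series (fun n => p (u n))).
  move=> pn; apply: normed_cvg.
  apply: (@series_le_cvg _ (fun n => `|p (u n)|) v) => // n.
  exact: le_trans (pn _) (uv n).
have cR := part _ (@Re_le_normc R); have cI := part _ (@Im_le_normc R).
have dist0 (w : nat -> R) : cvgn w -> (fun n => `|w n - limn w|) @ \oo --> (0 : R).
  move=> cw; rewrite -(normr0 R) -(subrr (limn w)); apply: cvg_norm.
  by apply: cvgB => //; exact: cvg_cst.
pose a := limn (series (fun n => complex.Re (u n))).
pose b := limn (series (fun n => complex.Im (u n))).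
have h : (fun n => `|series (fun n => complex.Re (u n)) n - a| +
    `|series (fun n => complex.Im (u n)) n - b|) @ \oo --> 0 + (0 : R).
  by apply: cvgD; exact: dist0.
rewrite addr0 in h.
apply: (ccto_squeeze _ h) => n.
set z := _ - _; have -> : z = complex.Re z +i* complex.Im z by case: z.
have E (p : {additive C -> R}) : p (series u n) = series (fun n => p (u n)) n.
  by rewrite /series raddf_sum.
rewrite /z !raddfB /= (E (@complex.Re R : {additive C -> R})).
rewrite (E (@complex.Im R : {additive C -> R})) /csum /= -/a -/b.
move: (_ - a) (_ - b) => p q.
rewrite -(@ler_pXn2r _ 2) ?nnegrE ?sqrtr_ge0 ?addr_ge0//.
rewrite sqr_sqrtr ?addr_ge0 ?sqr_ge0// -(real_normK (num_real p)) -(real_normK (num_real q)).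
have := normr_ge0 p; have := normr_ge0 q; nra.
Qed.

End ComplexConvergence.

Section WordPolynomials.
Context {R : realType} {d : nat}.
Local Notation C := R[i].
Local Notation nc := (@Normc.normc R).

Lemma levsum_lin {V W : lmodType C} (T : {linear V -> W}) m (F : seq 'I_d -> V) :
  T (levsum m F) = levsum m (fun s => T (F s)).
Proof. by apply: levsum_morph; [exact: linear0|exact: linearD]. Qed.

Lemma levsum_scale {V : lmodType C} m (F : seq 'I_d -> V) (a : C) :
  levsum m (fun s => a *: F s) = a *: levsum m F.
Proof. by rewrite -(levsum_lin ( *:%R a)). Qed.

Lemma levsumB {V : zmodType} m (F G : seq 'I_d -> V) :
  levsum m (fun s => F s - G s) = levsum m F - levsum m G.
Proof.
rewrite levsumD; congr (_ + _).
by rewrite (levsum_morph (phi := -%R)) ?oppr0//; exact: opprD.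
Qed.

Lemma levsum_cvg (F : nat -> seq 'I_d -> R) m :
  (forall s, (F ^~ s) @ \oo --> (0 : R)) ->
  (fun n => levsum m (F n)) @ \oo --> (0 : R).
Proof.
elim: m F => [|m IH] F hF /=; first exact: hF.
have h := @cvg_finsum R _ (index_enum 'I_d)
  (fun j n => levsum m (fun s => F n (j :: s))) (fun=> 0).
by rewrite big1 in h => //; apply: h => j; exact: IH.
Qed.

Context (n : nat) (Z : @mxtuple R d n).

(* The part of degree [m] of [sum_w Z^w F_w], in the matrix position [(i, l)]. *)
Definition zlev {V : lmodType C} (m : nat) (F : seq 'I_d -> V) (i l : 'I_n) : V :=
  levsum m (fun s => wpow Z (FMonom s) i l *: F s).

Lemma zlev0 {V : lmodType C} (F : seq 'I_d -> V) i l :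
  zlev 0 F i l = (i == l)%:R *: F [::].
Proof. by rewrite /zlev /= wpow_nil mxE. Qed.

Lemma zlevS {V : lmodType C} m (F : seq 'I_d -> V) i l :
  zlev m.+1 F i l = \sum_k \sum_j Z k i j *: zlev m (fun s => F (k :: s)) j l.
Proof.
rewrite /zlev /=; apply: eq_bigr => k _.
rewrite (eq_bigr (fun j => levsum m (fun s =>
  Z k i j *: (wpow Z (FMonom s) j l *: F (k :: s))))) => [|j _]; last first.
  by rewrite levsum_scale.
rewrite -levsum_exchange; apply: eq_levsum => s.
rewrite wpow_cons mxE scaler_suml; apply: eq_bigr => j _.
by rewrite scalerA.
Qed.

Lemma zlev_lin {V W : lmodType C} (T : {linear V -> W}) m (F : seq 'I_d -> V) i l :
  T (zlev m F i l) = zlev m (fun s => T (F s)) i l.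
Proof. by rewrite levsum_lin; apply: eq_levsum => s; rewrite linearZ. Qed.

Lemma zlevB {V : lmodType C} m (F G : seq 'I_d -> V) i l :
  zlev m (fun s => F s - G s) i l = zlev m F i l - zlev m G i l.
Proof. by rewrite -levsumB; apply: eq_levsum => s; rewrite scalerBr. Qed.

Context (r : R) (r01 : 0 <= r < 1).

Lemma zlev_bound (H : hilbertType R) m (F : seq 'I_d -> H) l :
  (forall x : 'I_d -> 'I_n -> H,
    \sum_i hnorm (\sum_k \sum_l Z k i l *: x k l) ^+ 2 <=
    r ^+ 2 * \sum_k \sum_l hnorm (x k l) ^+ 2) ->
  \sum_i hnorm (zlev m F i l) ^+ 2 <=
  (r ^+ m) ^+ 2 * levsum m (fun s => hnorm (F s) ^+ 2).
Proof.
move=> hr; elim: m F => [|m IH] F.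
  rewrite expr1n mul1r (bigD1 l)//= zlev0 eqxx scale1r big1 ?addr0// => i il.
  by rewrite zlev0 (negbTE il) scale0r hnorm0 expr0n.
under eq_bigr do rewrite zlevS.
apply: le_trans (hr _) _; rewrite (exprS r m) exprMn -[leRHS]mulrA.
rewrite ler_wpM2l ?sqr_ge0//= mulr_sumr; apply: ler_sum => k _.
exact: IH.
Qed.

Lemma zlev_bound_scalar m (h : seq 'I_d -> C) i l :
  (forall (H : hilbertType R) (x : 'I_d -> 'I_n -> H),
    \sum_i hnorm (\sum_k \sum_l Z k i l *: x k l) ^+ 2 <=
    r ^+ 2 * \sum_k \sum_l hnorm (x k l) ^+ 2) ->
  nc (zlev m (h : seq 'I_d -> C^o) i l) ^+ 2 <=
  (r ^+ m) ^+ 2 * levsum m (fun s => nc (h s) ^+ 2).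
Proof.
(* Scalars are treated as multiples of a unit vector. *)
move=> hr; pose e : @fock R d := evec [::].
have := zlev_bound m (fun s => h s *: e) l (hr _).
rewrite (@eq_levsum _ _ _ _ (fun s => nc (h s) ^+ 2)) => [|s]; last first.
  by rewrite hnormZ hnorm_evec mulr1.
apply: le_trans; rewrite (bigD1 i)//=.
have -> : zlev m (fun s => h s *: e) i l = zlev m (h : seq 'I_d -> C^o) i l *: e.
  have := @levsum_morph d C^o (@fock R d) (fun c => c *: e) m
    (fun s => wpow Z (FMonom s) i l *: (h s : C^o)) (scale0r e) (fun a b => scalerDl e a b).
  move=> hm; apply: etrans (esym hm).
  by apply: eq_levsum => s; rewrite /= scalerA.
rewrite hnormZ hnorm_evec mulr1 lerDl.
by apply: sumr_ge0 => k _; exact: sqr_ge0.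
Qed.

End WordPolynomials.

Section TransferRecursion.
Context {R : realType} {d : nat} {K : hilbertType R}.
Local Notation C := R[i].
Local Notation nc := (@Normc.normc R).
Local Notation Re := (@complex.Re R).
Context (V : 'I_d -> bop K K) (xi : K) (t : R).
Implicit Types (h : seq 'I_d -> C) (s : seq 'I_d).
Local Notation m := (hnorm xi ^+ 2).

Definition clark_den : C := (1 + m) +i* t.
Local Notation delta := clark_den.

Lemma clark_den_neq0 : delta != 0.
Proof.
rewrite eq_complex negb_and; apply/orP; left.
by rewrite /= gt_eqF// ltr_pwDl// sqr_ge0.
Qed.

(** The solution y of delta y = 2 (c - <xi, p>): the coefficient of (1 - b) h produced by the input
    [c] and the incoming state [p]. *)
Definition feedback (c : C) (p : K) : C := 2 / delta * (c - dotp xi p).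

(* Multiplication by the symbol on the Fock space is realized by a unitary
   colligation; [tstate h] is the coefficient sequence of the state driven by
   the input [h], and [tout h] that of the output. *)
Fixpoint tstate h s : K :=
  let p := if s is j :: s' then adj (V j) (tstate h s') else 0 in
  p + feedback (h s) p *: xi.

Definition tpre h s : K := if s is j :: s' then adj (V j) (tstate h s') else 0.

Definition tfeed h s : C := feedback (h s) (tpre h s).

Definition tout h s : C := h s - tfeed h s.

Lemma tstateE h s : tstate h s = tpre h s + tfeed h s *: xi.
Proof. by case: s. Qed.

Lemma tfeedE h s : delta * tfeed h s = 2 * (h s - dotp xi (tpre h s)).
Proof.
by rewrite /tfeed /feedback mulrA; field; exact: clark_den_neq0.
Qed.

(** The change of energy is the real part of conj(y) (delta y - 2 (c - <xi, p>)), which vanishes by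
    the choice of y; the term i t |y|^2 is purely imaginary. *)
Lemma feedback_energy c p : 
  hnorm (p + feedback c p *: xi) ^+ 2 + nc (c - feedback c p) ^+ 2 =
  hnorm p ^+ 2 + nc c ^+ 2.
Proof.
set y := feedback c p.
have yE : delta * y = 2 * (c - dotp xi p).
  by rewrite /y /feedback mulrA; field; exact: clark_den_neq0.
rewrite hnormD_sqr hnormZ exprMn dotpZr [dotp p xi]dotpC !normc2.
move: yE; rewrite /clark_den; move: (dotp xi p) m c y => [a b] q [c1 c2] [y1 y2] /=.
move=> [e1 e2].
have h1 : y1 * ((1 + q) * y1 - t * y2) = y1 * (2 * (c1 - a)).
  by congr (_ * _); rewrite e1; ring.
have h2 : y2 * ((1 + q) * y2 + t * y1) = y2 * (2 * (c2 - b)).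
  by congr (_ * _); rewrite e2; ring.
lra.
Qed.

Lemma tstate_energy h s :
  hnorm (tstate h s) ^+ 2 + nc (tout h s) ^+ 2 =
  hnorm (tpre h s) ^+ 2 + nc (h s) ^+ 2.
Proof. by rewrite tstateE; exact: feedback_energy. Qed.

Lemma tstate_add h g s : tstate (fun s => h s + g s) s = tstate h s + tstate g s.
Proof.
elim: s => [|j s IH] /=.
  rewrite !add0r -scalerDl; congr (_ *: _).
  by rewrite /feedback -mulrDr; congr (_ * _); rewrite dotp0r !subr0.
rewrite IH linearD addrACA -scalerDl; congr (_ + _ *: _).
by rewrite /feedback -mulrDr; congr (_ * _); rewrite dotpDr; ring.
Qed.

Local Notation E h := (fun N => levsum N (fun s => hnorm (tstate h s) ^+ 2)).
Local Notation sq h := (fun N => levsum N (fun s => nc (h s) ^+ 2)).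

Lemma levsum_tpre0 h : levsum 0 (fun s => hnorm (tpre h s) ^+ 2) = 0.
Proof. by rewrite /= hnorm0 expr0n. Qed.

Lemma levsum_tpreS h N : levsum N.+1 (fun s => hnorm (tpre h s) ^+ 2) =
  levsum N (fun s => \sum_j hnorm (adj (V j) (tstate h s)) ^+ 2).
Proof. by rewrite levsum_exchange. Qed.

Lemma level_energy h N :
  E h N + sq (tout h) N = levsum N (fun s => hnorm (tpre h s) ^+ 2) + sq h N.
Proof. by rewrite -!levsumD; apply: eq_levsum => s; exact: tstate_energy. Qed.

(* The energy lost in the first step, which vanishes when [V] is Cuntz. *)
Definition deficit h (N : nat) : R := if N is 0 then 0 else
  hnorm (tstate h [::]) ^+ 2 - \sum_j hnorm (adj (V j) (tstate h [::])) ^+ 2.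

Lemma deficit_ge0 h N : row_contraction V -> 0 <= deficit h N.
Proof.
by case: N => //= N cV; rewrite subr_ge0; exact: row_contraction_adj.
Qed.

Lemma series1 (u : nat -> R) : series u 1 = u 0%N.
Proof. by rewrite /series /= big_nat1. Qed.

(** Sum of the level identities. Each passage to the next level applies the column of adjoints,
    which can only lose energy; the loss is recorded at the empty word, where an inner symbol will
    detect it. *)
Lemma total_energy_le h N : row_contraction V ->
  series (sq (tout h)) N.+1 + E h N + deficit h N <= series (sq h) N.+1.
Proof.
move=> cV; elim: N => [|N IH].
  have d0 : deficit h 0 = 0 by [].
  by have := level_energy h 0; rewrite levsum_tpre0 !series1 d0; lra.
rewrite [series (sq (tout h)) _]seriesSr [series (sq h) _]seriesSr.
have := level_energy h N.+1; rewrite levsum_tpreS => hE.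
case: N IH hE => [|N] IH hE.
  have d0 : deficit h 0 = 0 by [].
  have d1 : deficit h 1 = E h 0%N -
    levsum 0 (fun s => \sum_j hnorm (adj (V j) (tstate h s)) ^+ 2) by [].
  by move: IH; rewrite d0 d1; lra.
have le1 : levsum N.+1 (fun s => \sum_j hnorm (adj (V j) (tstate h s)) ^+ 2) <= E h N.+1.
  by apply: levsum_le => s _; exact: row_contraction_adj.
have dN : deficit h N.+2 = deficit h N.+1 by [].
by rewrite dN; lra.
Qed.

Lemma total_energy_cuntz h N : cuntz V ->
  series (sq (tout h)) N.+1 + E h N = series (sq h) N.+1.
Proof.
move=> cV; elim: N => [|N IH].
  by have := level_energy h 0; rewrite levsum_tpre0 !series1; lra.
rewrite [series (sq (tout h)) _]seriesSr [series (sq h) _]seriesSr.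
have := level_energy h N.+1; rewrite levsum_tpreS.
have -> : levsum N (fun s => \sum_j hnorm (adj (V j) (tstate h s)) ^+ 2) = E h N.
  by apply: eq_levsum => s; exact: cuntz_adj.
by lra.
Qed.

Lemma wlevel_sq (h : word d -> C) :
  wlevel (fun w => nc (h w) ^+ 2) = sq (fun s => h (FMonom s)).
Proof. by apply/funext => N; rewrite wlevelE. Qed.

Definition coefs (h : @fock R d) : seq 'I_d -> C := fun s => h (FMonom s).

Lemma series_coefs_le (h : @fock R d) N : series (sq (coefs h)) N <= hnorm h ^+ 2.
Proof.
rewrite hnorm_fock wlevel_sq; have /asboolP sh := fock_coefP h.
rewrite /square_summable wlevel_sq in sh.
apply: nondecreasing_cvgn_le => // i j ij.
apply: nondecreasing_series => // k _ _.
by apply: levsum_ge0 => s; exact: sqr_ge0.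
Qed.

Lemma series_coefs_cvg (h : @fock R d) : series (sq (coefs h)) @ \oo --> hnorm h ^+ 2.
Proof.
rewrite hnorm_fock wlevel_sq; have /asboolP sh := fock_coefP h.
by rewrite /square_summable wlevel_sq in sh.
Qed.

Section Output.
Hypothesis cV : row_contraction V.
Context (h : @fock R d).

Lemma tstate_energy_le N : E (coefs h) N <= hnorm h ^+ 2.
Proof.
apply: le_trans (series_coefs_le h N.+1); apply: le_trans (total_energy_le _ N cV).
have : 0 <= series (sq (tout (coefs h))) N.+1.
  apply: sumr_ge0 => k _; apply: levsum_ge0 => s; exact: sqr_ge0.
by have := deficit_ge0 (coefs h) N cV; lra.
Qed.

Lemma tout_series_le N : series (sq (tout (coefs h))) N <= hnorm h ^+ 2.
Proof.
apply: le_trans (series_coefs_le h N.+1); apply: le_trans (total_energy_le _ N cV).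
have : series (sq (tout (coefs h))) N <= series (sq (tout (coefs h))) N.+1.
  rewrite seriesSr lerDl; apply: levsum_ge0 => s; exact: sqr_ge0.
have : 0 <= E (coefs h) N by apply: levsum_ge0 => s; exact: sqr_ge0.
by have := deficit_ge0 (coefs h) N cV; lra.
Qed.

Lemma tout_l2 : (fun w : word d => tout (coefs h) (fmonom_val w)) \in @l2_pred R d.
Proof.
apply/asboolP; apply: (proj1 (@wseries_bounded _ _ _ (hnorm h ^+ 2) _ _)).
  by move=> w; exact: sqr_ge0.
by move=> N; rewrite wlevel_sq; exact: tout_series_le.
Qed.

Definition tfock : @fock R d := Fock tout_l2.

Lemma coefs_tfock : coefs tfock = tout (coefs h).
Proof. by []. Qed.

End Output.

End TransferRecursion.

(** * Values of the transfer function on the row ball *)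

Section TransferFunction.
Context {R : realType} {d : nat} {K : hilbertType R}.
Local Notation C := R[i].
Context (V : 'I_d -> bop K K) (cV : row_contraction V) (xi : K) (t : R).
Context (n : nat) (Z : @mxtuple R d n) (r : R) (r01 : 0 <= r < 1).
Hypothesis hr : forall (H : hilbertType R) (x : 'I_d -> 'I_n -> H),
  \sum_i hnorm (\sum_k \sum_l Z k i l *: x k l) ^+ 2 <=
  r ^+ 2 * \sum_k \sum_l hnorm (x k l) ^+ 2.
Local Notation X := (pencil (fun k => adj (V k)) Z).
Context (Y : 'M[bop K K]_n) (YX : Y *m (1%:M - X) = 1%:M).
Context (b : 'M[C]_n) (ub : 1%:M - b \in unitmx).
Hypothesis bE : (1%:M + b) *m invmx (1%:M - b) =
  \matrix_(i, j) (2 * dotp xi (Y i j xi) - (i == j)%:R * (hnorm xi ^+ 2)%:C) +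
  (0 +i* t)%:M.
Context (h : @fock R d) (l : 'I_n).

Local Notation c := (coefs h).
Definition level_st m i : K := zlev Z m (tstate V xi t c) i l.
Definition level_pr m i : K := zlev Z m (tpre V xi t c) i l.
Definition level_fd m i : C := zlev Z m (tfeed V xi t c : _ -> C^o) i l.
Definition level_in m i : C := zlev Z m (c : _ -> C^o) i l.
Definition level_ou m i : C := zlev Z m (tout V xi t c : _ -> C^o) i l.
Definition part (U : zmodType) (F : nat -> 'I_n -> U) N i : U :=
  \sum_(0 <= m < N) F m i.
Local Notation kk := level_st.
Local Notation pp := level_pr.
Local Notation yy := level_fd.
Local Notation hh := level_in.
Local Notation gg := level_ou.

Lemma pencilE (B : 'I_d -> bop K K) (x : 'I_n -> K) i :
  mxapp (pencil B Z) x i = \sum_k \sum_j Z k i j *: B k (x j).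
Proof.
rewrite /mxapp exchange_big; apply: eq_bigr => j _.
by rewrite mxE bop_sumE.
Qed.

Lemma mxappD A (x y : 'I_n -> K) i : mxapp A (fun j => x j + y j) i = mxapp A x i + mxapp A y i.
Proof. by rewrite /mxapp -big_split; apply: eq_bigr => j _; rewrite linearD. Qed.

Lemma mxappB A (x y : 'I_n -> K) i : mxapp A (fun j => x j - y j) i = mxapp A x i - mxapp A y i.
Proof. by rewrite /mxapp -sumrB; apply: eq_bigr => j _; rewrite linearB. Qed.

Lemma level_state m i : kk m i = pp m i + yy m i *: xi.
Proof.
rewrite /level_st /level_pr /level_fd.
have := @levsum_morph d C^o K (fun a => a *: xi) m
  (fun s => wpow Z (FMonom s) i l *: (tfeed V xi t c s : C^o)) (scale0r xi)
  (fun u v => scalerDl xi u v) => ->.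
rewrite -levsumD; apply: eq_levsum => s.
by rewrite tstateE scalerDr /= scalerA.
Qed.

Lemma level_pre0 i : pp 0%N i = 0.
Proof. by rewrite /level_pr zlev0 scaler0. Qed.

Lemma level_preS m i : pp m.+1 i = mxapp X (kk m) i.
Proof.
rewrite pencilE /level_pr zlevS; apply: eq_bigr => k _; apply: eq_bigr => j _.
by congr (_ *: _); rewrite /level_st (zlev_lin _ (adj (V k))).
Qed.

Lemma level_feed m i :
  clark_den xi t * yy m i = 2 * (hh m i - dotp xi (pp m i)).
Proof.
rewrite /level_fd /level_in /level_pr.
have -> : dotp xi (zlev Z m (tpre V xi t c) i l) =
    zlev Z m (fun s => dotp xi (tpre V xi t c s) : C^o) i l.
  rewrite (@levsum_morph d K C^o (dotp xi) m _ (dotp0r xi) (dotpDr xi)).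
  by apply: eq_levsum => s; rewrite /= dotpZr.
rewrite -zlevB.
have mulE (a : C) (F : seq 'I_d -> C^o) :
    a * zlev Z m F i l = zlev Z m (fun s => a * F s : C^o) i l.
  rewrite (@levsum_morph d C^o C^o ( *%R a) m _ (mulr0 a) (mulrDr a)).
  by apply: eq_levsum => s; rewrite /= /GRing.scale /= mulrCA.
rewrite !mulE; apply: eq_levsum => s; congr (_ *: _).
exact: tfeedE.
Qed.

Lemma level_out m i : gg m i = hh m i - yy m i.
Proof. by rewrite /level_ou /level_in /level_fd -zlevB. Qed.

Lemma partS (U : zmodType) (F : nat -> 'I_n -> U) N i :
  part F N.+1 i = part F N i + F N i.
Proof. by rewrite /part big_nat_recr. Qed.

(** Truncated states satisfy the resolvent equation up to the boundary term [pp N], the part of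
    degree N that the partial sum has not absorbed. *)
Lemma state_equation N i :
  part kk N i - mxapp X (part kk N) i = part yy N i *: xi - pp N i.
Proof.
elim: N i => [|N IH] i.
  rewrite /part !big_geq// level_pre0 scale0r /mxapp big1// => j _.
  by rewrite big_geq// linear0.
have -> : mxapp X (part kk N.+1) i = mxapp X (part kk N) i + pp N.+1 i.
  rewrite level_preS -mxappD; congr (mxapp _ _ i).
  by apply/funext => j; rewrite partS.
rewrite !partS opprD addrACA IH level_state scalerDl.
by rewrite -!addrA addKr.
Qed.

Lemma state_solution N i :
  part kk N i = mxapp Y (fun j => part yy N j *: xi - pp N j) i.
Proof.
transitivity (mxapp 1%:M (part kk N) i); first by rewrite mxapp1.
rewrite -YX mxapp_mul; congr (mxapp _ _ i); apply/funext => j.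
rewrite -state_equation.
have <- : mxapp 1%:M (part kk N) j = part kk N j by rewrite mxapp1.
rewrite /mxapp -sumrB; apply: eq_bigr => k _.
by rewrite [(1%:M - X) j k]mxE [(- X) j k]mxE.
Qed.

Definition state_error N i : C := dotp xi (mxapp Y (fun j => pp N j) i).

(** An identity for each truncation, with the boundary term as its only error; limits are taken
    afterwards, on scalars. *)
Lemma output_equation N i :
  part gg N i = \sum_j b i j * part hh N j - \sum_j (1%:M - b) i j * state_error N j.
Proof.
pose y : 'cV[C]_n := \col_i part yy N i; pose g : 'cV[C]_n := \col_i part hh N i.
pose e : 'cV[C]_n := \col_i state_error N i.
(* With G the Cayley matrix in [bE], (G + 1) y = 2 (g + e); as (1 - b) (G + 1) = 2, this yields y =
   (1 - b) (g + e). *)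
have Dy : ((1%:M + b) *m invmx (1%:M - b) + 1%:M) *m y = 2 *: (g + e).
  apply/colP => j; rewrite bE [RHS]mxE [X in _ * X]mxE [X in _ * (X + _)]mxE
    [X in _ * (_ + X)]mxE.
  have dk : dotp xi (part kk N j) =
      \sum_k dotp xi (Y j k xi) * part yy N k - state_error N j.
    rewrite state_solution mxappB dotpBr; congr (_ - _).
    rewrite /mxapp dotp_sumr; apply: eq_bigr => k _.
    by rewrite linearZ dotpZr mulrC.
  have dp : dotp xi (part pp N j) = dotp xi (part kk N j) -
      (hnorm xi ^+ 2)%:C * part yy N j.
    have -> : part kk N j = part pp N j + part yy N j *: xi.
      by rewrite /part scaler_suml -big_split; apply: eq_bigr => m _; exact: level_state.
    by rewrite dotpDr dotpZr dotpxx [_%:C * _]mulrC addrK.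
  have feed : clark_den xi t * part yy N j = 2 * (part hh N j - dotp xi (part pp N j)).
    rewrite /part dotp_sumr -sumrB !mulr_sumr; apply: eq_bigr => m _.
    exact: level_feed.
  rewrite !mulmxDl !mul_scalar_mx scale1r mxE [X in X + _ = _]mxE.
  rewrite [((0 +i* t) *: y) j 0]mxE [y j 0]mxE.
  have -> : ((\matrix_(i, j) (2 * dotp xi (Y i j xi) -
      (i == j)%:R * (hnorm xi ^+ 2)%:C)) *m y) j 0 =
      2 * (\sum_k dotp xi (Y j k xi) * part yy N k) -
      (hnorm xi ^+ 2)%:C * part yy N j.
    rewrite mxE (eq_bigr (fun k => 2 * (dotp xi (Y j k xi) * part yy N k) -
        (j == k)%:R * (hnorm xi ^+ 2)%:C * part yy N k)) => [|k _]; last first.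
      by rewrite !mxE mulrBl mulrA.
    rewrite sumrB -mulr_sumr; congr (_ - _).
    rewrite (bigD1 j)//= eqxx mul1r big1 ?addr0// => k kj.
    by rewrite eq_sym (negbTE kj) !mul0r.
  move: feed; rewrite dp dk /clark_den.
  rewrite (_ : (1 + _) +i* t = 1 + (hnorm xi ^+ 2)%:C + (0 +i* t)); last first.
    by apply/eqP; rewrite eq_complex /= !(addr0, add0r) !eqxx.
  move: (\sum_k _) (state_error N j) (part yy N j) (part hh N j)
    ((hnorm xi ^+ 2)%:C) (0 +i* t) => S E y' h' m' t' feed.
  have -> : 2 * S = 2 * h' + 2 * E + 2 * (m' * y') - (1 + m' + t') * y'.
    by rewrite feed; ring.
  by ring.
have bD : (1%:M - b) *m ((1%:M + b) *m invmx (1%:M - b) + 1%:M) = 2%:M.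
  have -> : (1%:M + b) *m invmx (1%:M - b) + 1%:M = 2 *: invmx (1%:M - b).
    transitivity ((1%:M + b) *m invmx (1%:M - b) + (1%:M - b) *m invmx (1%:M - b)).
      by rewrite (mulmxV ub).
    rewrite -mulmxDl.
    have -> : 1%:M + b + (1%:M - b) = 2%:M :> 'M[C]_n.
      by rewrite addrACA subrr addr0 -raddfD.
    by rewrite mul_scalar_mx.
  by rewrite -scalemxAr mulmxV// scale_scalar_mx mulr1.
have yE : y = (1%:M - b) *m (g + e).
  apply: (@scalerI _ _ (2 : C)); first by rewrite pnatr_eq0.
  by rewrite scalemxAr -Dy mulmxA bD mul_scalar_mx.
have -> : part gg N i = g i 0 - y i 0.
  by rewrite !mxE /part -sumrB; apply: eq_bigr => m _; exact: level_out.
rewrite yE mulmxDr [X in _ - X]mxE mulmxBl mul1mx [X in _ - (X + _)]mxE.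
rewrite [X in _ - (_ + X + _)]mxE opprD opprD opprK addrA addrA subrr add0r.
congr (_ - _); rewrite mxE; apply: eq_bigr => j _; by rewrite [_ j 0]mxE.
Qed.

Lemma level_pre_bound N i : hnorm (pp N i) <= r ^+ N * hnorm h.
Proof.
have /andP[r0 _] := r01.
rewrite -(@ler_pXn2r _ 2) ?nnegrE ?mulr_ge0 ?exprn_ge0 ?hnorm_ge0// exprMn.
apply: le_trans (_ : \sum_i hnorm (pp N i) ^+ 2 <= _).
  by rewrite (bigD1 i)//= lerDl; apply: sumr_ge0 => j _; exact: sqr_ge0.
have hz := zlev_bound N (tpre V xi t c) l (@hr K).
rewrite /level_pr; apply: le_trans hz _; rewrite ler_wpM2l ?sqr_ge0//.
case: N => [|N]; first by rewrite levsum_tpre0 sqr_ge0.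
apply: le_trans (tstate_energy_le xi t cV h N).
by rewrite levsum_tpreS; apply: levsum_le => s _; exact: row_contraction_adj.
Qed.

Lemma rate_cvg (a : R) : (fun N => a * r ^+ N) @ \oo --> (0 : R).
Proof.
have /andP[r0 r1] := r01; rewrite -[X in _ --> X](mulr0 a).
by apply: cvgM; [exact: cvg_cst|apply: cvg_expr; rewrite ger0_norm].
Qed.

Lemma state_error_cvg i : ccto (fun N => state_error N i) 0.
Proof.
have /choice[a ha] : forall j, exists a : R, 0 <= a /\ bounded_by (Y i j) a.
  by move=> j; have [a a0 ba] := bop_bounded (Y i j); exists a.
apply: (ccto_squeeze _ (rate_cvg (hnorm xi * \sum_j a j * hnorm h))) => N.
rewrite subr0; apply: le_trans (Cauchy_Schwarz _ _) _.
rewrite -mulrA ler_wpM2l ?hnorm_ge0//; apply: le_trans (hnorm_sum _ _) _.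
rewrite mulr_suml; apply: ler_sum => j _; have [a0 ba] := ha j.
apply: le_trans (ba _) _; rewrite -mulrA ler_wpM2l// mulrC.
exact: level_pre_bound.
Qed.

Lemma hevalE (g : @fock R d) i :
  heval g Z i l = csum (fun m => zlev Z m (coefs g : _ -> C^o) i l).
Proof.
rewrite mxE /wsum; congr csum; apply/funext => m.
by rewrite wlevelE; apply: eq_levsum => s; exact: mulrC.
Qed.

Lemma heval_cvg i : ccto (fun N => part hh N i) (heval h Z i l).
Proof.
rewrite hevalE; apply: (ccto_dominated (v := geometric (hnorm h) r)) => [m|].
  have /andP[r0 _] := r01.
  rewrite -(@ler_pXn2r _ 2) ?nnegrE ?mulr_ge0 ?exprn_ge0 ?hnorm_ge0 ?normc_ge0//.
  apply: le_trans (zlev_bound_scalar _ _ _ _ (@hr)) _.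
  rewrite exprMn mulrC ler_wpM2r ?sqr_ge0//.
  apply: le_trans (series_coefs_le h m.+1); rewrite seriesSr lerDr.
  apply: sumr_ge0 => k _; apply: levsum_ge0 => s; exact: sqr_ge0.
by have /andP[r0 r1] := r01; apply: is_cvg_geometric_series; rewrite ger0_norm.
Qed.

Lemma transfer_function i :
  heval (tfock xi t cV h) Z i l = \sum_j b i j * heval h Z j l.
Proof.
rewrite hevalE; apply: ccto_csum.
have h1 : ccto (fun N => \sum_j b i j * part hh N j) (\sum_j b i j * heval h Z j l).
  by apply: ccto_sum => j; apply: cctoZ; exact: heval_cvg.
have h2 : ccto (fun N => \sum_j (- (1%:M - b) i j) * state_error N j) 0.
  rewrite -[X in ccto _ X](_ : \sum_j (- (1%:M - b) i j) * 0 = 0); last first.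
    by rewrite big1// => j _; rewrite mulr0.
  by apply: ccto_sum => j; apply: cctoZ; exact: state_error_cvg.
have := cctoD h1 h2; rewrite addr0; congr ccto; apply/funext => N.
rewrite /series /= -[RHS]/(part gg N i) output_equation; congr (_ + _).
by rewrite -sumrN; apply: eq_bigr => j _; rewrite mulNr.
Qed.

End TransferFunction.

(** * Coefficients are determined by values on the row ball *)

Section CoefficientUniqueness.
Context {R : realType} {d : nat}.
Local Notation C := R[i].
Local Notation nc := (@Normc.normc R).

Lemma row_ball_small n (Z : @mxtuple R d n) (e : R) : 0 <= e ->
  e ^+ 2 * (d * (n * n))%:R < 1 -> (forall k i l, nc (Z k i l) <= e) -> row_ball Z.
Proof.
move=> e0 e1 Ze; apply: row_ball_intro => v v0.
set N := \sum_i nc (v i 0) ^+ 2.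
have N0 : 0 < N by exact: sum_normc_gt0.
have le k l : nc (rowadj Z (fun i => v i 0 : C^o) k l) ^+ 2 <= (n%:R * e ^+ 2) * N.
  apply: le_trans (_ : (\sum_i nc ((Z k i l)^*%C * v i 0)) ^+ 2 <= _).
    rewrite ler_pXn2r ?nnegrE ?normc_ge0 ?normc_sum//.
    by apply: sumr_ge0 => i _; exact: normc_ge0.
  apply: le_trans (_ : (\sum_(i < n) e ^+ 2) * N <= _).
    apply: sum_Cauchy_Schwarz => i; rewrite ?sqr_ge0 ?normc_ge0//.
    rewrite Normc.normcM exprMn normc_conj ler_wpM2r ?sqr_ge0//.
    by rewrite ler_pXn2r ?nnegrE ?normc_ge0.
  by rewrite sumr_const card_ord mulr_natl.
apply: le_lt_trans (_ : \sum_(k < d) \sum_(l < n) (n%:R * e ^+ 2) * N < _).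
  by apply: ler_sum => k _; apply: ler_sum => l _.
rewrite !sumr_const !card_ord -mulrnA -[X in X < _]mulr_natl.
have -> : (n * d)%:R * (n%:R * e ^+ 2 * N) = (e ^+ 2 * (d * (n * n))%:R) * N.
  by rewrite !natrM; ring.
by rewrite gtr_pMl.
Qed.

Lemma row_ball0 n : @row_ball R d n (fun=> 0).
Proof.
apply: (row_ball_small (lexx 0)); first by rewrite expr0n mul0r.
by move=> k i l; rewrite mxE Normc.normc0.
Qed.

(* A weighted nilpotent shift along the word [w]. *)
Definition word_tuple (w : seq 'I_d) (e : R) : @mxtuple R d (size w).+1 :=
  fun k => \matrix_(a, b) if (b == a.+1 :> nat) && (ohead (drop a w) == Some k)
                          then e%:C else 0.

Lemma word_tuple_wpow w e (u : seq 'I_d) a b :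
  wpow (word_tuple w e) (FMonom u) a b =
  if (b == (a + size u)%N :> nat) && prefix u (drop a w) then (e ^+ size u)%:C else 0.
Proof.
elim: u a => [|k u IH] a.
  by rewrite wpow_nil mxE prefix0s andbT addn0 expr0 -val_eqE eq_sym; case: eqP.
rewrite wpow_cons mxE.
have [aw|aw] := ltnP a (size w); last first.
  rewrite big1 => [|c _]; last by rewrite mxE drop_oversize// andbF mul0r.
  by rewrite drop_oversize// andbF.
have a1 : (a.+1 < (size w).+1)%N by [].
rewrite (bigD1 (Ordinal a1))//= big1 ?addr0 => [|c ca]; last first.
  by rewrite mxE (_ : (c == a.+1 :> nat) = false) ?mul0r//; apply/negbTE.
rewrite mxE eqxx IH /= addSnnS.
have -> : drop a w = nth k w a :: drop a.+1 w by rewrite -drop_nth.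
rewrite prefix_cons /=; case: (b == _ :> nat); rewrite ?mulr0//=.
rewrite (inj_eq Some_inj) eq_sym; case: eqP => _ /=; last by rewrite mul0r.
by case: prefix; rewrite ?mulr0// exprS rmorphM.
Qed.

(** At the nilpotent tuple of [w] the corner entry of Z^u is nonzero only for u = w, so evaluation
    returns the coefficient at [w] times e^|w|. *)
Lemma heval_inj (g g' : @fock R d) :
  (forall n (Z : mxtuple n), row_ball Z -> heval g Z = heval g' Z) -> g = g'.
Proof.
move=> gg; apply/val_inj/funext => w0; rewrite /= -(fmK w0).
set w := fmonom_val w0.
pose n := (size w).+1.
(* Since e <= 1, e^2 d n^2 <= e d n^2 < 1, as [row_ball_small] asks. *)
pose e : R := (d * (n * n)).+1%:R^-1.
have e0 : 0 < e by rewrite invr_gt0.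
have bZ : row_ball (word_tuple w e).
  apply: (row_ball_small (ltW e0)) => [|k i l]; last first.
    rewrite mxE; case: ifP => _; last by rewrite Normc.normc0 ltW.
    by rewrite normc_real ger0_norm// ltW.
  rewrite expr2 -mulrA; apply: le_lt_trans (_ : 1 * (e * (d * (n * n))%:R) < _).
    apply: ler_wpM2r; first by rewrite mulr_ge0 ?ler0n// ltW.
    by rewrite /e invf_le1// ler1n.
  by rewrite mul1r mulrC ltr_pdivrMr// mul1r ltr_nat.
have val (f : @fock R d) : heval f (word_tuple w e) ord0 ord_max =
    (e ^+ size w)%:C * f (FMonom w).
  rewrite hevalE (csum_single (k := size w)) => [|m /eqP mw].
    rewrite /zlev (levsum_pick (w := w))// => [|s sw nsw].
      by rewrite word_tuple_wpow add0n eqxx drop0 prefix_refl.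
    rewrite word_tuple_wpow drop0 (_ : prefix s w = false) ?andbF ?scale0r//.
    apply/negbTE/negP => /prefixP[v wv]; apply: nsw.
    move/(congr1 size): (wv); rewrite size_cat -sw => /eqP.
    rewrite sw -{1}[size w]addn0 eqn_add2l eq_sym => /eqP/size0nil v0.
    by rewrite wv v0 cats0.
  rewrite /zlev; apply: levsum0 => s sm.
  rewrite word_tuple_wpow add0n (_ : (_ == _ :> nat) = false) ?scale0r//.
  by rewrite /= sm eq_sym; apply/negbTE.
have := congr1 (fun M : 'M_n => M ord0 ord_max) (gg _ _ bZ).
rewrite /= !val => /mulfI; apply.
by rewrite eq_complex negb_and /= expf_neq0// gt_eqF.
Qed.

End CoefficientUniqueness.

(** * From an inner symbol to a Cuntz row *)

Section InnerImpliesCuntz.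
Context {R : realType} {d : nat}.
Local Notation C := R[i].
Local Notation H2 := (@fock R d).
Context (mu : bop H2 H2 -> C) (hmu : positive_ncmeasure mu)
  (K : hilbertType R) (iota : {linear ncpoly R d -> K}) (Pi : 'I_d -> bop K K).
Hypothesis hgns : is_gns mu iota Pi.
Context (b : @ncmap R d) (hb : is_clark_measure b mu).
Local Notation xi := (iota 1).

(** The [t] of the colligation is the one that [is_clark_measure] fixes through b(0). *)
Lemma clark_transfer : exists t : R, forall (h : H2) n (Z : mxtuple n),
  row_ball Z ->
  heval (tfock xi t (row_isometry_contraction (gns_row_isometry hgns)) h) Z =
  b Z *m heval h Z.
Proof.
have [_ hbZ] := hb; exists (complex.Im ((1 + @b 1%N (fun=> 0) 0 0) / (1 - @b 1%N (fun=> 0) 0 0))).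
move=> h n Z bZ; have [ub bE] := hbZ n Z bZ.
have [Y [Y1 Y2] hY] := herglotzE hmu hgns bZ; rewrite hY in bE.
have [r r01 hr] := row_ball_strict bZ.
apply/matrixP => i l; rewrite [RHS]mxE.
exact: (transfer_function (row_isometry_contraction (gns_row_isometry hgns)) r01 hr Y2 ub bE).
Qed.

Lemma inner_multiplier_cuntz : inner_multiplier b -> cuntz Pi.
Proof.
move=> hin; have [t ht] := clark_transfer.
have iV := gns_row_isometry hgns.
have [g hg ge] := hin (evec [::]).
move: ht; set cV := row_isometry_contraction _ => ht.
have gE : g = tfock xi t cV (evec [::]).
  by apply: heval_inj => n Z bZ; rewrite hg// ht.
pose k0 := tstate Pi xi t (coefs (evec [::])) [::].
pose D := hnorm k0 ^+ 2 - \sum_j hnorm (adj (Pi j) k0) ^+ 2.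
have g1 : hnorm g ^+ 2 = 1 by rewrite ge hnorm_evec expr1n.
(* Input and output both have norm 1, which leaves no room in the energy inequality for the loss [D]
   at the empty word. *)
have D0 : D <= 0.
  suff : hnorm g ^+ 2 <= 1 - D by rewrite g1; lra.
  have cg := @series_coefs_cvg R d g.
  rewrite -(cvg_lim _ cg)//; apply: limr_le; first by apply: cvgP cg.
  (* [deficit] is 0 at level 0, so the comparison starts with two terms. *)
  exists 2%N => // -[|[|N]] // _.
  have := total_energy_le xi t (coefs (evec [::])) N.+1 cV.
  have -> : deficit Pi xi t (coefs (evec [::])) N.+1 = D by [].
  rewrite gE coefs_tfock.
  have := series_coefs_le (evec [::] : H2) N.+2; rewrite hnorm_evec expr1n.
  have : 0 <= levsum N.+1 (fun s => hnorm (tstate Pi xi t (coefs (evec [::])) s) ^+ 2).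
    by apply: levsum_ge0 => s; exact: sqr_ge0.
  lra.
apply: (gns_vacuum_cuntz hgns).
have k0E : k0 = (2 / clark_den xi t) *: xi.
  have c1 : coefs (evec [::] : H2) [::] = 1.
    by rewrite /coefs -dotp_evec evec_dotp eqxx.
  change (0 + feedback xi t (coefs (evec [::] : H2) [::]) 0 *: xi =
    (2 / clark_den xi t) *: xi).
  by rewrite c1 add0r /feedback dotp0r subr0 mulr1.
have a0 : 0 < Normc.normc (2 / clark_den xi t) ^+ 2.
  rewrite exprn_gt0// lt_neqAle normc_ge0 eq_sym normc_eq0 mulf_neq0 ?pnatr_eq0//.
  by rewrite invr_eq0 clark_den_neq0.
move: D0; rewrite /D k0E hnormZ exprMn subr_le0.
rewrite (eq_bigr (fun j => Normc.normc (2 / clark_den xi t) ^+ 2 *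
  hnorm (adj (Pi j) xi) ^+ 2)) => [|j _]; last by rewrite linearZ hnormZ exprMn.
by rewrite -mulr_sumr ler_pM2l.
Qed.

End InnerImpliesCuntz.

(** * Closed-loop stability *)

Section Stability.
Context {R : realType} {d : nat} {K : hilbertType R}.
Local Notation C := R[i].
Local Notation nc := (@Normc.normc R).
Context (V : 'I_d -> bop K K) (cV : cuntz V) (xi : K) (t : R).
Context (n : nat) (f : 'I_n -> K).
Hypotheses (fo : orthonormal_family f)
  (fV : forall j a, expands f (adj (V j) (f a))) (fxi : expands f xi)
  (total : forall x, (forall w, dotp (wpow V w xi) x = 0) -> x = 0).

Fact feedback_map_subproof :
  (fun p => p + feedback xi t 0 p *: xi) \in @bounded_linear_pred R K K.
Proof.
apply/asboolP; split=> [a p q|].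
  rewrite scalerDr scalerA addrACA -scalerDl; congr (_ + _ *: _).
  by rewrite /feedback dotpPr; ring.
exists 1 => p; rewrite mul1r -(@ler_pXn2r _ 2) ?nnegrE ?hnorm_ge0//.
have := feedback_energy xi t 0 p; rewrite Normc.normc0 expr0n addr0 => <-.
by rewrite lerDl sqr_ge0.
Qed.
Definition feedback_map : bop K K := Bop feedback_map_subproof.

(** One step of the state after the input has stopped: the feedback still acts, with input 0. *)
Definition closed_loop (j : 'I_d) : bop K K := feedback_map * adj (V j).
Local Notation A := closed_loop.

Lemma closed_loopE j x :
  A j x = adj (V j) x + feedback xi t 0 (adj (V j) x) *: xi.
Proof. by []. Qed.

Lemma closed_loop_energy j x :
  hnorm (A j x) ^+ 2 + nc (feedback xi t 0 (adj (V j) x)) ^+ 2 =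
  hnorm (adj (V j) x) ^+ 2.
Proof.
have := feedback_energy xi t 0 (adj (V j) x).
by rewrite Normc.normc0 expr0n addr0 sub0r normcN.
Qed.

Lemma closed_loop_loss x : hnorm x ^+ 2 - \sum_j hnorm (A j x) ^+ 2 =
  \sum_j nc (feedback xi t 0 (adj (V j) x)) ^+ 2.
Proof.
rewrite -(cuntz_adj x cV) -sumrB; apply: eq_bigr => j _.
by rewrite -closed_loop_energy addrC addKr.
Qed.

Lemma closed_loop_contraction : column_contraction A.
Proof.
move=> x; rewrite -subr_ge0 closed_loop_loss.
by apply: sumr_ge0 => j _; exact: sqr_ge0.
Qed.

Local Notation cA := closed_loop_contraction.

Definition loss M x : R := hnorm x ^+ 2 - energy A M x.

Lemma loss_ge0 M x : 0 <= loss M x.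
Proof. by rewrite subr_ge0; exact: energy_le cA. Qed.

Lemma loss_le M N x : (M <= N)%N -> loss M x <= loss N x.
Proof.
move=> /subnKC <-; elim: (N - M)%N => [|k IH]; first by rewrite addn0.
apply: (le_trans IH); rewrite addnS lerD2l lerN2.
exact: energy_nonincreasing cA.
Qed.

Lemma lossS M x : loss M.+1 x =
  \sum_j nc (feedback xi t 0 (adj (V j) x)) ^+ 2 + \sum_j loss M (A j x).
Proof. by rewrite -closed_loop_loss /loss sumrB addrA subrK. Qed.

(** Functionals controlled by the energy lost in finitely many steps. The explicit constant is what
    turns into a uniform decay on a finite-dimensional space. *)
Definition observable x : Prop := exists M (c : R), 0 <= c /\
  forall y, nc (dotp x y) ^+ 2 <= c * loss M y.

Lemma observable_subspace : subspace_pred observable.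
Proof.
split.
  by exists 0%N, 0; split=> // y; rewrite dotp0l Normc.normc0 expr0n mul0r.
move=> a x y [M [c [c0 hx]]] [N [e [e0 hy]]].
exists (maxn M N), (2 * (nc a ^+ 2 * c + e)); split.
  by rewrite mulr_ge0// addr_ge0// mulr_ge0// sqr_ge0.
move=> z; rewrite dotpDl dotpZl.
have h1 : nc (dotp x z) ^+ 2 <= c * loss (maxn M N) z.
  by apply: le_trans (hx z) _; rewrite ler_wpM2l// loss_le// leq_maxl.
have h2 : nc (dotp y z) ^+ 2 <= e * loss (maxn M N) z.
  by apply: le_trans (hy z) _; rewrite ler_wpM2l// loss_le// leq_maxr.
apply: le_trans (_ : (nc (a^*%C * dotp x z) + nc (dotp y z)) ^+ 2 <= _).
  by rewrite ler_pXn2r ?nnegrE ?addr_ge0 ?normc_ge0// le_normcD.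
rewrite Normc.normcM normc_conj.
apply: le_trans (_ : 2 * ((nc a * nc (dotp x z)) ^+ 2 + nc (dotp y z) ^+ 2) <= _).
  by have := sqr_ge0 (nc a * nc (dotp x z) - nc (dotp y z)); nra.
rewrite -[leRHS]mulrA ler_wpM2l// mulrDl lerD// exprMn -[leRHS]mulrA.
by rewrite ler_wpM2l ?sqr_ge0.
Qed.

(** Under zero input the feedback after letter [j] is -(2 / delta) <V j xi, y>, and its square is
    part of the loss of the first step. *)
Lemma observable_generator j : observable (V j xi).
Proof.
exists 1%N, (nc (clark_den xi t / 2) ^+ 2); split; first exact: sqr_ge0.
move=> y; have -> : dotp (V j xi) y =
    - (clark_den xi t / 2 * feedback xi t 0 (adj (V j) y)).
  rewrite adjP /feedback sub0r; field.
  by rewrite clark_den_neq0.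
rewrite normcN Normc.normcM exprMn ler_wpM2l ?sqr_ge0//.
rewrite lossS (bigD1 j)//= -addrA lerDl addr_ge0//.
  by apply: sumr_ge0 => k _; exact: sqr_ge0.
by apply: sumr_ge0 => k _; exact: loss_ge0.
Qed.

(** The loss over M + 1 steps contains the loss over M steps that follows a first step by [j]. *)
Lemma observable_adj j x : observable x -> observable (adj (A j) x).
Proof.
move=> [M [c [c0 hx]]]; exists M.+1, c; split=> // y.
rewrite adjPl; apply: le_trans (hx _) _; rewrite ler_wpM2l//.
rewrite lossS (bigD1 (F := fun k => loss M (A k y)) j)//= addrCA lerDl addr_ge0//.
  by apply: sumr_ge0 => k _; exact: sqr_ge0.
by apply: sumr_ge0 => k _; exact: loss_ge0.
Qed.

(** On a vector orthogonal to all observables the feedback vanishes, so the closed loop acts as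
    adj(V_j) and the annihilator is coinvariant; then each adj(V_j) x is orthogonal to every V^w xi,
    hence 0. *)
Lemma observable_total x : (forall y, observable y -> dotp y x = 0) -> x = 0.
Proof.
pose N z := forall y, observable y -> dotp y z = 0.
have Nxi z j : N z -> dotp xi (adj (V j) z) = 0.
  by move=> Nz; rewrite -adjP; apply: Nz; exact: observable_generator.
have NV z j : N z -> N (adj (V j) z).
  move=> Nz y oy; have -> : adj (V j) z = A j z.
    by rewrite closed_loopE /feedback Nxi// subrr mulr0 scale0r addr0.
  by rewrite -adjPl; apply/Nz/observable_adj.
have Nw s z j : N z -> dotp (wpow V (FMonom s) xi) (adj (V j) z) = 0.
  elim: s z j => [|k s IH] z j Nz; first by rewrite wpow_nil; exact: Nxi.
  by rewrite wpow_cons bopME adjP; apply/IH/NV.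
move=> Nx; rewrite -(cuntz_sum x cV) big1// => j _.
rewrite (_ : adj (V j) x = 0) ?linear0//; apply: total => w.
by rewrite -(fmK w); exact: Nw.
Qed.

Lemma closed_loop_expands j x : expands f x -> expands f (A j x).
Proof.
move=> fx; rewrite closed_loopE addrC; apply: (expands_subspace f).2 => //.
exact: (expands_linear (fV j)).
Qed.

(* On the finite-dimensional space spanned by [f], observability is uniform. *)
Lemma closed_loop_uniform : exists M (rho : R), [/\ 0 <= rho, rho < 1 &
  forall x, expands f x -> energy A M x <= rho * hnorm x ^+ 2].
Proof.
(* The [n] approximation errors 2 e |x|^2 then add up to at most |x|^2 / 2, which the left-hand side
   absorbs. *)
pose e : R := (2 * (2 * n.+1%:R))^-1; have e0 : 0 < e by rewrite invr_gt0 !mulr_gt0 ?ltr0n.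
have s0 : 0 < Num.sqrt e by rewrite sqrtr_gt0.
have ex a : exists Mc : nat * R, 0 <= Mc.2 /\ forall x,
    nc (dotp (f a) x) ^+ 2 <= 2 * e * hnorm x ^+ 2 + 2 * Mc.2 * loss Mc.1 x.
  have [y sy fy] := total_closed_span observable_total (f a) s0.
  have [M [c [c0 hy]]] : observable y.
    by apply: lspan_min sy => //; exact: observable_subspace.
  exists (M, c); split=> // x /=.
  have -> : dotp (f a) x = dotp (f a - y) x + dotp y x by rewrite dotpBl subrK.
  apply: le_trans (_ : (nc (dotp (f a - y) x) + nc (dotp y x)) ^+ 2 <= _).
    by rewrite ler_pXn2r ?nnegrE ?addr_ge0 ?normc_ge0// le_normcD.
  have h1 : nc (dotp (f a - y) x) ^+ 2 <= e * hnorm x ^+ 2.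
    apply: le_trans (Cauchy_Schwarz_sqr _ _) _; rewrite ler_wpM2r ?sqr_ge0//.
    rewrite -(sqr_sqrtr (ltW e0)) ler_pXn2r ?nnegrE ?hnorm_ge0 ?sqrtr_ge0//.
    exact: ltW.
  have h2 := hy x.
  have := sqr_ge0 (nc (dotp (f a - y) x) - nc (dotp y x)).
  by nra.
have [Mc hMc] := choice ex.
pose M := \max_a (Mc a).1; pose c := \sum_a (Mc a).2.
have c0 : 0 <= c by apply: sumr_ge0 => a _; exact: (hMc a).1.
have c1 : 0 < 4 * c + 1 by rewrite ltr_wpDl// mulr_ge0.
have key x : expands f x -> hnorm x ^+ 2 <= 4 * c * loss M x.
  move=> fx; have : hnorm x ^+ 2 <= \sum_(a < n) (2 * e * hnorm x ^+ 2) +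
      2 * c * loss M x.
    rewrite [leLHS](Parseval fx) /c mulr_sumr mulr_suml -big_split /=.
    apply: ler_sum => a _; apply: le_trans ((hMc a).2 x) _; rewrite lerD2l.
    rewrite ler_wpM2l ?mulr_ge0 ?(hMc a).1//; apply: loss_le.
    exact: (leq_bigmax_cond (F := fun a => (Mc a).1)).
  rewrite sumr_const card_ord -(mulr_natl _ n).
  have : n%:R * (2 * e * hnorm x ^+ 2) <= 2^-1 * hnorm x ^+ 2.
    rewrite mulrA ler_wpM2r ?sqr_ge0// /e.
    have -> : n%:R * (2 * (2 * (2 * n.+1%:R))^-1) = n%:R / n.+1%:R * 2^-1 :> R.
      have : n.+1%:R != 0 :> R by rewrite pnatr_eq0.
      by move: n.+1%:R => u u0; field.
    rewrite -[leRHS]mul1r ler_wpM2r ?invr_ge0// ler_pdivrMr ?ltr0n// mul1r.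
    by rewrite ler_nat.
  by rewrite -!(mulrA _ c); move: (n%:R * _) (c * _) => u v; lra.
(* From |x|^2 <= (4 c + 1) loss, where the added 1 avoids division by 0 when c = 0. *)
exists M, (1 - (4 * c + 1)^-1); split.
- by rewrite subr_ge0 invf_le1// lerDr mulr_ge0.
- by rewrite gtrBl invr_gt0.
- move=> x /key; rewrite /loss => h.
  have : hnorm x ^+ 2 <= (4 * c + 1) * loss M x.
    by rewrite mulrDl mul1r (le_trans h)// lerDl loss_ge0.
  rewrite mulrC -ler_pdivrMr// /loss mulrC => h2.
  by rewrite mulrBl mul1r; lra.
Qed.

Lemma closed_loop_stable x : expands f x -> energy_vanishes A x.
Proof.
have [M [rho [r0 r1 hM]]] := closed_loop_uniform.
move=> fx; apply: (@energy_vanishes_step _ _ _ _ _ M rho (fun=> 0) cA r0 r1).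
  exact: cvg_cst.
move=> m; rewrite addr0; elim: m x fx => [|m IH] x fx; first exact: hM.
rewrite addSn /= mulr_sumr; apply: ler_sum => j _.
by apply: IH; exact: closed_loop_expands.
Qed.

Local Notation E h := (fun N => levsum N (fun s => hnorm (tstate V xi t h s) ^+ 2)).

Lemma tstate_expands h s : expands f (tstate V xi t h s).
Proof.
have [f0 fP] := expands_subspace f.
elim: s => [|j s IH] /=; first by rewrite addrC; apply: fP.
by rewrite addrC; apply: fP => //; exact: (expands_linear (fV j)).
Qed.

(** Once the input has stopped, adding a letter in front of a word applies one closed loop step to
    the state. *)
Lemma tstate_free h N k : (forall s, (N <= size s)%N -> h s = 0) ->
  E h (N + k)%N = levsum N (fun s => energy A k (tstate V xi t h s)).
Proof.
move=> hN; suff gen : forall m, (N <= m)%N ->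
    E h (m + k)%N = levsum m (fun s => energy A k (tstate V xi t h s)) by exact: gen.
elim: k => [|k IH] m Nm; first by rewrite addn0.
rewrite addnS -addSn IH ?(leq_trans Nm)//.
change (\sum_j levsum m (fun s => energy A k (tstate V xi t h (j :: s))) =
  levsum m (fun s => \sum_j energy A k (A j (tstate V xi t h s)))).
rewrite levsum_exchange; apply: eq_bigr => j _; apply: eq_levsum_size => s sm.
by congr energy; rewrite /= hN//= ?sm ?(leq_trans Nm).
Qed.

(** The input is cut at a length N0: the state of the short part decays by stability, and that of
    the rest is bounded by the small energy of the rest. *)
Lemma tstate_energy_vanishes (h : @fock R d) :
  (fun N => E (coefs h) N) @ \oo --> (0 : R).
Proof.
apply/cvgrPdist_lt => e e0; have e4 : 0 < e / 4 by rewrite divr_gt0.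
have ch := @series_coefs_cvg R d h.
have /cvgrPdist_lt/(_ _ e4)[N0 _ /(_ N0 (leqnn N0)) /= hN0] := ch.
pose u s : C := if (size s < N0)%N then coefs h s else 0.
pose v s : C := if (size s < N0)%N then 0 else coefs h s.
have uv : coefs h = (fun s => u s + v s).
  by apply/funext => s; rewrite /u /v; case: ifP; rewrite ?addr0 ?add0r.
have u0 s : (N0 <= size s)%N -> u s = 0 by rewrite /u ltnNge => ->.
have uE : (fun k => levsum N0 (fun s => energy A k (tstate V xi t u s))) @ \oo --> (0 : R).
  by apply: levsum_cvg => s; apply: closed_loop_stable; exact: tstate_expands.
have vE N : E v N < e / 4.
  have cVr := row_isometry_contraction cV.1.
  have h1 := total_energy_le xi t v N cVr; have h2 := deficit_ge0 xi t v N cVr.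
  have h3 : 0 <= series (fun N => levsum N (fun s => nc (tout V xi t v s) ^+ 2)) N.+1.
    by apply: sumr_ge0 => k _; apply: levsum_ge0 => s; exact: sqr_ge0.
  pose sq g := fun N => levsum N (fun s : seq 'I_d => nc (g s : C) ^+ 2).
  have h4 : series (sq v) N.+1 <= hnorm h ^+ 2 - series (sq (coefs h)) N0.
    have sqv k : sq v k = if (k < N0)%N then 0 else sq (coefs h) k.
      rewrite /sq; case: ifP => kN.
        apply: levsum0 => s sk; rewrite /v sk kN Normc.normc0 expr0n//.
      by apply: eq_levsum_size => s sk; rewrite /v sk kN.
    have le_tail K' : (N0 <= K')%N ->
        series (sq v) K' = series (sq (coefs h)) K' - series (sq (coefs h)) N0.
      move=> NK; rewrite sub_series_geq// /series /= (big_cat_nat _ NK)//=.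
      rewrite big_nat big1 ?add0r => [|i /andP[_ iN]]; last by rewrite sqv iN.
      by apply: eq_big_nat => i /andP[Ni _]; rewrite sqv ltnNge Ni.
    apply: le_trans (_ : series (sq v) (maxn N0 N.+1) <= _).
      apply: (nondecreasing_series (P := xpredT)); last exact: leq_maxr.
      by move=> k _ _; apply: levsum_ge0 => s; exact: sqr_ge0.
    by rewrite le_tail ?leq_maxl// lerD2r; exact: series_coefs_le.
  have h5 : hnorm h ^+ 2 - series (sq (coefs h)) N0 < e / 4.
    by apply: le_lt_trans hN0; exact: ler_norm.
  by move: h1 h4; rewrite /sq; lra.
have /cvgrPdist_lt/(_ _ e4)[k0 _ hk] := uE.
exists (N0 + k0)%N => // N /= NN.
have N0N : (N0 <= N)%N by exact: leq_trans (leq_addr k0 N0) NN.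
have NE : N = (N0 + (N - N0))%N by exact: esym (subnKC N0N).
have uN : E u N < e / 4.
  have kk : (k0 <= N - N0)%N by rewrite (leq_subRL _ N0N); exact: NN.
  have := hk _ kk; rewrite /= sub0r normrN -(tstate_free _ u0) -NE.
  by apply: le_lt_trans; exact: ler_norm.
rewrite sub0r normrN ger0_norm; last by apply: levsum_ge0 => s; exact: sqr_ge0.
apply: le_lt_trans (_ : 2 * E u N + 2 * E v N < _).
  rewrite -!levsumZ -levsumD; apply: levsum_le => s _.
  rewrite uv tstate_add.
  have := hnorm_parallel (tstate V xi t u s) (tstate V xi t v s).
  rewrite -(mulr_natl (_ + _) 2); have := sqr_ge0 (hnorm (tstate V xi t u s - tstate V xi t v s)).
  lra.
by have := vE N; lra.
Qed.

Lemma tfock_isometric (cVr : row_contraction V) (h : @fock R d) :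
  hnorm (tfock xi t cVr h) = hnorm h.
Proof.
apply/eqP; rewrite -(@eqrXn2 _ 2) ?hnorm_ge0//; apply/eqP.
have c1 := @series_coefs_cvg R d (tfock xi t cVr h).
have c2 := @series_coefs_cvg R d h; have c3 := tstate_energy_vanishes h.
rewrite coefs_tfock in c1.
rewrite -(cvg_shiftS _) /= in c1; rewrite -(cvg_shiftS _) /= in c2.
have c4 := cvgD c1 c3; rewrite addr0 in c4; have {}c4 := c4 eventually_filter.
rewrite -(cvg_lim _ c4)// -(cvg_lim _ c2)//; congr (limn _).
by apply/funext => N; exact: total_energy_cuntz.
Qed.

End Stability.

(** * Rational symbols *)

Section Accretive.
Context {R : realType}.
Local Notation C := R[i].
Local Notation Re := (@complex.Re R).

Definition cdot n (u v : 'cV[C]_n) : C := (u^t* *m v) 0 0.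

Lemma cdotE n (u v : 'cV[C]_n) : cdot u v = \sum_i (u i 0)^*%C * v i 0.
Proof. by rewrite /cdot mxE; apply: eq_bigr => i _; rewrite !mxE. Qed.

Lemma cdot0r n (u : 'cV[C]_n) : cdot u 0 = 0.
Proof. by rewrite /cdot mulmx0 mxE. Qed.

Lemma cdotDr n (u v w : 'cV[C]_n) : cdot u (v + w) = cdot u v + cdot u w.
Proof. by rewrite /cdot mulmxDr mxE. Qed.

Lemma accretive_unit n (A : 'M[C]_n) :
  (forall v, v != 0 -> 0 < Re (cdot v (A *m v))) -> A \in unitmx.
Proof.
move=> hA; rewrite -unitmx_tr unitmxE unitfE; apply/negP => /det0P[r r0 rA].
have /hA : r^T != 0 by apply: contra r0 => /eqP r0; rewrite -(trmxK r) r0 trmx0.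
by rewrite -[A]trmxK -trmx_mul rA trmx0 cdot0r ltxx.
Qed.

(** The coefficients are n by n matrices and only [k] is fixed, so that elimination yields
    expressions valid for all [n]. *)
Definition accretive_system k n (P : 'I_k -> 'I_k -> 'M[C]_n) : Prop :=
  forall x : 'I_k -> 'cV[C]_n, (exists a, x a != 0) ->
    0 < Re (\sum_a cdot (x a) (\sum_b P a b *m x b)).

End Accretive.

Section Expressions.
Context {R : realType} {d : nat}.
Local Notation C := R[i].
Local Notation expr := (@ncexpr R d).
Local Notation eval := ncexpr_eval.
Local Notation dom := ncexpr_dom.

Definition esub (r s : expr) : expr := EAdd r (EMul (EConst (-1)) s).

Lemma esubE (r s : expr) n (Z : mxtuple n) : eval (esub r s) Z = eval r Z - eval s Z.
Proof. by rewrite /= mul_scalar_mx scaleN1r. Qed.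

Definition esum k (F : 'I_k -> expr) : expr :=
  foldr (fun a e => EAdd (F a) e) (EConst 0) (enum 'I_k).

Lemma esumE k (F : 'I_k -> expr) n (Z : mxtuple n) :
  eval (esum F) Z = \sum_a eval (F a) Z.
Proof.
rewrite -big_enum /= /esum; elim: (enum 'I_k) => [|a s IH] /=.
  by rewrite big_nil raddf0.
by rewrite big_cons IH.
Qed.

Lemma esum_dom k (F : 'I_k -> expr) n (Z : mxtuple n) :
  (forall a, dom (F a) Z) -> dom (esum F) Z.
Proof. by move=> hF; rewrite /esum; elim: (enum 'I_k). Qed.

Lemma invmx_uniq n (A B : 'M[C]_n) : A *m B = 1%:M -> invmx A = B.
Proof.
by move=> AB; have [uA _] := mulmx1_unit AB; rewrite -[RHS](mulKmx uA) AB mulmx1.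
Qed.

Lemma ncexpr_eval_block (r : expr) m n (Z : mxtuple m) (W : mxtuple n) :
  dom r Z -> dom r W ->
  eval r (fun j => block_mx (Z j) 0 0 (W j)) = block_mx (eval r Z) 0 0 (eval r W).
Proof.
elim: r => [j|c|r IHr s IHs|r IHr s IHs|r IHr] //=.
- by move=> _ _; rewrite scalar_mx_block.
- by move=> [? ?] [? ?]; rewrite IHr// IHs// add_block_mx !addr0.
- move=> [? ?] [? ?]; rewrite IHr// IHs// mulmx_block.
  by rewrite !mul0mx !mulmx0 !addr0 !add0r.
- move=> [? uZ] [? uW]; rewrite IHr//; apply: invmx_uniq.
  rewrite mulmx_block !mul0mx !mulmx0 !addr0 !add0r !mulmxV//.
  by rewrite -scalar_mx_block.
Qed.

Lemma ncexpr_eval_conj (r : expr) n (Z : mxtuple n) (S : 'M[C]_n) :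
  S \in unitmx -> dom r Z ->
  eval r (fun j => invmx S *m Z j *m S) = invmx S *m eval r Z *m S.
Proof.
move=> uS; elim: r => [j|c|r IHr s IHs|r IHr s IHs|r IHr] //=.
- by move=> _; rewrite scalar_mxC mulmxKV.
- by move=> [? ?]; rewrite IHr// IHs// mulmxDr mulmxDl.
- by move=> [? ?]; rewrite IHr// IHs// !mulmxA mulmxK.
- move=> [? u]; rewrite IHr//; apply: invmx_uniq.
  by rewrite !mulmxA mulmxK// mulmxK// mulVmx.
Qed.

(* Block Gaussian elimination: Schur complements of accretive systems are
   accretive, hence invertible. *)
Lemma accretive_solve (D : forall n, @mxtuple R d n -> Prop) k
    (P : 'I_k -> 'I_k -> expr) (c : 'I_k -> expr) :
  (forall n (Z : mxtuple n), D n Z ->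
     [/\ forall a b, dom (P a b) Z, forall a, dom (c a) Z &
         accretive_system (fun a b => eval (P a b) Z)]) ->
  exists x : 'I_k -> expr, forall n (Z : mxtuple n), D n Z ->
    (forall a, dom (x a) Z) /\
    forall a, \sum_b eval (P a b) Z *m eval (x b) Z = eval (c a) Z.
Proof.
elim: k P c => [|k IH] P c hP; first by exists c => n Z _; split=> -[].
pose P' a b := P (lift ord0 a) (lift ord0 b).
have hP' : forall n (Z : mxtuple n), D n Z ->
    (forall a b, dom (P' a b) Z) /\ accretive_system (fun a b => eval (P' a b) Z).
  move=> n Z DZ; have [dP dc aP] := hP n Z DZ; split=> [a b|x [a xa]]; first exact: dP.
  (* Padding with a zero first component: the lower block inherits accretivity. *)
  pose y b := if unlift ord0 b is Some b' then x b' else 0.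
  have y0 : y ord0 = 0 by rewrite /y unlift_none.
  have yl b : y (lift ord0 b) = x b by rewrite /y liftK.
  have := aP y; rewrite big_ord_recl y0.
  rewrite [cdot 0 _](_ : _ = 0) ?add0r; last first.
    by rewrite cdotE big1// => i _; rewrite mxE rmorph0 mul0r.
  rewrite (eq_bigr (fun a => cdot (x a) (\sum_b eval (P' a b) Z *m x b))) => [|b _].
    by apply; exists (lift ord0 a); rewrite yl.
  rewrite yl big_ord_recl y0 mulmx0 add0r.
  by congr cdot; apply: eq_bigr => e _; rewrite yl.
(* [u] solves the lower block against the first column and [w] against the right-hand side; the
   first unknown is then found by inverting the Schur complement [s]. *)
have [u hu] : exists u : 'I_k -> expr, forall n (Z : mxtuple n), D n Z ->
    (forall a, dom (u a) Z) /\ forall a, \sum_b eval (P' a b) Z *m eval (u b) Z =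
      eval (P (lift ord0 a) ord0) Z.
  apply: (IH P' (fun a => P (lift ord0 a) ord0)) => n Z DZ.
  by have [? ?] := hP' n Z DZ; have [? _ _] := hP n Z DZ; split.
have [w hw] : exists w : 'I_k -> expr, forall n (Z : mxtuple n), D n Z ->
    (forall a, dom (w a) Z) /\ forall a, \sum_b eval (P' a b) Z *m eval (w b) Z =
      eval (c (lift ord0 a)) Z.
  apply: (IH P' (fun a => c (lift ord0 a))) => n Z DZ.
  by have [? ?] := hP' n Z DZ; have [_ ? _] := hP n Z DZ; split.
pose s := esub (P ord0 ord0) (esum (fun a => EMul (P ord0 (lift ord0 a)) (u a))).
pose x0 := EMul (EInv s)
  (esub (c ord0) (esum (fun a => EMul (P ord0 (lift ord0 a)) (w a)))).
exists (fun b => if unlift ord0 b is Some a then esub (w a) (EMul (u a) x0) else x0).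
move=> n Z DZ; have [dP dc aP] := hP n Z DZ.
have [du eu] := hu n Z DZ; have [dw ew] := hw n Z DZ.
have sE : eval s Z = eval (P ord0 ord0) Z -
    \sum_a eval (P ord0 (lift ord0 a)) Z *m eval (u a) Z by rewrite esubE esumE.
have ds : dom s Z by split=> //; split=> //; apply: esum_dom.
have us : eval s Z \in unitmx.
  apply: accretive_unit => v v0.
  (* The lower rows annihilate (v, - u v), so accretivity of the system at this vector is
     accretivity of [s] at [v]. *)
  pose y b := if unlift ord0 b is Some a then - (eval (u a) Z *m v) else v.
  have y0 : y ord0 = v by rewrite /y unlift_none.
  have yl b : y (lift ord0 b) = - (eval (u b) Z *m v) by rewrite /y liftK.
  have := aP y; rewrite big_ord_recl [X in _ + X]big1 => [|a _].
    rewrite addr0 y0 big_ord_recl y0.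
    rewrite (_ : _ + _ = eval s Z *m v).
      by apply; exists ord0; rewrite y0.
    rewrite sE mulmxBl mulmx_suml -sumrN; congr (_ + _); apply: eq_bigr => a _.
    by rewrite yl mulmxN mulmxA.
  rewrite big_ord_recl y0 -eu mulmx_suml -big_split big1 ?cdot0r//= => b _.
  by rewrite yl mulmxN mulmxA subrr.
have dx0 : dom x0 Z by split=> //; split=> //; split=> //; apply: esum_dom.
have x0E : eval s Z *m eval x0 Z = eval (c ord0) Z -
    \sum_a eval (P ord0 (lift ord0 a)) Z *m eval (w a) Z.
  by rewrite -(esumE (fun a => EMul (P ord0 (lift ord0 a)) (w a))) -esubE mulKVmx.
clearbody x0; split=> [b|b]; first by case: unliftP => [a _|_] //; split.
rewrite big_ord_recl unlift_none.
under eq_bigr do rewrite liftK esubE mulmxBr.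
rewrite sumrB; case: (unliftP ord0 b) => [a ->|->].
  rewrite ew -eu mulmx_suml addrC -addrA -sumrN -big_split big1 ?addr0// => e _ /=.
  by rewrite mulmxA addNr.
rewrite addrC -addrA.
move/(congr1 (fun M => M + \sum_a eval (P ord0 (lift ord0 a)) Z *m eval (w a) Z)): x0E.
rewrite subrK => <-; rewrite addrC; congr (_ + _).
rewrite sE mulmxBl mulmx_suml addrC; congr (_ - _).
by apply: eq_bigr => e _; rewrite /= mulmxA.
Qed.

End Expressions.

(** * The Cayley transform of a Herglotz function *)

Section Cayley.
Context {R : realType} {d : nat}.
Local Notation C := R[i].
Local Notation Re := (@complex.Re R).
Local Notation expr := (@ncexpr R d).
Local Notation eval := ncexpr_eval.
Local Notation dom := ncexpr_dom.

Lemma cdotBr n (u v w : 'cV[C]_n) : cdot u (v - w) = cdot u v - cdot u w.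
Proof. by rewrite /cdot mulmxBr mxE [X in _ + X]mxE. Qed.

Lemma cdotDl n (u v w : 'cV[C]_n) : cdot (v + w) u = cdot v u + cdot w u.
Proof. by rewrite /cdot linearD /= map_mxD mulmxDl mxE. Qed.

Lemma cdotBl n (u v w : 'cV[C]_n) : cdot (v - w) u = cdot v u - cdot w u.
Proof. by rewrite /cdot linearB /= map_mxB mulmxBl mxE [X in _ + X]mxE. Qed.

Lemma cdotC n (u v : 'cV[C]_n) : cdot v u = (cdot u v)^*%C.
Proof.
rewrite !cdotE rmorph_sum; apply: eq_bigr => i _.
by rewrite rmorphM /= conjcK mulrC.
Qed.

Lemma cdot_gt0 n (v : 'cV[C]_n) : v != 0 -> 0 < Re (cdot v v).
Proof. by move=> v0; rewrite /cdot dotmx_col; exact: sum_normc_gt0. Qed.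

Definition cayley (h : expr) : expr :=
  EMul (esub h (EConst 1)) (EInv (EAdd h (EConst 1))).

Section Value.
Context (n : nat) (M : 'M[C]_n) (M0 : forall v, 0 <= Re (cdot v (M *m v))).

Lemma cayley_unit : M + 1%:M \in unitmx.
Proof.
apply: accretive_unit => v v0; rewrite mulmxDl mul1mx cdotDr raddfD /=.
by rewrite ltr_wpDl// cdot_gt0.
Qed.

Local Notation B := ((M - 1%:M) *m invmx (M + 1%:M)).

Lemma cayley_sub1 : 1%:M - B = 2 *: invmx (M + 1%:M).
Proof.
rewrite -{1}(mulmxV cayley_unit) -mulmxBl opprB addrC addrA subrK.
by rewrite -(mulr2n (1%:M : 'M_n)) -scaler_nat -scalemxAl mul1mx.
Qed.

Lemma cayley_sub1_unit : 1%:M - B \in unitmx.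
Proof.
by rewrite cayley_sub1 unitmxZ ?unitmx_inv ?cayley_unit// unitfE pnatr_eq0.
Qed.

Lemma cayleyK : (1%:M + B) *m invmx (1%:M - B) = M.
Proof.
apply: (canLR (mulmxK cayley_sub1_unit)); rewrite cayley_sub1.
rewrite -{1}(mulmxV cayley_unit) -mulmxDl addrACA subrr addr0 -mulr2n.
by rewrite -scaler_nat -scalemxAl -scalemxAr.
Qed.

(** With u = (M + 1)^-1 v, the difference |M u + u|^2 - |M u - u|^2 is 4 Re <u, M u>. *)
Lemma cayley_contraction v : cdot (B *m v) (B *m v) <= cdot v v.
Proof.
pose u := invmx (M + 1%:M) *m v.
have -> : B *m v = M *m u - u by rewrite -mulmxA mulmxBl mul1mx.
have -> : v = M *m u + u.
  by rewrite -{2}(mul1mx u) -mulmxDl mulKVmx// cayley_unit.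
rewrite -subr_ge0 !(cdotBr, cdotBl, cdotDr, cdotDl) [cdot (M *m u) u]cdotC.
have := M0 u; case: (cdot u (M *m u)) => a b /= a0.
rewrite (_ : _ - _ = (4 * a)%:C); first by rewrite (lecR 0) mulr_ge0.
case: (cdot (M *m u) _) (cdot u u) => [e f] [g k]; apply/eqP.
by rewrite eq_complex /=; apply/andP; split; apply/eqP; ring.
Qed.

End Value.

Lemma cayley_symbol (mu : bop (@fock R d) (@fock R d) -> C) (h : expr) :
  (forall n (Z : mxtuple n), row_ball Z -> dom h Z /\ eval h Z = herglotz mu Z) ->
  (forall n (Z : mxtuple n) v, row_ball Z -> 0 <= Re (cdot v (herglotz mu Z *m v))) ->
  complex.Im (herglotz mu (fun=> 0 : 'M[C]_1) 0 0) = 0 ->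
  rational_clark_symbol mu (fun n Z => eval (cayley h) Z).
Proof.
move=> hh h0 hr.
have bE n (Z : mxtuple n) : row_ball Z -> eval (cayley h) Z =
    (herglotz mu Z - 1%:M) *m invmx (herglotz mu Z + 1%:M).
  by move=> /hh[_ hE]; rewrite -hE -[X in _ - X]/(eval (EConst 1) Z) -esubE.
have db n (Z : mxtuple n) : row_ball Z -> dom (cayley h) Z.
  move=> bZ; have [dh hE] := hh n Z bZ; split; first by split.
  by split; [split|rewrite /= hE; apply: cayley_unit => v; exact: h0].
have b0 := @row_ball0 R d 1.
have hu n (Z : mxtuple n) : row_ball Z -> 1%:M - eval (cayley h) Z \in unitmx.
  by move=> bZ; rewrite bE//; apply: cayley_sub1_unit => v; exact: h0.
have hM n (Z : mxtuple n) : row_ball Z ->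
    (1%:M + eval (cayley h) Z) *m invmx (1%:M - eval (cayley h) Z) = herglotz mu Z.
  by move=> bZ; rewrite bE// cayleyK// => v; exact: h0.
split.
- split.
    split=> [m n Z W bZ bW|n Z S uS bZ _].
      exact: ncexpr_eval_block (db _ _ bZ) (db _ _ bW).
    exact: ncexpr_eval_conj uS (db _ _ bZ).
  move=> n Z bZ v; rewrite bE//; apply: cayley_contraction => u; exact: h0.
- by exists (cayley h) => n Z bZ; split; [exact: db|].
- split.
    exists 1%N, (fun=> 0); split=> // b1; have := hu _ _ b0.
    by rewrite b1 subrr unitmxE det0 unitr0.
  move=> n Z bZ; split; first exact: hu.
  rewrite hM// (_ : complex.Im _ = 0) ?raddf0 ?addr0//.
  rewrite -[RHS]hr -(hM _ _ b0); congr complex.Im.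
  have := hu _ _ b0; set B := eval _ _ => uB.
  (* Matrices of size 1 are scalars, which identifies the quotient defining [t] with the value of
     H_mu at 0, a real number; so this symbol has t = 0. *)
  have sc (c : C) : 1%:M + c *: B = (1 + c * B 0 0)%:M.
    by rewrite {1}[B]mx11_scalar scale_scalar_mx -raddfD.
  have := sc 1; have := sc (- 1); rewrite scaleN1r scale1r mulN1r mul1r => -> ->.
  by rewrite invmx_scalar -scalar_mxM [RHS]mxE.
Qed.

End Cayley.

(** * Realization on the cyclic space *)

Section Realization.
Context {R : realType} {d : nat}.
Local Notation C := R[i].
Local Notation H2 := (@fock R d).
Local Notation Re := (@complex.Re R).
Context (mu : bop H2 H2 -> C) (hmu : positive_ncmeasure mu)
  (K : hilbertType R) (iota : {linear ncpoly R d -> K}) (Pi : 'I_d -> bop K K).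
Hypothesis hgns : is_gns mu iota Pi.
Local Notation xi := (iota 1).
Local Notation X := (pencil (fun k => adj (Pi k))).
Local Notation eval := ncexpr_eval.
Local Notation dom := ncexpr_dom.

Lemma gns_pencil_contraction n (Z : @mxtuple R d n) : row_ball Z ->
  exists2 r : R, 0 <= r < 1 & forall x : 'I_n -> K,
    \sum_i hnorm (mxapp (X Z) x i) ^+ 2 <= r ^+ 2 * \sum_i hnorm (x i) ^+ 2.
Proof.
move=> bZ; have [r r01 hr] := row_ball_strict bZ; exists r => // x.
apply: pencil_contraction (hr K) x.
by move=> y; apply/row_contraction_adj/row_isometry_contraction/(gns_row_isometry hgns).
Qed.

Lemma mxapp_sub1 n (Z : @mxtuple R d n) (x : 'I_n -> K) i :
  mxapp (1%:M - X Z) x i = x i - mxapp (X Z) x i.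
Proof.
rewrite -[in X in _ = X - _](mxapp1 x) /mxapp -sumrB; apply: eq_bigr => j _.
by rewrite mxE [X in _ + X]mxE.
Qed.

(** With y = v xi and w = (1 - X)^-1 y, the real part is sum_i (|w_i|^2 - |(X w)_i|^2), and the
    pencil X is a contraction. *)
Lemma herglotz_accretive n (Z : @mxtuple R d n) v : row_ball Z ->
  0 <= Re (cdot v (herglotz mu Z *m v)).
Proof.
move=> bZ; have [r r01 hX] := gns_pencil_contraction bZ.
have [Y [Y1 _] ->] := herglotzE hmu hgns bZ.
pose y (i : 'I_n) := v i 0 *: xi; pose w := mxapp Y y.
have wy i : y i = w i - mxapp (X Z) w i.
  by rewrite -mxapp_sub1 -mxapp_mul Y1 mxapp1.
have -> : Re (cdot v ((\matrix_(i, j) (2 * dotp xi (Y i j xi) -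
      (i == j)%:R * (hnorm xi ^+ 2)%:C)) *m v)) =
    \sum_i (2 * Re (dotp (y i) (w i)) - hnorm (y i) ^+ 2).
  rewrite cdotE raddf_sum; apply: eq_bigr => i _ /=.
  have -> : 2 * Re (dotp (y i) (w i)) - hnorm (y i) ^+ 2 =
      Re (2 * dotp (y i) (w i) - dotp (y i) (y i)).
    rewrite hnorm_sqr raddfB; congr (_ - _).
    by rewrite -Re_rmul rmorphMn rmorph1.
  congr (Re _); rewrite mxE /w /mxapp dotp_sumr [2 * _]mulr_sumr.
  have -> : \sum_j (\matrix_(i, j) (2 * dotp xi (Y i j xi) -
      (i == j)%:R * (hnorm xi ^+ 2)%:C)) i j * v j 0 =
      \sum_j 2 * dotp xi (Y i j (y j)) - (hnorm xi ^+ 2)%:C * v i 0.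
    have -> : (hnorm xi ^+ 2)%:C * v i 0 =
        \sum_j (i == j)%:R * (hnorm xi ^+ 2)%:C * v j 0.
      rewrite (bigD1 i)//= eqxx mul1r big1 ?addr0// => j ji.
      by rewrite eq_sym (negbTE ji) !mul0r.
    rewrite -sumrB; apply: eq_bigr => j _; rewrite mxE [Y i j (y j)]linearZ dotpZr mulrBl.
    by congr (_ - _); rewrite -mulrA [_ * v j 0]mulrC.
  rewrite mulrBr mulr_sumr; congr (_ - _).
    by apply: eq_bigr => j _; rewrite dotpZl mulrCA.
  by rewrite dotpZl dotpZr dotpxx [_ * v i 0]mulrC.
apply: le_trans (_ : \sum_i (hnorm (w i) ^+ 2 - hnorm (mxapp (X Z) w i) ^+ 2) <= _).
  rewrite sumrB subr_ge0; apply: le_trans (hX w) _.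
  have /andP[r0 r1] := r01; rewrite ler_piMl ?sumr_ge0// => [i _|]; first exact: sqr_ge0.
  by rewrite expr_le1// ltW.
apply: ler_sum => i _.
have -> : mxapp (X Z) w i = w i - y i by rewrite wy subKr.
rewrite hnormB_sqr dotpC /= (_ : Re _^*%C = Re (dotp (y i) (w i))); last by case: dotp.
by lra.
Qed.

Lemma herglotz0_real : complex.Im (herglotz mu (fun=> 0 : 'M[C]_1) 0 0) = 0.
Proof.
have b0 := @row_ball0 R d 1.
have [Y [Y1 _] ->] := herglotzE hmu hgns b0; rewrite mxE.
have XE : X (fun _ : 'I_d => 0 : 'M[C]_1) = 0.
  by apply/matrixP => i j; rewrite !mxE big1// => k _; rewrite scale0r.
move: Y1; rewrite XE subr0 mul1mx => ->; rewrite mxE eqxx mul1r bop1E dotpxx.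
by rewrite (_ : _ - _ = (hnorm xi ^+ 2)%:C)//; ring.
Qed.

Lemma gns_cyclic_basis : finitely_correlated iota Pi ->
  exists m (f : 'I_m -> K), [/\ orthonormal_family f,
    forall j a, expands f (adj (Pi j) (f a)) & expands f xi].
Proof.
move=> [n [e he]]; have [m [f [fo fe fM]]] := Gram_Schmidt (fun a => val (e a)).
have fx x : gns_cyclic iota Pi x -> expands f x.
  move=> hx; have [c /(congr1 val)] := he (SubHilb (asboolT hx)).
  rewrite subhilb_val_sum /= => ->; apply: subspace_sum => //.
  exact: expands_subspace.
have fm a : gns_cyclic iota Pi (f a).
  apply: (fM (gns_cyclic iota Pi)) => [|i]; last exact: subhilb_in.
  by split; [exact: cls0|exact: clsP].
exists m, f; split=> // [j a|]; first by apply/fx/gns_cyclic_adj/fm.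
exact/fx/gns_cyclic_vacuum.
Qed.

Section Basis.
Context (m : nat) (f : 'I_m -> K) (fo : orthonormal_family f)
  (fPi : forall j a, expands f (adj (Pi j) (f a))) (fxi : expands f xi).

(** The matrix of 1 - X on H_mu in the basis [f], with the variables in place of [Z]. *)
Definition realization_entry (a b : 'I_m) : @ncexpr R d :=
  esub (EConst (a == b)%:R)
    (esum (fun j => EMul (EConst (dotp (f a) (adj (Pi j) (f b)))) (EVar j))).

Definition embed_col n (x : 'I_m -> 'cV[C]_n) (i : 'I_n) : K :=
  \sum_a x a i 0 *: f a.

Lemma dotp_embed_col n (x : 'I_m -> 'cV[C]_n) i a :
  dotp (f a) (embed_col x i) = x a i 0.
Proof. exact: orthonormal_sum. Qed.

Lemma realization_entryE n (Z : @mxtuple R d n) (x : 'I_m -> 'cV[C]_n) a i :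
  (\sum_b eval (realization_entry a b) Z *m x b) i 0 =
  dotp (f a) (mxapp (1%:M - X Z) (embed_col x) i).
Proof.
rewrite mxapp_sub1 dotpBr dotp_embed_col pencilE summxE.
have -> : dotp (f a) (\sum_k \sum_j Z k i j *: adj (Pi k) (embed_col x j)) =
    \sum_b \sum_k \sum_j dotp (f a) (adj (Pi k) (f b)) * (Z k i j * x b j 0).
  rewrite dotp_sumr exchange_big; apply: eq_bigr => k _ /=.
  rewrite dotp_sumr exchange_big; apply: eq_bigr => j _ /=.
  rewrite dotpZr linear_sum dotp_sumr mulr_sumr; apply: eq_bigr => b _.
  by rewrite linearZ dotpZr; ring.
have -> : x a i 0 = \sum_b (a == b)%:R * x b i 0.
  rewrite (bigD1 a)//= eqxx mul1r big1 ?addr0// => b ba.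
  by rewrite eq_sym (negbTE ba) mul0r.
rewrite -sumrB; apply: eq_bigr => b _.
rewrite esubE mulmxBl mul_scalar_mx esumE mulmx_suml mxE [X in X + _]mxE.
rewrite [X in _ + X]mxE summxE; congr (_ - _); apply: eq_bigr => k _ /=.
by rewrite mul_scalar_mx -scalemxAl mxE -mulr_sumr; congr (_ * _); rewrite mxE.
Qed.

(** 2 Re <k, (1 - X) k> = |k|^2 - |X k|^2 + |k - X k|^2, which is at least (1 - r^2) |k|^2. *)
Lemma realization_accretive n (Z : @mxtuple R d n) : row_ball Z ->
  accretive_system (fun a b => eval (realization_entry a b) Z).
Proof.
move=> bZ x [a xa]; have [r r01 hX] := gns_pencil_contraction bZ.
pose k := embed_col x.
have -> : \sum_a cdot (x a) (\sum_b eval (realization_entry a b) Z *m x b) =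
    \sum_i dotp (k i) (mxapp (1%:M - X Z) k i).
  transitivity (\sum_a \sum_i (x a i 0)^*%C *
      dotp (f a) (mxapp (1%:M - X Z) k i)).
    apply: eq_bigr => b _; rewrite cdotE; apply: eq_bigr => i _.
    by rewrite realization_entryE.
  rewrite exchange_big; apply: eq_bigr => i _ /=; rewrite dotp_suml.
  by apply: eq_bigr => b _; rewrite dotpZl.
pose N := \sum_i hnorm (k i) ^+ 2.
have N0 : 0 < N.
  have [i xi0] := col_neq0 xa.
  rewrite /N (bigD1 i)//= ltr_pwDl//; last by apply: sumr_ge0 => j _; exact: sqr_ge0.
  rewrite exprn_gt0// lt_neqAle hnorm_ge0 eq_sym andbT.
  apply: contra xi0 => /eqP/hnorm_eq0 ki.
  by rewrite -(dotp_embed_col x i a) -/(k i) ki dotp0r.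
have : (1 - r ^+ 2) * N <= 2 * Re (\sum_i dotp (k i) (mxapp (1%:M - X Z) k i)).
  apply: le_trans (_ : N - \sum_i hnorm (mxapp (X Z) k i) ^+ 2 <= _).
    by rewrite mulrBl mul1r lerD2l lerN2; exact: hX.
  rewrite [Re _]raddf_sum mulr_sumr /N -sumrB; apply: ler_sum => i _ /=.
  rewrite mxapp_sub1 dotpBr raddfB /= -hnorm_sqr.
  have := hnormB_sqr (k i) (mxapp (X Z) k i).
  have := sqr_ge0 (hnorm (k i - mxapp (X Z) k i)).
  by move=> /= h1 h2; lra.
have /andP[r0 r1] := r01; have : 0 < (1 - r ^+ 2) * N.
  by rewrite mulr_gt0// subr_gt0 expr_lt1.
by move=> h1 h2; lra.
Qed.

(** The l-th columns of the solution, read in the basis [f], give a vector k with (1 - X) k equal to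
    [xi] in position [l] and 0 elsewhere; the resolvent then returns k. *)
Lemma realization_solution n (Z : @mxtuple R d n) (x : 'I_m -> 'M[C]_n) Y :
  resolvent_of Pi Z Y ->
  (forall a, \sum_b eval (realization_entry a b) Z *m x b = (dotp (f a) xi)%:M) ->
  forall i l, dotp xi (Y i l xi) = \sum_a dotp xi (f a) * x a i l.
Proof.
move=> [_ Y2] hx i l; have [f0 fP] := expands_subspace f.
pose k := embed_col (fun a => col l (x a)).
have fk j : expands f (k j) by exact: orthonormal_sum_expands.
have ek j : mxapp (1%:M - X Z) k j = (j == l)%:R *: xi.
  have fe : expands f (mxapp (1%:M - X Z) k j).
    rewrite mxapp_sub1 addrC -scaleN1r; apply: (fP) => //.
    rewrite /mxapp; apply: (big_ind (expands f)) => // [u v fu fv|b _].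
      by rewrite -[u]scale1r; exact: fP.
    rewrite mxE bop_sumE; apply: subspace_sum => // j'.
    exact: (expands_linear (fPi j')).
  rewrite fe [in RHS]fxi scaler_sumr; apply: eq_bigr => a _.
  rewrite scalerA; congr (_ *: _); rewrite -realization_entryE.
  rewrite (eq_bigr (fun b => col l (eval (realization_entry a b) Z *m x b))) => [|b _].
    rewrite -[\sum_b col _ _](raddf_sum (col l)) hx !mxE.
    by case: (j == l); rewrite ?mulr1n ?mul1r ?mulr0n ?mul0r.
  by rewrite !colE mulmxA.
have -> : Y i l xi = k i.
  rewrite -(mxapp1 k) -Y2 mxapp_mul (funext ek) /mxapp (bigD1 l)//= big1 => [|j jl].
    by rewrite eqxx scale1r addr0.
  by rewrite (negbTE jl) scale0r linear0.
by rewrite dotp_sumr; apply: eq_bigr => a _; rewrite dotpZr mxE mulrC.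
Qed.

Lemma rational_symbol_of_basis : exists b, rational_clark_symbol mu b.
Proof.
have [x hx] : exists x : 'I_m -> @ncexpr R d, forall n (Z : mxtuple n), row_ball Z ->
    (forall a, dom (x a) Z) /\
    forall a, \sum_b eval (realization_entry a b) Z *m eval (x b) Z =
      (dotp (f a) xi)%:M.
  apply: (accretive_solve (D := fun n Z => row_ball Z)
    (c := fun a => EConst (dotp (f a) xi))) => n Z bZ.
  split=> //; last exact: realization_accretive.
  by move=> a b; split=> //; split=> //; apply: esum_dom.
(* H_mu as an expression: twice the solution paired with [xi], minus |xi|^2. *)
pose h := esub (esum (fun a => EMul (EConst (2 * dotp xi (f a))) (x a)))
  (EConst (hnorm xi ^+ 2)%:C).
exists (fun n Z => eval (cayley h) Z); apply: cayley_symbol => [n Z bZ|n Z v bZ|].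
- have [dx ex] := hx n Z bZ; split.
    by split; [apply: esum_dom|split].
  have [Y rY ->] := herglotzE hmu hgns bZ; rewrite esubE esumE.
  apply/matrixP => i l; rewrite [RHS]mxE [LHS]mxE summxE; congr (_ + _).
    rewrite (realization_solution rY ex) mulr_sumr; apply: eq_bigr => a _ /=.
    by rewrite mul_scalar_mx mxE mulrA.
  by rewrite !mxE; case: (i == l); rewrite ?mulr1n ?mul1r ?mulr0n ?mul0r.
- exact: herglotz_accretive.
- exact: herglotz0_real.
Qed.

End Basis.

Lemma rational_symbol_exists : finitely_correlated iota Pi ->
  exists b, rational_clark_symbol mu b.
Proof.
by move=> /gns_cyclic_basis[m [f [fo fPi fxi]]]; exact: rational_symbol_of_basis fo fPi fxi.
Qed.

Lemma cuntz_inner_multiplier b : finitely_correlated iota Pi -> cuntz Pi ->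
  is_clark_measure b mu -> inner_multiplier b.
Proof.
move=> /gns_cyclic_basis[m [f [fo fPi fxi]]] cPi hb h.
have [t ht] := clark_transfer hmu hgns hb.
exists (tfock xi t (row_isometry_contraction (gns_row_isometry hgns)) h).
  by move=> n Z; exact: ht.
exact: (tfock_isometric cPi t fPi fxi (@gns_total _ _ _ _ _ _ hgns)).
Qed.

End Realization.

(** * The cycle of implications *)

Theorem corollary1 (R : realType) (d : nat) (hd : (2 <= d)%N)
    (mu : bop (@fock R d) (@fock R d) -> R[i]) (hmu : positive_ncmeasure mu)
    (K : hilbertType R) (iota : {linear ncpoly R d -> K})
    (Pi : 'I_d -> bop K K) (hgns : is_gns mu iota Pi)
    (hfc : finitely_correlated iota Pi) :
  [<-> clark_symbol_inner mu;
       cuntz Pi;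
       finite_dim (subhilb (gns_cyclic iota Pi)) /\
         row_coisometry (gns_row iota Pi);
       dilation_type Pi;
       singular_row Pi].
Proof.
have iPi := gns_row_isometry hgns.
have fPi := gns_finitely_correlated hgns hfc.
tfae.
- move=> [[b hb] /(_ b hb)]; have [_ _ cb] := hb.
  exact: (inner_multiplier_cuntz hmu hgns cb).
- move=> cPi; split; [exact: hfc|exact: (cuntz_gns_row iota cPi)].
- move=> [_ /(gns_row_cuntz hgns) cPi].
  exact: (finitely_correlated_dilation_type hd (fPi cPi)).
- by move=> [cPi _]; exact: (finitely_correlated_singular hd (fPi cPi)).
(* [clark_symbol_inner] has two halves: a rational symbol exists, and every such symbol is inner. *)
- move=> /(singular_row_cuntz iPi) cPi; split.
    exact: (rational_symbol_exists hmu hgns hfc).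
  by move=> b [_ _ hb]; exact: (cuntz_inner_multiplier hmu hgns hfc cPi hb).
Qed.
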